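(* Let $\mathcal{O}$ be an order in an imaginary quadratic field with discriminant $\Delta$, and suppose $|\Delta|>12$. Let $\tau=\sqrt{\Delta}/2$ if $\Delta$ is even and $\tau=(1+\sqrt{\Delta})/2$ if $\Delta$ is odd. Let $N$ be the subgroup of $\mathrm{PE}_2(\mathcal{O})$ generated by $r$, $s(1)$, and $s(\tau)rs(\tau)^{-1}$, and let $\Gamma\le\mathrm{PSL}_2(\mathcal{O})$ be the subgroup (depending on $\mathcal{O}$) generated by the matrices pairing those faces of the Ford domain $\mathcal{F}$ of $\mathrm{PSL}_2(\mathcal{O})$ that lie at least partially below the Euclidean plane $t=2/3$. Then $N$ is a subgroup of both $\mathrm{PE}_2(\mathcal{O})$ and $\Gamma$, and $$\mathrm{PSL}_2(\mathcal{O})\simeq\mathrm{PE}_2(\mathcal{O})*_N\Gamma$$ is a nontrivial free product with amalgamation (that is, $N\neq\mathrm{PE}_2(\mathcal{O})$ and $N\neq\Gamma$).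
   Context: $\mathrm{PE}_2(\mathcal{O})$, the projective elementary group, is the subgroup of $\mathrm{PSL}_2(\mathcal{O})$ generated by the (classes of) elementary matrices, i.e. the diagonal, (upper or lower) triangular, or permutation matrices in $\mathrm{PSL}_2(\mathcal{O})$. Notation for elements of $\mathrm{PSL}_2(\mathcal{O})$: $r=\begin{bmatrix}0&-1\\1&0\end{bmatrix}$ and $s(\alpha)=\begin{bmatrix}1&\alpha\\0&1\end{bmatrix}$ for $\alpha\in\mathcal{O}$. The order $\mathcal{O}$ is not assumed to be maximal. $\mathbb{H}=\{(\zeta,t)\mid\zeta\in\mathbb{C},\ t\in(0,\infty)\}$ is the upper half-space model of hyperbolic 3-space with the usual action of $\mathrm{PSL}_2(\mathbb{C})$; $\zeta(P)$ and $t(P)$ denote the coordinates of $P\in\mathbb{H}$. Let $\overline F\subset\mathbb{C}$ be the closed rectangle $\{|\mathrm{Re}\,\zeta|\le 1/2,\ 0\le\mathrm{Im}\,\zeta\le\sqrt{|\Delta|}/2\}$ centered at $\sqrt{\Delta}/4$, a fundamental polygon for the translation action of $\mathcal{O}$ on $\mathbb{C}$. The Ford domain of $\mathrm{PSL}_2(\mathcal{O})$ is $$\mathcal{F}=\{P\in\mathbb{H}\mid\zeta(P)\in\overline F,\ t(P)\ge t(gP)\text{ for all }g\in\mathrm{PSL}_2(\mathcal{O})\},$$ a fundamental polyhedron for $\mathrm{PSL}_2(\mathcal{O})$. The face-pairing matrices of $\mathcal{F}$ are the elements $g\neq 1$ of $\mathrm{PSL}_2(\mathcal{O})$ for which $\mathcal{F}\cap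 g\mathcal{F}$ is two-dimensional; the corresponding face is $\mathcal{F}\cap g\mathcal{F}$, and it lies at least partially below $t=2/3$ if it contains a point $P$ with $t(P)<2/3$. For groups $A$, $B$ with a common subgroup $N$, $A*_NB$ denotes the free product of $A$ and $B$ amalgamated along $N$; the amalgam is nontrivial if $N\ne A$ and $N\ne B$. *)

(* Defs.v *)
From HB Require Import structures.
From mathcomp Require Import all_boot all_order perm all_algebra.
From mathcomp Require Import generic_quotient.
From mathcomp Require Import boolp classical_sets reals complex.

Set Implicit Arguments.
Unset Strict Implicit.
Unset Printing Implicit Defensive.

Import Order.TTheory GRing.Theory Num.Theory.

Local Open Scope quotient_scope.
Local Open Scope group_scope.

Section Subgroups.
Variable G : groupType.

Record subgroup_type (A : groupClosed G) :=
  SubgroupElt { sgval :> G; _ : sgval \in A }.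

HB.instance Definition _ (A : groupClosed G) :=
  [isSub of subgroup_type A for @sgval A].
HB.instance Definition _ (A : groupClosed G) :=
  [Choice of subgroup_type A by <:].

Lemma subgroup_type_closed (A : groupClosed G) :
  group_closed [pred x | x \in A].
Proof. exact: (conj (@gpred1 G A) (@gpredF G A)). Qed.

HB.instance Definition _ (A : groupClosed G) :=
  SubChoice_isSubGroup.Build G (fun x => x \in A) (subgroup_type A)
    (subgroup_type_closed A).

Definition group_closed_pack (A : {pred G}) (cA : group_closed A) :
    groupClosed G :=
  GroupClosed.Pack (GroupClosed.Class
    (isInvClosed.Build G A (group_closedV cA))
    (isMul1Closed.Build G A (proj1 cA))
    (isMulClosed.Build G A (group_closedM cA))).

Definition gen_pred (S : set G) : {pred G} :=
  fun x => `[< forall A : {pred G},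
                 group_closed A -> (forall y, S y -> y \in A) -> x \in A >].

Lemma gen_pred_closed (S : set G) : group_closed (gen_pred S).
Proof.
split; first by apply/asboolP => A [].
move=> x y /asboolP Sx /asboolP Sy; apply/asboolP => A cA SA.
by case: (cA) => _; apply; [exact: Sx | exact: Sy].
Qed.

Definition gen (S : set G) : groupClosed G :=
  group_closed_pack (gen_pred_closed S).

End Subgroups.

(* The free product with amalgamation of two subgroups A and B of a group G
   along N: words in A + B, modulo the congruence generated by the
   multiplication tables of A and B and by identifying the copy in A and the
   copy in B of each element of N. *)
Section Amalgam.
Variables (G : groupType) (A B N : groupClosed G).

Definition amalgam_word := seq (subgroup_type A + subgroup_type B).

Inductive amalgam_cong : amalgam_word -> amalgam_word -> Prop :=
| AmalgRefl w : amalgam_cong w w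
| AmalgSym w1 w2 : amalgam_cong w1 w2 -> amalgam_cong w2 w1
| AmalgTrans w1 w2 w3 :
    amalgam_cong w1 w2 -> amalgam_cong w2 w3 -> amalgam_cong w1 w3
| AmalgCat v1 v2 w1 w2 :
    amalgam_cong v1 v2 -> amalgam_cong w1 w2 ->
    amalgam_cong (v1 ++ w1) (v2 ++ w2)
| AmalgOneL : amalgam_cong [:: inl 1] [::]
| AmalgOneR : amalgam_cong [:: inr 1] [::]
| AmalgMulL a a' : amalgam_cong [:: inl a; inl a'] [:: inl (a * a')]
| AmalgMulR b b' : amalgam_cong [:: inr b; inr b'] [:: inr (b * b')]
| AmalgGlue a b :
    val a = val b -> val a \in N -> amalgam_cong [:: inl a] [:: inr b].

Definition amalgam_rel (w1 w2 : amalgam_word) := `[< amalgam_cong w1 w2 >].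

Lemma amalgam_rel_equiv : equiv_class_of amalgam_rel.
Proof.
split.
- by move=> w; apply/asboolP; exact: AmalgRefl.
- by move=> v w; apply/idP/idP => /asboolP vw; apply/asboolP; exact: AmalgSym.
- move=> u v w /asboolP vu /asboolP uw; apply/asboolP.
  exact: AmalgTrans vu uw.
Qed.

Canonical amalgam_equiv := EquivRelPack amalgam_rel_equiv.

Definition amalgam := {eq_quot amalgam_rel}.

HB.instance Definition _ := EqQuotient.on amalgam.
HB.instance Definition _ := Choice.on amalgam.

Lemma amalgam_piP (v w : amalgam_word) :
  reflect (\pi_amalgam v = \pi_amalgam w) (amalgam_rel v w).
Proof. exact: eqquotP. Qed.

Lemma amalgam_reprP (w : amalgam_word) :
  amalgam_cong (repr (\pi_amalgam w)) w.
Proof. by apply/asboolP/amalgam_piP; rewrite reprK. Qed.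

Definition amalgam_letter_inv (x : subgroup_type A + subgroup_type B) :
    subgroup_type A + subgroup_type B :=
  match x with inl a => inl a^-1 | inr b => inr b^-1 end.

Definition amalgam_word_inv (w : amalgam_word) : amalgam_word :=
  rev (map amalgam_letter_inv w).

Definition amalgam_mul (x y : amalgam) : amalgam :=
  \pi_amalgam (repr x ++ repr y).
Definition amalgam_one : amalgam := \pi_amalgam [::].
Definition amalgam_inv (x : amalgam) : amalgam :=
  \pi_amalgam (amalgam_word_inv (repr x)).

Lemma amalgam_mulE v w :
  amalgam_mul (\pi_amalgam v) (\pi_amalgam w) = \pi_amalgam (v ++ w).
Proof.
by apply/amalgam_piP/asboolP/AmalgCat; exact: amalgam_reprP.
Qed.

Lemma amalgam_mulA : associative amalgam_mul.
Proof.
elim/quotW=> x; elim/quotW=> y; elim/quotW=> z.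
by rewrite (amalgam_mulE y z) (amalgam_mulE x y) !amalgam_mulE catA.
Qed.

Lemma amalgam_mul1 : left_id amalgam_one amalgam_mul.
Proof. by elim/quotW=> x; rewrite amalgam_mulE. Qed.

Lemma amalgam_mulr1 : right_id amalgam_one amalgam_mul.
Proof. by elim/quotW=> x; rewrite amalgam_mulE cats0. Qed.

Lemma amalgam_letter_invK : involutive amalgam_letter_inv.
Proof. by case=> a /=; rewrite invgK. Qed.

Lemma amalgam_word_invK : involutive amalgam_word_inv.
Proof.
move=> w; rewrite /amalgam_word_inv map_rev revK -map_comp.
by rewrite (eq_map amalgam_letter_invK) map_id.
Qed.

Lemma amalgam_cong_mulV w : amalgam_cong (w ++ amalgam_word_inv w) [::].
Proof.
elim: w => [|x w IHw]; first exact: AmalgRefl.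
rewrite /amalgam_word_inv /= rev_cons -cats1 catA -/(amalgam_word_inv w).
apply: (@AmalgTrans _ ([:: x] ++ [:: amalgam_letter_inv x])).
  apply: (AmalgCat (AmalgRefl [:: x])).
  exact: (AmalgCat IHw (AmalgRefl [:: amalgam_letter_inv x])).
case: x => a /=.
- by apply: AmalgTrans (AmalgMulL _ _) _; rewrite mulgV; exact: AmalgOneL.
- by apply: AmalgTrans (AmalgMulR _ _) _; rewrite mulgV; exact: AmalgOneR.
Qed.

Lemma amalgam_mulV : left_inverse amalgam_one amalgam_inv amalgam_mul.
Proof.
move=> x; rewrite -{2}[x]reprK amalgam_mulE; apply/amalgam_piP/asboolP.
by rewrite -{2}[repr x]amalgam_word_invK; exact: amalgam_cong_mulV.
Qed.

Lemma amalgam_mulgV : right_inverse amalgam_one amalgam_inv amalgam_mul.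
Proof.
move=> x; rewrite -{1}[x]reprK amalgam_mulE; apply/amalgam_piP/asboolP.
exact: amalgam_cong_mulV.
Qed.

HB.instance Definition _ := isGroup.Build amalgam
  amalgam_mulA amalgam_mul1 amalgam_mulr1 amalgam_mulV amalgam_mulgV.

Definition amalgam_inl (a : subgroup_type A) : amalgam := \pi_amalgam [:: inl a].
Definition amalgam_inr (b : subgroup_type B) : amalgam := \pi_amalgam [:: inr b].

End Amalgam.

Section PSL2.
Variable F : fieldType.
Local Open Scope ring_scope.

Record SL2 := MkSL2 { SL2val :> 'M[F]_2; _ : \det SL2val == 1 }.

HB.instance Definition _ := [isSub of SL2 for SL2val].
HB.instance Definition _ := [Choice of SL2 by <:].

Lemma SL2_det (M : SL2) : \det M = 1.
Proof. exact/eqP/(valP M). Qed.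

Lemma SL2_mul_subproof (M1 M2 : SL2) : \det (M1 *m M2) == 1.
Proof. by rewrite det_mulmx !SL2_det mulr1. Qed.
Lemma SL2_one_subproof : \det (1%:M : 'M[F]_2) == 1.
Proof. by rewrite det1. Qed.
Lemma SL2_inv_subproof (M : SL2) : \det (invmx M) == 1.
Proof. by rewrite det_inv SL2_det invr1. Qed.

Definition SL2_mul M1 M2 : SL2 := MkSL2 (SL2_mul_subproof M1 M2).
Definition SL2_one : SL2 := MkSL2 SL2_one_subproof.
Definition SL2_inv M : SL2 := MkSL2 (SL2_inv_subproof M).

Lemma SL2_unit (M : SL2) : SL2val M \in unitmx.
Proof. by rewrite unitmxE SL2_det unitr1. Qed.

Lemma SL2_mulA : associative SL2_mul.
Proof. by move=> x y z; apply/val_inj; rewrite /= mulmxA. Qed.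
Lemma SL2_mul1 : left_id SL2_one SL2_mul.
Proof. by move=> x; apply/val_inj; rewrite /= mul1mx. Qed.
Lemma SL2_mulr1 : right_id SL2_one SL2_mul.
Proof. by move=> x; apply/val_inj; rewrite /= mulmx1. Qed.
Lemma SL2_mulV : left_inverse SL2_one SL2_inv SL2_mul.
Proof. by move=> x; apply/val_inj; rewrite /= mulVmx ?SL2_unit. Qed.
Lemma SL2_mulgV : right_inverse SL2_one SL2_inv SL2_mul.
Proof. by move=> x; apply/val_inj; rewrite /= mulmxV ?SL2_unit. Qed.

HB.instance Definition _ := isGroup.Build SL2
  SL2_mulA SL2_mul1 SL2_mulr1 SL2_mulV SL2_mulgV.

Definition SL2_pm (M1 M2 : SL2) : bool :=
  (val M1 == val M2) || (val M1 == - val M2).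

Lemma SL2_pm_equiv : equiv_class_of SL2_pm.
Proof.
split.
- by move=> x; rewrite /SL2_pm eqxx.
- by move=> x y; rewrite /SL2_pm eq_sym -eqr_oppLR [- _ == _]eq_sym.
- move=> y x z /orP[/eqP e1|/eqP e1] /orP[/eqP e2|/eqP e2];
    by rewrite /SL2_pm e1 e2 ?opprK eqxx ?orbT.
Qed.

Canonical SL2_pm_equivRel := EquivRelPack SL2_pm_equiv.

Definition PSL2 := {eq_quot SL2_pm}.

HB.instance Definition _ := EqQuotient.on PSL2.
HB.instance Definition _ := Choice.on PSL2.

Lemma PSL2_piP (x y : SL2) : reflect (\pi_PSL2 x = \pi_PSL2 y) (SL2_pm x y).
Proof. exact: eqquotP. Qed.

Lemma PSL2_reprP (x : SL2) : SL2_pm (repr (\pi_PSL2 x)) x.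
Proof. by apply/PSL2_piP; rewrite reprK. Qed.

Definition PSL2_mul (x y : PSL2) : PSL2 := \pi_PSL2 (repr x * repr y)%g.
Definition PSL2_one : PSL2 := \pi_PSL2 1%g.
Definition PSL2_inv (x : PSL2) : PSL2 := \pi_PSL2 (repr x)^-1%g.

Lemma PSL2_mulE x y : PSL2_mul (\pi_PSL2 x) (\pi_PSL2 y) = \pi_PSL2 (x * y)%g.
Proof.
apply/PSL2_piP; rewrite /SL2_pm /=.
case/orP: (PSL2_reprP x) => /eqP ->; case/orP: (PSL2_reprP y) => /eqP ->;
  by rewrite ?mulNmx ?mulmxN ?opprK eqxx ?orbT.
Qed.

Lemma PSL2_mulA : associative PSL2_mul.
Proof.
elim/quotW=> x; elim/quotW=> y; elim/quotW=> z.
by rewrite (PSL2_mulE y z) (PSL2_mulE x y) !PSL2_mulE mulgA.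
Qed.
Lemma PSL2_mul1 : left_id PSL2_one PSL2_mul.
Proof. by elim/quotW=> x; rewrite PSL2_mulE mul1g. Qed.
Lemma PSL2_mulr1 : right_id PSL2_one PSL2_mul.
Proof. by elim/quotW=> x; rewrite PSL2_mulE mulg1. Qed.
Lemma PSL2_mulV : left_inverse PSL2_one PSL2_inv PSL2_mul.
Proof. by move=> x; rewrite -{2}[x]reprK PSL2_mulE mulVg. Qed.
Lemma PSL2_mulgV : right_inverse PSL2_one PSL2_inv PSL2_mul.
Proof. by move=> x; rewrite -{1}[x]reprK PSL2_mulE mulgV. Qed.

HB.instance Definition _ := isGroup.Build PSL2
  PSL2_mulA PSL2_mul1 PSL2_mulr1 PSL2_mulV PSL2_mulgV.

Definition mx2 (a b c d : F) : 'M[F]_2 :=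
  \matrix_(i, j) if i == 0 then (if j == 0 then a else b)
                 else (if j == 0 then c else d).

Lemma det_mx2 a b c d : \det (mx2 a b c d) = a * d - b * c.
Proof.
rewrite (expand_det_row _ 0) !big_ord_recl big_ord0 addr0 /cofactor !det_mx11.
by rewrite !mxE /= expr0 mul1r expr1 mulN1r mulrN.
Qed.

Lemma rot_subproof : \det (mx2 0 (-1) 1 0) == 1.
Proof. by rewrite det_mx2 mul0r mulr1 opprK add0r. Qed.
Lemma shift_subproof a : \det (mx2 1 a 0 1) == 1.
Proof. by rewrite det_mx2 mulr0 mulr1 subr0. Qed.

Definition rot : PSL2 := \pi_PSL2 (MkSL2 rot_subproof).
Definition shift (a : F) : PSL2 := \pi_PSL2 (MkSL2 (shift_subproof a)).

Definition mxin (O : {pred F}) (M : 'M[F]_2) : Prop := forall i j, M i j \in O.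

(* PSL_2(O), as a subgroup of PSL_2(F). *)
Definition PSL2_pred (O : {pred F}) : {pred PSL2} :=
  fun g => `[< exists2 M : SL2, mxin O M & g = \pi_PSL2 M >].

Lemma PSL2_pred_closed (O : subringClosed F) : group_closed (PSL2_pred O).
Proof.
split.
  apply/asboolP; exists 1%g => // i j.
  by rewrite mxE; case: eqP => _; rewrite ?rpred1 ?rpred0.
move=> x y /asboolP[M MO ->] /asboolP[M' MO' ->]; apply/asboolP.
exists (M / M')%g; last first.
  have -> : (\pi_PSL2 M')^-1%g = \pi_PSL2 (M'^-1)%g.
    apply: (mulgI (\pi_PSL2 M')); rewrite mulgV.
    by rewrite [RHS]PSL2_mulE mulgV.
  exact: PSL2_mulE.
have adjO i j : invmx M' i j \in O.
  rewrite /invmx SL2_unit SL2_det invr1 scale1r mxE /cofactor.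
  rewrite rpredM ?rpredX ?rpredN ?rpred1 //.
  by rewrite det_mx11 !mxE.
by move=> i j; rewrite mxE; apply: rpred_sum => k _; apply: rpredM.
Qed.

Definition PSL2_over (O : subringClosed F) : groupClosed PSL2 :=
  group_closed_pack (PSL2_pred_closed O).

(* A permutation matrix is taken up to the signs of its entries: the
   transposition matrix itself has determinant -1, and it is rot that
   represents it in PSL_2. *)
Definition elementary_mx (M : 'M[F]_2) : Prop :=
  [\/ is_diag_mx M, is_trig_mx M, is_trig_mx M^T
    | exists s : 'S_2, forall i j,
        M i j = perm_mx s i j \/ M i j = - perm_mx s i j].

Definition PE2 (O : {pred F}) : groupClosed PSL2 :=
  gen [set g | exists M : SL2, [/\ mxin O M, elementary_mx M & g = \pi_PSL2 M]].

End PSL2.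

Section Orders.
Variable R : realType.
Local Open Scope ring_scope.
Local Notation C := R[i].

(* A subfield K of C with a Q-basis (1, theta), theta not real. *)
Definition imaginary_quadratic_field (K : divringClosed C) : Prop :=
  exists theta : C, theta \isn't Num.real /\
    forall x, x \in K <-> exists p q : rat, x = ratr p + ratr q * theta.

Definition Z_basis (O : {pred C}) (w1 w2 : C) : Prop :=
  (forall m n : int, m%:~R * w1 + n%:~R * w2 = 0 -> m = 0 /\ n = 0) /\
  (forall x, x \in O <-> exists m n : int, x = m%:~R * w1 + n%:~R * w2).

(* A subring of K which is a free Z-module of rank 2 = [K : Q]. *)
Definition is_order (K : divringClosed C) (O : subringClosed C) : Prop :=
  {subset O <= K} /\ exists w1 w2, Z_basis O w1 w2.

(* The square of the determinant of the two complex embeddings of a Z-basis. *)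
Definition has_discriminant (O : {pred C}) (Delta : int) : Prop :=
  exists w1 w2, Z_basis O w1 w2 /\
    Delta%:~R = (w1 * w2^* - w2 * w1^*) ^+ 2.

End Orders.

Section Hyperbolic.
Variable R : realType.
Local Open Scope ring_scope.
Local Open Scope classical_set_scope.
Local Notation C := R[i].
Local Notation Re := complex.Re.
Local Notation Im := complex.Im.

(* The point (zeta, t) of the upper half-space is a pair with 0 < t. *)
Definition half_space : set (C * R) := [set P | 0 < P.2].

Definition sqnorm (z : C) : R := Re z ^+ 2 + Im z ^+ 2.

(* The Poincare extension: with quaternions z + t j, it is
   (a (z + t j) + b) (c (z + t j) + d)^-1. *)
Definition act_mx (M : 'M[C]_2) (P : C * R) : C * R :=
  let: (z, t) := P in
  let a := M 0 0 in let b := M 0 1 in let c := M 1 0 in let d := M 1 1 in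
  let D := sqnorm (c * z + d) + sqnorm c * t ^+ 2 in
  (((a * z + b) * (c * z + d)^* + a * c^* * (t ^+ 2)%:C%C) / D%:C%C, t / D).

Definition act (g : PSL2 C) (P : C * R) : C * R :=
  act_mx (val (repr g)) P.

Lemma sqnormN z : sqnorm (- z) = sqnorm z.
Proof. by case: z => a b; rewrite /sqnorm /= !sqrrN. Qed.

Lemma act_mxN (M : 'M[C]_2) P : act_mx (- M) P = act_mx M P.
Proof.
case: P => z t; rewrite /act_mx !mxE.
have lin a b : - a * z - b = - (a * z + b) by rewrite mulNr -opprD.
have bil (x y : C) : - x * (- y)^* = x * y^* by rewrite rmorphN mulrNN.
by rewrite !lin !sqnormN !bil.
Qed.

Lemma act_pi (M : SL2 C) P : act (\pi_(PSL2 C) M) P = act_mx (val M) P.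
Proof. by rewrite /act; case/orP: (PSL2_reprP M) => /eqP ->; rewrite ?act_mxN. Qed.

Definition rectangle (Delta : int) : set C :=
  [set z | `|Re z| <= 2^-1 /\ 0 <= Im z <= Num.sqrt `|Delta|%:~R / 2].

Definition ford_domain (O : subringClosed C) (Delta : int) : set (C * R) :=
  [set P | [/\ half_space P, rectangle Delta P.1 &
             forall g, g \in PSL2_over O -> (act g P).2 <= P.2]].

Definition hemisphere (z : C) (rho : R) : set (C * R) :=
  [set P | half_space P /\ sqnorm (P.1 - z) + P.2 ^+ 2 = rho ^+ 2].

(* The vertical half-plane over the line through z with direction u. *)
Definition vertical_plane (z u : C) : set (C * R) :=
  [set P | half_space P /\ Im ((P.1 - z) * u^*) = 0].

Definition geodesic_plane (S : set (C * R)) : Prop :=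
  (exists z rho, 0 < rho /\ S = hemisphere z rho) \/
  (exists z u, u != 0 /\ S = vertical_plane z u).

Definition geodesic_line (S : set (C * R)) : Prop :=
  (exists z, S = [set P | half_space P /\ P.1 = z]) \/
  (exists z rho u, [/\ 0 < rho, u != 0 &
                     S = hemisphere z rho `&` vertical_plane z u]).

(* Dimension in the sense of convex sets: S lies in a hyperbolic plane but in
   no hyperbolic line.  It is only applied to intersections of translates of
   the Ford domain, which are convex. *)
Definition two_dimensional (S : set (C * R)) : Prop :=
  (exists2 Pi, geodesic_plane Pi & S `<=` Pi) /\
  ~ (exists2 L, geodesic_line L & S `<=` L).

Definition face (O : subringClosed C) (Delta : int) (g : PSL2 C) : set (C * R) :=
  ford_domain O Delta `&` (act g @` ford_domain O Delta).

Definition face_pairing (O : subringClosed C) (Delta : int) (g : PSL2 C) : Prop :=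
  [/\ g \in PSL2_over O, g != 1%g & two_dimensional (face O Delta g)].

Definition partially_below (h : R) (S : set (C * R)) : Prop :=
  exists2 P, S P & P.2 < h.

Definition Gamma (O : subringClosed C) (Delta : int) : groupClosed (PSL2 C) :=
  gen [set g | face_pairing O Delta g /\
               partially_below (2 / 3) (face O Delta g)].

(* For Delta < 0, sqrtC Delta is the root with positive imaginary part. *)
Definition tau (Delta : int) : C :=
  if (2 %| Delta)%Z then sqrtC Delta%:~R / 2 else (1 + sqrtC Delta%:~R) / 2.

Definition Ngroup (Delta : int) : groupClosed (PSL2 C) :=
  gen [set g | [\/ g = rot C, g = shift 1 |
                  g = (shift (tau Delta) * rot C * (shift (tau Delta))^-1)%g]].

End Hyperbolic.

(* Main.v *)
(* Ping-pong on the upper half-space, with no appeal to Poincare's theorem.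
   Since |Delta| > 12, every a in O other than 0, 1, -1 has |a| >= 2,
   so each element of PE2(O) is a word s(a1) r s(a2) r ... s(b) with interior
   entries satisfying |a| >= 2.  Hence PE2(O) never raises a point outside all the
   unit balls centred in O, and below t = 2/3 such a point lies in one of the
   strips k s < Im z < (k + 1) s, s = sqrt |Delta| / 2, which the word carries to a
   strip whose index determines its coset modulo N.  The complement of the
   PE2(O)-invariant region [above] (t >= 2/3 outside the unit balls) is thus the
   disjoint union of the translates a L, a in PE2(O)/N, of a set L = [below].
   Points of different translates are at distance bounded below, so any chain of
   small steps avoiding [above] stays in one translate; as g [above] is disjoint
   from [above] for g outside PE2(O), chains along vertical rays and horospheres
   show that translates of L by PSL2(O) are nested, disjoint or complementary.
   The low face pairings preserve the pattern of translates of L containing the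
   low part of the Ford domain.  Therefore elements of Gamma outside N map the
   complement of L into L, while elements of PE2(O) outside N map L off itself and
   off [above], and no alternating word fixes a point of [above].
   PE2(O) and Gamma generate: a point of maximal height in its orbit under them
   is of maximal height under PSL2(O), since otherwise a nearby point of the floor
   of the Ford domain lies on a two-dimensional low face whose pairing raises it. *)
Require Import Defs.
From HB Require Import structures.
From mathcomp Require Import all_boot all_order all_algebra.
From mathcomp Require Import boolp classical_sets reals complex.
From mathcomp Require Import generic_quotient perm ring lra zify.

Import Order.TTheory GRing.Theory Num.Theory.

Local Open Scope quotient_scope.
Local Open Scope ring_scope.

Set Implicit Arguments.
Unset Strict Implicit.
Unset Printing Implicit Defensive.

(** Gamma is given by unspecified faces, so no element of it outside N is at hand. All that is used
    of a low pairing is that it preserves heights between points of the Ford domain; conversely,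
    generation has to produce a face that is genuinely two-dimensional, not merely an element
    raising a point. For the same reason N != Gamma is obtained indirectly, from an explicit element
    of PSL2(O) outside PE2(O). Connectedness is replaced by chains with steps [hdist] <= 1/16, and
    the constants fit together: outside the unit balls and below t = 2/3 a point is more than 1/2
    away from every line Im z = k s, while a step there moves Im z by at most 1/6. A step changes
    heights by a factor at most 4/3, so comparing maximal heights loses at most 16/9; and a word
    losing at most a factor 3 has |Im z| <= sqrt 3 < s wherever one of its r acts. This inequality
    and the norm gap come from |Delta| >= 15, or 16 in the even case, as discriminants are 0 or 1
    modulo 4. *)

Local Notation rot := Defs.rot.

(** * PSL2 and its action on the half-space *)

(* The class of the matrix with rows (a, b) and (c, d) when a d - b c = 1, and
   1 otherwise. *)
HB.lock Definition psl (F : fieldType) (a b c d : F) : PSL2 F :=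
  \pi_(PSL2 F) (insubd (1%g : SL2 F) (mx2 a b c d)).

Section Psl.
Variable F : fieldType.

Lemma mx2E (M : 'M[F]_2) : M = mx2 (M 0 0) (M 0 1) (M 1 0) (M 1 1).
Proof.
apply/matrixP => i j; rewrite mxE.
by case: (unliftP 0 i) => [i'|] ->; case: (unliftP 0 j) => [j'|] ->;
  rewrite ?ord1 /=; congr (M _ _); apply/val_inj.
Qed.

Lemma mx2_mul (a b c d a' b' c' d' : F) :
  mx2 a b c d *m mx2 a' b' c' d' =
  mx2 (a * a' + b * c') (a * b' + b * d') (c * a' + d * c') (c * b' + d * d').
Proof.
apply/matrixP => i j; rewrite !mxE !big_ord_recl big_ord0 addr0 !mxE /=.
by case: eqP => _; case: eqP => _.
Qed.

Lemma psl_val (a b c d : F) : a * d - b * c = 1 ->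
  val (insubd (1%g : SL2 F) (mx2 a b c d)) = mx2 a b c d.
Proof. by move=> h; rewrite insubdK // -topredE /= det_mx2 h. Qed.

Lemma pi_psl (M : SL2 F) :
  \pi_(PSL2 F) M = psl (val M 0 0) (val M 0 1) (val M 1 0) (val M 1 1).
Proof. by rewrite psl.unlock -mx2E valKd. Qed.

Lemma SL2_det2 (M : SL2 F) : val M 0 0 * val M 1 1 - val M 0 1 * val M 1 0 = 1.
Proof. by rewrite -det_mx2 -mx2E SL2_det. Qed.

Lemma psl_mul (a b c d a' b' c' d' : F) : a * d - b * c = 1 -> a' * d' - b' * c' = 1 ->
  (psl a b c d * psl a' b' c' d')%g =
  psl (a * a' + b * c') (a * b' + b * d') (c * a' + d * c') (c * b' + d * d').
Proof.
move=> h h'; rewrite !psl.unlock.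
transitivity (\pi_(PSL2 F) (insubd (1%g : SL2 F) (mx2 a b c d) * insubd (1%g : SL2 F) (mx2 a' b' c' d'))%g).
  exact: PSL2_mulE.
congr (\pi_(PSL2 F) _); apply/val_inj; rewrite [RHS]psl_val /=.
  by rewrite !psl_val // mx2_mul.
by rewrite -[RHS]mulr1 -{1}h -h'; ring.
Qed.

Lemma psl1 : psl (1 : F) 0 0 1 = 1%g.
Proof.
rewrite !psl.unlock; congr (\pi_(PSL2 F) _); apply/val_inj.
rewrite psl_val; last by rewrite mulr1 mulr0 subr0.
by apply/matrixP => i j; rewrite !mxE /=; case: (unliftP 0 i) => [i'|] ->;
  case: (unliftP 0 j) => [j'|] ->; rewrite ?ord1.
Qed.

Lemma pslN (a b c d : F) : a * d - b * c = 1 ->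
  psl (- a) (- b) (- c) (- d) = psl a b c d.
Proof.
move=> h; rewrite !psl.unlock; apply/PSL2_piP; rewrite /SL2_pm !psl_val //; last by rewrite !mulrNN.
by apply/orP; right; apply/eqP/matrixP => i j; rewrite !mxE; do 2?case: ifP.
Qed.

Lemma psl_inv (a b c d : F) : a * d - b * c = 1 ->
  (psl a b c d)^-1%g = psl d (- b) (- c) a.
Proof.
move=> h; apply: (mulgI (psl a b c d)); rewrite mulgV psl_mul //; last by rewrite -h; ring.
by rewrite -psl1; congr psl; rewrite -?h; ring.
Qed.

Lemma rotE : rot F = psl (0 : F) (-1) 1 0.
Proof. by rewrite /rot pi_psl /= !mxE. Qed.

Lemma shiftE (a : F) : shift a = psl 1 a 0 1.
Proof. by rewrite /shift pi_psl /= !mxE. Qed.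

Lemma psl_over (O : subringClosed F) (a b c d : F) : a * d - b * c = 1 ->
  a \in O -> b \in O -> c \in O -> d \in O -> psl a b c d \in PSL2_over O.
Proof.
move=> h aO bO cO dO; rewrite psl.unlock; apply/asboolP; exists (insubd (1%g : SL2 F) (mx2 a b c d)) => //.
by move=> i j; rewrite psl_val // mxE; do 2?case: ifP.
Qed.

Lemma PSL2_overP (O : subringClosed F) (g : PSL2 F) : g \in PSL2_over O ->
  exists a b c d : F, [/\ a * d - b * c = 1, [/\ a \in O, b \in O, c \in O & d \in O]
    & g = psl a b c d].
Proof.
move=> /asboolP[M MO ->].
exists (val M 0 0), (val M 0 1), (val M 1 0), (val M 1 1).
by split; [exact: SL2_det2 | split; exact: MO | exact: pi_psl].
Qed.

Lemma shift_mul (a b : F) : (shift a * shift b)%g = shift (a + b).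
Proof. by rewrite !shiftE psl_mul; [congr psl | |]; ring. Qed.

Lemma shift0 : shift 0 = 1%g :> PSL2 F.
Proof. by rewrite shiftE psl1. Qed.

Lemma shift_inv (a : F) : (shift a)^-1%g = shift (- a).
Proof. by apply: (mulgI (shift a)); rewrite mulgV shift_mul subrr shift0. Qed.

Lemma rot2 : (rot F * rot F)%g = 1%g.
Proof.
rewrite rotE psl_mul -?psl1; [|ring|ring].
by rewrite -[RHS]pslN; [congr psl; ring | ring].
Qed.

Lemma rot_inv : (rot F)^-1%g = rot F.
Proof. by apply: (mulgI (rot F)); rewrite mulgV rot2. Qed.

(** The relation (r s(1))^3 = 1 and its variant for s(-1). It deletes a unit entry from the interior
    of a word in r and the s(a), at the cost of shifting both neighbours. *)
Lemma rot_shift_rot (e : F) : e * e = 1 ->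
  (rot F * shift e * rot F)%g = (shift (- e) * rot F * shift (- e))%g.
Proof.
move/eqP; rewrite -expr2 sqrf_eq1 => /orP[] /eqP ->;
  rewrite !rotE !shiftE !psl_mul; try ring.
- by congr psl; ring.
- by rewrite -[RHS]pslN; [congr psl|]; ring.
Qed.

Lemma gen_sub (S : set (PSL2 F)) (A : groupClosed (PSL2 F)) :
  (forall y, S y -> y \in A) -> {subset gen S <= A}.
Proof.
move=> SA x /asboolP; apply=> //.
by split; [exact: gpred1 | exact: gpredF].
Qed.

Lemma mem_gen (S : set (PSL2 F)) y : S y -> y \in gen S.
Proof. by move=> Sy; apply/asboolP => A _; apply. Qed.

End Psl.

(** * Coordinates: the automorphy factor and the action law *)

Section Coord.
Variable R : realType.
Local Notation C := R[i].
Local Notation Re := complex.Re.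
Local Notation Im := complex.Im.

Lemma conjE (z : C) : z^* = Complex (Re z) (- Im z).
Proof. by case: z. Qed.

Lemma ReD (z w : C) : Re (z + w) = Re z + Re w. Proof. by case: z; case: w. Qed.
Lemma ImD (z w : C) : Im (z + w) = Im z + Im w. Proof. by case: z; case: w. Qed.
Lemma ReN (z : C) : Re (- z) = - Re z. Proof. by case: z. Qed.
Lemma ImN (z : C) : Im (- z) = - Im z. Proof. by case: z. Qed.
Lemma ReM (z w : C) : Re (z * w) = Re z * Re w - Im z * Im w.
Proof. by case: z; case: w. Qed.
Lemma ImM (z w : C) : Im (z * w) = Re z * Im w + Im z * Re w.
Proof. by case: z; case: w. Qed.
Lemma complex_eqP (z w : C) : Re z = Re w -> Im z = Im w -> z = w.
Proof. by case: z => a b; case: w => c d /= -> ->. Qed.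
Lemma ReZ (m : int) : Re (m%:~R : C) = m%:~R.
Proof. by rewrite -(rmorph_int (real_complex R)). Qed.
Lemma ImZ (m : int) : Im (m%:~R : C) = 0.
Proof. by rewrite -(rmorph_int (real_complex R)). Qed.
Lemma Re1 : Re (1 : C) = 1. Proof. by []. Qed.
Lemma Im1 : Im (1 : C) = 0. Proof. by []. Qed.
Lemma Re0 : Re (0 : C) = 0. Proof. by []. Qed.
Lemma Im0 : Im (0 : C) = 0. Proof. by []. Qed.
Lemma ReR (x : R) : Re (x%:C)%C = x. Proof. by []. Qed.
Lemma ImR (x : R) : Im (x%:C)%C = 0. Proof. by []. Qed.
Lemma Rec (z : C) : Re (z^*) = Re z. Proof. by rewrite conjE. Qed.
Lemma Imc (z : C) : Im (z^*) = - Im z. Proof. by rewrite conjE. Qed.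
Lemma Re_mk (a b : R) : Re (Complex a b) = a. Proof. by []. Qed.
Lemma Im_mk (a b : R) : Im (Complex a b) = b. Proof. by []. Qed.
Definition cE := (Re_mk, Im_mk, ReD, ImD, ReN, ImN, ReM, ImM, ReZ, ImZ, Re1, Im1, Re0, Im0,
  ReR, ImR, Rec, Imc).

Lemma sqnormC (z : C) : (sqnorm z)%:C%C = z * z^* :> C.
Proof. by apply: complex_eqP; rewrite /sqnorm !cE; ring. Qed.

Lemma sqnorm_ge0 (z : C) : 0 <= sqnorm z.
Proof. by rewrite addr_ge0 ?sqr_ge0. Qed.

Lemma sqnorm_eq0 (z : C) : sqnorm z = 0 -> z = 0.
Proof.
move=> /eqP; rewrite paddr_eq0 ?sqr_ge0 // !sqrf_eq0 => /andP[/eqP h1 /eqP h2].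
exact: complex_eqP.
Qed.

Lemma sqnorm_gt0 (z : C) : z != 0 -> 0 < sqnorm z.
Proof.
by move=> z0; rewrite lt0r sqnorm_ge0 andbT; apply/eqP => /sqnorm_eq0 /eqP; rewrite (negbTE z0).
Qed.

Lemma sqnormM (z w : C) : sqnorm (z * w) = sqnorm z * sqnorm w.
Proof. by rewrite /sqnorm !cE; ring. Qed.

(** The automorphy factor: a matrix with bottom row (c, d) divides the height of [P] by it, so it
    raises [P] exactly when the factor is below 1. *)
Definition den (c d : C) (P : C * R) : R := sqnorm (c * P.1 + d) + sqnorm c * P.2 ^+ 2.

Lemma den_gt0 (a b c d : C) (P : C * R) : half_space P -> a * d - b * c = 1 -> 0 < den c d P.
Proof.
case: P => z t; rewrite /half_space /= => t0 h; rewrite /den /=.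
have [c0|c0] := eqVneq c 0; last first.
  by rewrite ltr_wpDl ?sqnorm_ge0 // mulr_gt0 ?sqnorm_gt0 // exprn_gt0.
rewrite c0 mul0r add0r ltr_pwDl ?mulr_ge0 ?sqnorm_ge0 ?(ltW t0) //.
apply: sqnorm_gt0; apply/eqP => d0; move/eqP: h.
by rewrite c0 d0 !mulr0 subr0 eq_sym oner_eq0.
Qed.

Lemma act_psl (a b c d z : C) (t : R) : a * d - b * c = 1 ->
  act (psl a b c d) (z, t) =
    (((a * z + b) * (c * z + d)^* + a * c^* * (t ^+ 2)%:C%C) / (den c d (z, t))%:C%C,
     t / den c d (z, t)).
Proof. by move=> h; rewrite !psl.unlock act_pi psl_val // /act_mx !mxE. Qed.

Lemma ht_psl (a b c d : C) (P : C * R) : a * d - b * c = 1 ->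
  (act (psl a b c d) P).2 = P.2 / den c d P.
Proof. by case: P => z t h; rewrite act_psl. Qed.

Lemma half_space_psl (a b c d : C) (P : C * R) : a * d - b * c = 1 -> half_space P ->
  half_space (act (psl a b c d) P).
Proof.
move=> h hP; rewrite /half_space /= ht_psl // divr_gt0 //.
exact: den_gt0 hP h.
Qed.

Lemma pslP (g : PSL2 C) : exists a b c d, a * d - b * c = 1 /\ g = psl a b c d.
Proof.
elim/quotW: g => M; exists (val M 0 0), (val M 0 1), (val M 1 0), (val M 1 1).
by split; [exact: SL2_det2 | exact: pi_psl].
Qed.

Lemma half_space_act g (P : C * R) : half_space P -> half_space (act g P).
Proof. by case: (pslP g) => a [b [c [d [h ->]]]]; exact: half_space_psl. Qed.

Lemma realC_neq0 (x : R) : 0 < x -> (x%:C)%C != 0 :> C.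
Proof. by move=> x0; apply/eqP => /(congr1 (@complex.Re R)) /= x00; rewrite x00 ltxx in x0. Qed.

Lemma denC (c d z : C) (t : R) : (den c d (z, t))%:C%C =
  (c * z + d) * (c^* * z^* + d^*) + c * c^* * (t%:C%C) ^+ 2 :> C.
Proof.
rewrite /den; move: (t ^+ 2) (rmorphXn (real_complex R) 2 t) => t2 /= <-.
by rewrite rmorphD rmorphM /= !sqnormC rmorphD rmorphM.
Qed.

Lemma conjR (x : R) : (x%:C%C : C)^* = x%:C%C.
Proof. by apply: complex_eqP; rewrite !cE ?oppr0. Qed.

Lemma den_act (a b c d a' b' c' d' : C) (P : C * R) : half_space P -> a' * d' - b' * c' = 1 ->
  den c d (act (psl a' b' c' d') P) * den c' d' P =
  den (c * a' + d * c') (c * b' + d * d') P.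
Proof.
move=> hP h'; have D0 := den_gt0 hP h'.
case: P hP D0 => z t hP D0; rewrite act_psl //.
move: D0; set D := den c' d' (z, t) => D0.
have DC := denC c' d' z t; rewrite -/D in DC.
have DC0 := realC_neq0 D0; clearbody D.
apply: (@complexI R); rewrite rmorphM /= !denC.
rewrite !(rmorphD, rmorphM, rmorphXn, fmorphV, conjR, conjCK) /= ?conjR ?conjCK.
have h'' : a'^* * d'^* - b'^* * c'^* = 1 by rewrite -!rmorphM -rmorphB h' rmorph1.
move: DC DC0; set DD := (D%:C)%C; set T := (t%:C)%C => DC DC0.
(* This is the formula for |zeta|^2 + t^2 at the image point, cleared of denominators; the
   determinant and its conjugate both enter. *)
have E : (a' * z + b') * (a'^* * z^* + b'^*) * DD + a' * a'^* * T ^+ 2 * DD =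
   ((a' * z + b') * (c'^* * z^* + d'^*) + a' * c'^* * T ^+ 2) *
   ((a'^* * z^* + b'^*) * (c' * z + d') + a'^* * c' * T ^+ 2) + T ^+ 2.
  rewrite DC; rewrite -[X in _ = _ + X]mulr1 -{1}h'' -[X in _ = _ + X]mulr1 -{1}h'; ring.
(* Conjugates become independent variables: what remains is a polynomial identity. *)
move: DC0 DC E; generalize (a'^*) (b'^*) (c'^*) (d'^*) (z^*) (c^*) (d^*) => a1 b1 c1 d1 z1 c2 d2 DC0 DC E.
apply: (mulfI DC0).
transitivity (c * c2 * (((a' * z + b') * (c1 * z1 + d1) + a' * c1 * T ^+ 2) *
   ((a1 * z1 + b1) * (c' * z + d') + a1 * c' * T ^+ 2) + T ^+ 2) +
   c * ((a' * z + b') * (c1 * z1 + d1) + a' * c1 * T ^+ 2) * d2 * DD +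
   c2 * ((a1 * z1 + b1) * (c' * z + d') + a1 * c' * T ^+ 2) * d * DD + d * d2 * DD ^+ 2).
  by field.
rewrite -E [in LHS]DC DC; ring.
Qed.

Lemma act_mul g h (P : C * R) : half_space P -> act (g * h)%g P = act g (act h P).
Proof.
case: (pslP g) => a [b [c [d [e ->]]]]; case: (pslP h) => a' [b' [c' [d' [e' ->]]]] hP.
have D0 := den_gt0 hP e'.
have E0 := den_gt0 (half_space_psl e' hP) e.
have M := den_act a b c d hP e'.
have ee : (a * a' + b * c') * (c * b' + d * d') - (a * b' + b * d') * (c * a' + d * c') = 1.
  by rewrite -[RHS]mulr1 -{1}e -e'; ring.
rewrite psl_mul //; case: P hP D0 E0 M => z t hP D0 E0 M.
rewrite [LHS]act_psl // -M.
move: E0 M; rewrite (act_psl z t e').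
set D := den c' d' (z, t) in D0 *; set z' := _ / _; set t' := t / D => E0 M.
rewrite act_psl //; set E := den c d (z', t') in E0 M *.
congr pair; last by rewrite /t'; field; rewrite !gt_eqF.
have DC := denC c' d' z t; rewrite -/D in DC.
have DC0 := realC_neq0 D0; have EC0 := realC_neq0 E0.
clear M; clearbody E; rewrite {}/z' {}/t'; clearbody D.
rewrite !(rmorphD, rmorphM, rmorphXn, fmorphV) /=.
rewrite !(rmorphD, rmorphM, rmorphXn, fmorphV, conjR, conjCK) /= ?conjR ?conjCK.
have e'' : a'^* * d'^* - b'^* * c'^* = 1 by rewrite -!rmorphM -rmorphB e' rmorph1.
move: DC DC0; set DD := (D%:C)%C; set T := (t%:C)%C => DC DC0.
have K : (a' * z + b') * (a'^* * z^* + b'^*) * DD + a' * a'^* * T ^+ 2 * DD =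
   ((a' * z + b') * (c'^* * z^* + d'^*) + a' * c'^* * T ^+ 2) *
   ((a'^* * z^* + b'^*) * (c' * z + d') + a'^* * c' * T ^+ 2) + T ^+ 2.
  rewrite DC; rewrite -[X in _ = _ + X]mulr1 -{1}e'' -[X in _ = _ + X]mulr1 -{1}e'; ring.
move: DC0 DC K; generalize (a'^*) (b'^*) (c'^*) (d'^*) (z^*) (c^*) (d^*) => a1 b1 c1 d1 z1 c2 d2 DC0 DC K.
apply: (mulfI DC0); apply: (mulfI DC0); apply: (mulfI EC0).
transitivity (a * c2 * (((a' * z + b') * (c1 * z1 + d1) + a' * c1 * T ^+ 2) *
   ((a1 * z1 + b1) * (c' * z + d') + a1 * c' * T ^+ 2) + T ^+ 2) +
   a * ((a' * z + b') * (c1 * z1 + d1) + a' * c1 * T ^+ 2) * d2 * DD +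
   c2 * ((a1 * z1 + b1) * (c' * z + d') + a1 * c' * T ^+ 2) * b * DD + b * d2 * DD ^+ 2);
  last by field; rewrite DC0 EC0.
rewrite -K.
transitivity (DD * ((a * a' + b * c') * z + (a * b' + b * d')) *
   ((c2 * a1 + d2 * c1) * z1 + (c2 * b1 + d2 * d1)) + DD * (a * a' + b * c') * (c2 * a1 + d2 * c1) * T ^+ 2).
  by field; rewrite DC0 EC0.
rewrite [in RHS]DC DC; ring.
Qed.

End Coord.

Section Coord2.
Variable R : realType.
Local Notation C := R[i].
Local Notation Re := complex.Re.
Local Notation Im := complex.Im.
Lemma act1 (P : C * R) : act 1%g P = P.
Proof.
have e : 1 * 1 - 0 * 0 = 1 :> C by ring.
case: P => z t; rewrite -psl1 act_psl //.
have -> : den 0 1 (z, t) = 1 by rewrite /den /= /sqnorm mul0r add0r !cE; ring.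
by rewrite rmorph1 !divr1 /=; congr pair; apply: complex_eqP; rewrite !cE; ring.
Qed.

Lemma actK g (P : C * R) : half_space P -> act g^-1%g (act g P) = P.
Proof. by move=> hP; rewrite -act_mul // mulVg act1. Qed.
Lemma actVK g (P : C * R) : half_space P -> act g (act g^-1%g P) = P.
Proof. by move=> hP; rewrite -act_mul // mulgV act1. Qed.

Lemma act_shift (a : C) (P : C * R) : act (shift a) P = (P.1 + a, P.2).
Proof.
have e : 1 * 1 - a * 0 = 1 :> C by ring.
case: P => z t; rewrite shiftE act_psl //.
have -> : den 0 1 (z, t) = 1 by rewrite /den /= /sqnorm mul0r add0r !cE; ring.
by rewrite rmorph1 !divr1 /=; congr pair; apply: complex_eqP; rewrite !cE; ring.
Qed.

Lemma ht_shift (a : C) (P : C * R) : (act (shift a) P).2 = P.2.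
Proof. by rewrite act_shift. Qed.

Definition nq (P : C * R) : R := sqnorm P.1 + P.2 ^+ 2.

Lemma nq_gt0 (P : C * R) : half_space P -> 0 < nq P.
Proof. by move=> hP; rewrite ltr_wpDl ?sqnorm_ge0 // exprn_gt0. Qed.

Lemma act_rot (P : C * R) : act (rot C) P = (- (P.1)^* / (nq P)%:C%C, P.2 / nq P).
Proof.
have e : 0 * 0 - (-1) * 1 = 1 :> C by ring.
case: P => z t; rewrite rotE act_psl //.
have -> : den 1 0 (z, t) = nq (z, t) by rewrite /den /nq /= /sqnorm !cE; ring.
by congr pair; congr (_ / _); apply: complex_eqP; rewrite !cE; ring.
Qed.

Lemma act_rotE (P : C * R) : half_space P -> act (rot C) P =
  (Complex (- Re P.1 / nq P) (Im P.1 / nq P), P.2 / nq P).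
Proof.
move=> hP; have := nq_gt0 hP; rewrite act_rot; move: (nq P) => n n0.
congr pair; rewrite -fmorphV; apply: complex_eqP; rewrite [RHS]/= !cE; ring.
Qed.

End Coord2.

(** * Imaginary quadratic orders as lattices *)

Section OrderBasis.
Variable R : realType.
Local Notation C := R[i].
Local Notation Re := complex.Re.
Local Notation Im := complex.Im.

(* The order is the lattice Z + Z (e + i s), where s = sqrt |Delta| / 2 and
   e = 0 or 1/2 according to the parity of Delta. *)
Record order_lattice (O : {pred C}) (Delta : int) (s e : R) : Prop := OrderLattice {
  latP : forall x, x \in O -> exists m k : int,
    Re x = m%:~R + k%:~R * e /\ Im x = k%:~R * s;
  lat_mem : forall m k : int, Complex (m%:~R + k%:~R * e) (k%:~R * s) \in O;
  lat_tau : tau R Delta = Complex e s;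
  lat_s : Num.sqrt `|Delta|%:~R / 2 = s;
  lat_s_gt0 : 0 < s;
  lat_s2 : 15 / 4 <= s ^+ 2;
  lat_e : (e = 0 /\ 4 <= s ^+ 2) \/ e = 1 / 2 }.

Lemma sqrtC_neg (r : R) : 0 < r -> sqrtC (Complex (- r ^+ 2) 0) = Complex 0 r :> C.
Proof.
move=> r0; have <- : (Complex 0 r) ^+ 2 = Complex (- r ^+ 2) 0 :> C.
  by rewrite expr2; apply: complex_eqP; rewrite !cE; ring.
apply/sqrCK_P/andP; split.
  rewrite ImE conjE /=.
  have -> : 'i = Complex 0 1 :> C by [].
  have -> : Complex 0 1 * (Complex 0 (- r) - Complex 0 r) / 2%:R = (r%:C)%C :> C.
    apply: (canLR (mulfK _)); first by rewrite pnatr_eq0.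
    rewrite -(rmorph_nat (real_complex R)); apply: complex_eqP; rewrite !cE. ring. ring.
  by rewrite ler0c ltW.
by rewrite ltcE /= ltxx andbF.
Qed.

Lemma order_generator (O : subringClosed C) (Delta : int) : has_discriminant O Delta ->
  Delta != 0 ->
  exists w : C, [/\ 0 < Im w, Delta%:~R = - (4 * (Im w) ^+ 2) &
    forall x, x \in O <-> exists m n : int, x = m%:~R + n%:~R * w].
Proof.
move=> [w1 [w2 [[fr bas] disc]]] D0.
have /bas [m [n e1]] : 1 \in O by exact: rpred1.
have mem_bas (p q : int) : p%:~R * w1 + q%:~R * w2 \in O by apply/bas; exists p, q.
have [u [v uv]] : exists u v : int, u * m + v * n = 1.
  (* With d the gcd of the coordinates of 1, y = 1/d and y^2 lie in O. As y = d y^2, the coprime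
     coordinates of y are divisible by d, so d is a unit. *)
  have [u [v guv]] := Bezoutz m n; set d := gcdz m n in guv.
  have /dvdzP [p mp] : (d %| m)%Z by exact: dvdz_gcdl.
  have /dvdzP [q nq] : (d %| n)%Z by exact: dvdz_gcdr.
  have dn0 : d != 0.
    apply/eqP => d0; have /eqP := e1.
    by rewrite mp nq d0 !mulr0 !mul0r addr0 oner_eq0.
  have upq : u * p + v * q = 1.
    by apply: (mulIf dn0); rewrite mul1r -{2}guv mp nq; ring.
  set y := p%:~R * w1 + q%:~R * w2.
  have dy : d%:~R * y = 1 by rewrite [RHS]e1 mp nq /y !intrM; ring.
  have /bas [p' [q' y2]] : y * y \in O by rewrite rpredM ?mem_bas.
  have [ep eq] : p - d * p' = 0 /\ q - d * q' = 0.
    apply: fr; rewrite !rmorphB !rmorphM /=.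
    transitivity (y - d%:~R * (p'%:~R * w1 + q'%:~R * w2)); first by rewrite /y; ring.
    by rewrite -y2 mulrA dy mul1r subrr.
  have d1 : d * (u * p' + v * q') = 1.
    by rewrite -[RHS]upq (subr0_eq ep) (subr0_eq eq); ring.
  have du : d * d = 1.
    have : (d %| 1)%Z by apply/dvdzP; exists (u * p' + v * q'); rewrite mulrC d1.
    by rewrite dvdz1 => /eqP; lia.
  exists (d * u), (d * v); transitivity (d * (u * m + v * n)); [ring | by rewrite guv].
have [h hb] : exists h : C, (forall x, x \in O <-> exists m n : int, x = m%:~R + n%:~R * h) /\
    Delta%:~R = - (4 * (Im h) ^+ 2).
  (* The row (-v, u) completes the coordinates (m, n) of 1 to a matrix of determinant 1, so (1, h)
     is a basis with the same discriminant. *)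
  exists (- v%:~R * w1 + u%:~R * w2); set h := _ + _; split.
    move=> x; rewrite bas; split => [[p [q ->]]|[p [q ->]]].
      exists (p * u + q * v), (- p * n + q * m).
      rewrite !(rmorphD, rmorphM, rmorphN) /= /h.
      have uvC : u%:~R * m%:~R + v%:~R * n%:~R = 1 :> C by rewrite -!intrM -intrD uv.
      transitivity ((p%:~R * w1 + q%:~R * w2) * (u%:~R * m%:~R + v%:~R * n%:~R) : C).
        by rewrite uvC mulr1.
      transitivity ((p%:~R * u%:~R + q%:~R * v%:~R) * (m%:~R * w1 + n%:~R * w2) + (- p%:~R * n%:~R + q%:~R * m%:~R) * (- v%:~R * w1 + u%:~R * w2)); first ring.
      by rewrite -e1 mulr1.
    exists (p * m - q * v), (p * n + q * u).
    rewrite /h; transitivity (p%:~R * (m%:~R * w1 + n%:~R * w2) + q%:~R * (- v%:~R * w1 + u%:~R * w2)); first by rewrite -e1 mulr1.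
    by rewrite !(rmorphD, rmorphM, rmorphN) /=; ring.
  have uvR : u%:~R * m%:~R + v%:~R * n%:~R = 1 :> R by rewrite -!intrM -intrD uv.
  have := congr1 (@complex.Re R) disc; rewrite expr2 !cE => ->.
  have := congr1 (@complex.Im R) e1; rewrite !cE => eI.
  have := congr1 (@complex.Re R) e1; rewrite !cE => eR.
  move: eI eR uvR.
  move: (Re w1) (Im w1) (Re w2) (Im w2) (m%:~R) (n%:~R) (u%:~R) (v%:~R) => a b c d M N U V eI eR uvR.
  have eb : b = - N * (U * d - V * b).
    rewrite -[LHS]mulr1 -uvR; transitivity (U * (M * b - 0 * a + (N * d - 0 * c) ) - N * U * d + V * N * b);[ring|].
    have -> : M * b - 0 * a + (N * d - 0 * c) = 0 by rewrite [RHS]eI; ring.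
    ring.
  have ed : d = M * (U * d - V * b).
    rewrite -[LHS]mulr1 -uvR; transitivity (V * (M * b - 0 * a + (N * d - 0 * c) ) - M * V * b + U * M * d);[ring|].
    have -> : M * b - 0 * a + (N * d - 0 * c) = 0 by rewrite [RHS]eI; ring.
    ring.
  have K : (b * c - a * d) = - (U * d - V * b).
    transitivity ((- N * (U * d - V * b)) * c - a * (M * (U * d - V * b))); first by rewrite -eb -ed.
    transitivity (- (U * d - V * b) * (M * a - 0 * b + (N * c - 0 * d))); first ring.
    by rewrite -eR mulr1.
  transitivity (- (4 * (b * c - a * d) ^+ 2)); first ring.
  by rewrite K; ring.
case: hb => hb hD.
have h0 : Im h != 0.
  apply: contraNneq D0 => h0; move: hD; rewrite h0 expr0n mulr0 oppr0 => /eqP.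
  by rewrite intr_eq0.
move: h0; rewrite neq_lt => /orP[h0|h0]; last by exists h.
exists (- h); split; rewrite ?ImN ?oppr_gt0 ?sqrrN // => x; rewrite hb.
by split => -[p [q ->]]; exists p, (- q); rewrite rmorphN mulrNN || rewrite rmorphN mulrN mulNr.
Qed.

Lemma order_latticeP (O : subringClosed C) (Delta : int) : has_discriminant O Delta ->
  12 < `|Delta| -> exists s e : R, order_lattice O Delta s e.
Proof.
move=> hD h12; have D0 : Delta != 0 by apply: contraTneq h12 => ->.
have [w [w0 wD wb]] := order_generator hD D0.
have /wb [x [y ww]] : w * w \in O by rewrite rpredM // wb; exists 0, 1; rewrite mul1r add0r.
have := congr1 (@complex.Im R) ww; rewrite !cE => eI.
have := congr1 (@complex.Re R) ww; rewrite !cE => eR.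
have wR : 2 * Re w = y%:~R.
  apply: (mulIf (lt0r_neq0 w0)).
  transitivity (Re w * Im w + Im w * Re w); first ring.
  by rewrite eI; ring.
have Dxy : Delta = 4 * x + y * y.
  apply/eqP; rewrite -(eqr_int R); apply/eqP; rewrite rmorphD !rmorphM /= wD.
  move: eR; rewrite -wR => eR.
  have -> : x%:~R = Re w * Re w - Im w * Im w - 2 * Re w * Re w by rewrite eR; ring.
  by ring.
have sD : `|Delta|%:~R = (2 * Im w) ^+ 2 :> R.
  rewrite intr_norm wD normrN ger0_norm; first by ring.
  by rewrite mulr_ge0 // sqr_ge0.
have Dneg : Delta < 0.
  by rewrite -(ltr_int R) wD oppr_lt0 mulr_gt0 // exprn_gt0.
have DC : (Delta%:~R : C) = Complex (- (2 * Im w) ^+ 2) 0.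
  apply: complex_eqP; rewrite !cE //= wD; ring.
have w20 : 0 < 2 * Im w by rewrite mulr_gt0.
have sq : Num.sqrt `|Delta|%:~R / 2 = Im w :> R.
  by rewrite sD sqrtr_sqr ger0_norm ?(ltW w20) //; field.
(* Delta = y^2 + 4 x is 0 or 1 modulo 4; being negative with |Delta| > 12, it is at most -15. *)
have w15 : 15 / 4 <= Im w ^+ 2.
  have : 15%:~R <= `|Delta|%:~R :> R.
    rewrite ler_int; have : 0 <= (y %% 2)%Z by rewrite modz_ge0.
  have : (y %% 2)%Z < 2 by rewrite ltz_pmod.
    have := divz_eq y 2; move: h12 Dneg; rewrite Dxy; move: (y %/ 2)%Z (y %% 2)%Z => q r h1 h2 ey r2 r0.
    nia.
  by rewrite sD; lra.
have two : (2 : C) != 0 by rewrite pnatr_eq0.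
have tauE : tau R Delta = if (2 %| Delta)%Z then Complex 0 (Im w) else Complex (1/2) (Im w).
  rewrite /tau DC sqrtC_neg //; case: ifP => _; apply: (canLR (mulfK two));
   rewrite -?(rmorph_nat (real_complex R)); apply: complex_eqP; rewrite !cE; by field.
have [y' [ey|ey]] : exists y' : int, y = 2 * y' \/ y = 2 * y' + 1.
  exists (y %/ 2)%Z; have := divz_eq y 2.
  have : 0 <= (y %% 2)%Z by rewrite modz_ge0.
  have : (y %% 2)%Z < 2 by rewrite ltz_pmod.
  lia.
- have e2 : (2 %| Delta)%Z by apply/dvdzP; exists (2 * x + y' * y); rewrite Dxy ey; ring.
  have wRe : Re w = y'%:~R by move: wR; rewrite ey rmorphM /=; lra.
  exists (Im w), 0; apply: OrderLattice => //.
  + move=> z /wb [m [n ->]]; exists (m + n * y'), n; rewrite !cE wRe rmorphD rmorphM /=.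
    by split; ring.
  + move=> m k; apply: (proj2 (wb _)); exists (m - k * y'), k; apply: complex_eqP; rewrite !cE ?rmorphB ?rmorphM /= ?wRe; ring.
  + by rewrite tauE e2.
  + left; split=> //; have : 16%:~R <= `|Delta|%:~R :> R.
      by rewrite ler_int; move: h12 Dneg; rewrite Dxy ey; nia.
    by rewrite sD; lra.
- have e2 : (2 %| Delta)%Z = false.
    by apply/negP => /dvdzP [q]; rewrite Dxy ey; lia.
  have wRe : Re w = y'%:~R + 1 / 2 by move: wR; rewrite ey rmorphD rmorphM /=; lra.
  exists (Im w), (1/2); apply: OrderLattice => //.
  + move=> z /wb [m [n ->]]; exists (m + n * y'), n; rewrite !cE wRe rmorphD rmorphM /=.
    by split; ring.
  + move=> m k; apply: (proj2 (wb _)); exists (m - k * y'), k; apply: complex_eqP; rewrite !cE ?rmorphB ?rmorphM /= ?wRe; ring.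
  + by rewrite tauE e2.
  + by right.
Qed.

End OrderBasis.

(** * Invariance of the hyperbolic distance *)

(** The big Bruhat cell. It reduces invariance of the distance to triangular matrices and r, and
    shows that a matrix over O with c = 1 or -1 is a product of elementary ones. *)
Lemma psl_bruhat (F : fieldType) (a b c d : F) : a * d - b * c = 1 -> c != 0 ->
  psl a b c d = (psl c^-1 a 0 c * rot F * shift (d / c))%g.
Proof.
move=> h c0.
have h1 : c^-1 * c - a * 0 = 1 by rewrite mulVf // mulr0 subr0.
have h2 : 0 * 0 - (-1) * 1 = 1 :> F by ring.
have h3 : 1 * 1 - (d / c) * 0 = 1 by ring.
have eb : b = (a * d - 1) / c by rewrite -h; field.
rewrite rotE shiftE psl_mul // psl_mul //; last by field.
by rewrite eb; congr psl; field.
Qed.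

Section Distance.
Variable R : realType.
Local Notation C := R[i].

(* Twice (cosh d - 1) for the hyperbolic distance d of P and P'. *)
Definition hdist (P P' : C * R) : R :=
  (sqnorm (P.1 - P'.1) + (P.2 - P'.2) ^+ 2) / (P.2 * P'.2).

Lemma hdist_shift (a : C) P P' : hdist (act (shift a) P) (act (shift a) P') = hdist P P'.
Proof. by rewrite /hdist !act_shift /sqnorm !cE /=; congr (_ / _); ring. Qed.

Lemma hdist_rot (P P' : C * R) : half_space P -> half_space P' ->
  hdist (act (rot C) P) (act (rot C) P') = hdist P P'.
Proof.
move=> hP hP'; have n0 := nq_gt0 hP; have n0' := nq_gt0 hP'.
rewrite /hdist !act_rotE //; move: hP hP' n0 n0'; rewrite /half_space /nq /sqnorm.
case: P => -[x y] t; case: P' => -[x' y'] t' /=.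
move=> t0 t0' n0 n0'; field.
by rewrite !gt_eqF.
Qed.

Lemma hdist_tri (a b d : C) (P P' : C * R) : a * d = 1 -> half_space P -> half_space P' ->
  hdist (act (psl a b 0 d) P) (act (psl a b 0 d) P') = hdist P P'.
Proof.
move=> h hP hP'; have h' : a * d - b * 0 = 1 by rewrite mulr0 subr0.
have d0 : d != 0 by apply: contra_eq_neq h => ->; rewrite mulr0 eq_sym oner_neq0.
have D Q : den 0 d Q = sqnorm d by rewrite /den /sqnorm !cE; ring.
case: P hP => z t hP; case: P' hP' => z' t' hP'.
rewrite !act_psl // !D /hdist /=.
have n0 : 0 < sqnorm d by exact: sqnorm_gt0.
have C0 := realC_neq0 n0.
set Z := (X in sqnorm X).
have -> : Z = a * (z - z') * d^* * (((sqnorm d)^-1)%:C)%C.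
  by rewrite /Z rmorph0 fmorphV; rewrite rmorphD rmorphM rmorph0; field.
rewrite !sqnormM; have -> : sqnorm d^* = sqnorm d by rewrite /sqnorm !cE; ring.
have -> : sqnorm a = (sqnorm d)^-1.
  apply: (mulIf (lt0r_neq0 n0)); rewrite mulVf ?lt0r_neq0 // -sqnormM h /sqnorm !cE; ring.
have -> (x : R) : sqnorm (x%:C)%C = x ^+ 2 by rewrite /sqnorm !cE; ring.
by field; rewrite !gt_eqF.
Qed.

Lemma hdist_act g (P P' : C * R) : half_space P -> half_space P' ->
  hdist (act g P) (act g P') = hdist P P'.
Proof.
move=> hP hP'; case: (pslP g) => a [b [c [d [h ->]]]].
have [c0|c0] := eqVneq c 0.
  by rewrite c0 hdist_tri //; rewrite -h c0 mulr0 subr0.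
rewrite psl_bruhat // !act_mul //; do ?apply: half_space_act => //.
by rewrite hdist_tri ?mulVf ?hdist_rot ?hdist_shift //; do ?apply: half_space_act.
Qed.

(** The ratio x of the heights satisfies (x - 1)^2 <= x / 16, which fails for x >= 4/3. *)
Lemma hdist_ht (P P' : C * R) : half_space P -> half_space P' -> hdist P P' <= 1 / 16 ->
  P.2 <= 4 / 3 * P'.2 /\ P'.2 <= 4 / 3 * P.2.
Proof.
case: P => z t; case: P' => z' t'; rewrite /half_space /hdist /= => t0 t0'.
rewrite ler_pdivrMr ?mulr_gt0 // => h.
have h2 := sqnorm_ge0 (z - z').
have h3 : (t - t') ^+ 2 <= 1 / 16 * (t * t') by lra.
by split; nra.
Qed.

Lemma hdist_sq (P P' : C * R) : half_space P -> half_space P' -> hdist P P' <= 1 / 16 ->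
  sqnorm (P.1 - P'.1) <= 1 / 16 * (P.2 * P'.2).
Proof.
case: P => z t; case: P' => z' t'; rewrite /half_space /hdist /= => t0 t0'.
rewrite ler_pdivrMr ?mulr_gt0 // => h.
by have := sqr_ge0 (t - t'); lra.
Qed.

End Distance.

(** * Norm gap, discreteness and reduction in the lattice O *)

Section Lattice.
Variable R : realType.
Local Notation C := R[i].
Local Notation Re := complex.Re.
Local Notation Im := complex.Im.
Variables (O : subringClosed C) (Delta : int) (s e : R).
Hypothesis H : order_lattice O Delta s e.

Lemma s_gt0 : 0 < s. Proof. exact: lat_s_gt0 H. Qed.
Lemma s_gt1 : 19 / 10 < s.
Proof. by have := lat_s2 H; have := s_gt0; nra. Qed.

Lemma e_cases : e = 0 \/ e = 1 / 2.
Proof. by case: (lat_e H) => [[]|]; [left|right]. Qed.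

Lemma tau_mem : tau R Delta \in O.
Proof. by have := lat_mem H 0 1; rewrite mul1r mul1r add0r (lat_tau H). Qed.

Lemma int_mem (m : int) : m%:~R \in O. Proof. by rewrite rpred_int. Qed.

Lemma sqrt_disc_mem : Complex 0 (2 * s) \in O.
Proof.
have [h|h] := e_cases.
  suff -> : Complex 0 (2 * s) = Complex (0%:~R + 2%:~R * e) (2%:~R * s) by exact: lat_mem H 0 2.
  by rewrite h; congr Complex; ring.
suff -> : Complex 0 (2 * s) = Complex ((-1)%:~R + 2%:~R * e) (2%:~R * s) by exact: lat_mem H (-1) 2.
by rewrite h rmorphN; congr Complex; field.
Qed.

Lemma lattice_real (a : C) : a \in O -> Im a = 0 -> exists m : int, a = m%:~R.
Proof.
move=> /(latP H) [m [k [hR hI]]] h0; exists m.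
have k0 : (k%:~R : R) = 0.
  by apply: (mulIf (lt0r_neq0 s_gt0)); rewrite -hI h0 mul0r.
by apply: complex_eqP; rewrite !cE // hR k0 mul0r addr0.
Qed.

Lemma lattice_Im_neq0 (k : int) : k != 0 -> s ^+ 2 <= (k%:~R * s) ^+ 2.
Proof.
move=> k0; rewrite exprMn ler_peMl ?sqr_ge0 // -rmorphXn /= -[1]/(1%:~R) ler_int.
by rewrite expr2; nia.
Qed.

(** The bound on |Delta| enters here: for -11 and -12 there are elements of norm 3. The tight case
    is e = 1/2 and Im a = s or -s, where the real part is an odd multiple of 1/2 and 1/4 + 15/4 =
    4. *)
Lemma lattice_gap (a : C) : a \in O -> [\/ a = 0, a = 1, a = -1 | 4 <= sqnorm a].
Proof.
move=> aO; have [m [k [hR hI]]] := latP H aO.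
have [k0|k0] := eqVneq k 0.
  have I0 : Im a = 0 by rewrite hI k0 mul0r.
  have [m' em] := lattice_real aO I0.
  have [| ] := boolP ((m' == 0) || (m' == 1) || (m' == -1)).
    rewrite em => /orP[/orP[]|] /eqP ->; [constructor 1|constructor 2|constructor 3]; by [].
  rewrite !negb_or => hm; constructor 4; rewrite em /sqnorm !cE expr0n addr0.
  rewrite -rmorphXn /= -[4]/(4%:~R) ler_int expr2.
  by move: hm => /andP[/andP[h1 h2] h3]; nia.
constructor 4; rewrite /sqnorm hI hR.
have := lattice_Im_neq0 k0.
case: (lat_e H) => [[-> s4]|he] h.
  by rewrite mulr0 addr0; have := sqr_ge0 (m%:~R : R); lra.
have := lat_s2 H => s15.
have [hk|hk] : (k = 1 \/ k = -1) \/ (2 <= k \/ k <= -2) by lia.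
  have : 1%:~R <= ((2 * m + k) * (2 * m + k))%:~R :> R.
    by rewrite ler_int; case: hk => ->; nia.
  rewrite !(rmorphM, rmorphD) /= he.
  have -> : (k%:~R * s) ^+ 2 = s ^+ 2 by case: hk => ->; rewrite ?rmorphN; ring.
  by lra.
have {hk} : 4 <= k * k by case: hk => hk; nia.
rewrite -(ler_int R) => hk.
move: hk; rewrite rmorphM /= exprMn => hk'.
have := sqr_ge0 (m%:~R + k%:~R * e).
by nra.
Qed.

Lemma sqnorm_ge1 (a : C) : a \in O -> a != 0 -> 1 <= sqnorm a.
Proof.
case/lattice_gap => [->|->|->|h] n0; rewrite ?eqxx // in n0 *.
- by rewrite /sqnorm !cE; lra.
- by rewrite /sqnorm !cE; lra.
- by lra.
Qed.

Lemma lattice_unit (a d : C) : a \in O -> d \in O -> a * d = 1 -> (a = 1 /\ d = 1) \/ (a = -1 /\ d = -1).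
Proof.
move=> aO dO h.
have a0 : a != 0 by apply: contra_eq_neq h => ->; rewrite mul0r eq_sym oner_neq0.
have d0 : d != 0 by apply: contra_eq_neq h => ->; rewrite mulr0 eq_sym oner_neq0.
have n1 : sqnorm a * sqnorm d = 1 by rewrite -sqnormM h /sqnorm !cE; ring.
have hd := sqnorm_ge1 dO d0.
case: (lattice_gap aO) => [ea|ea|ea|ea].
- by rewrite ea eqxx in a0.
- by left; split=> //; rewrite -h ea mul1r.
- by right; split=> //; rewrite -h ea mulN1r opprK.
- by exfalso; clear -n1 hd ea; nra.
Qed.

Lemma floor_bounds (x : R) : exists k : int, k%:~R <= x /\ x < k%:~R + 1.
Proof.
exists (Num.floor x); have := real_floor_itv (num_real x).
by rewrite rmorphD /= => /andP[].
Qed.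

Lemma row_nearest (z : C) (k : int) : exists a, [/\ a \in O, Im a = k%:~R * s & - (1/2) <= Re (z - a) <= 1 / 2].
Proof.
have [m [h1 h2]] := floor_bounds (Re z - k%:~R * e + 1 / 2).
exists (Complex (m%:~R + k%:~R * e) (k%:~R * s)); split; rewrite ?(lat_mem H) // !cE.
lra.
Qed.

Lemma strip_index (y : R) : exists k : int, k%:~R * s <= y /\ y < (k%:~R + 1) * s.
Proof.
have [k [h1 h2]] := floor_bounds (y / s); exists k.
by rewrite -ler_pdivlMr ?s_gt0 // -ltr_pdivrMr ?s_gt0.
Qed.

Lemma lattice_reduce (z : C) : exists2 a, a \in O & - (1/2) <= Re (z - a) <= 1 / 2 /\ 0 <= Im (z - a) <= s.
Proof.
have [k [h1 h2]] := strip_index (Im z).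
have [a [aO aI aR]] := row_nearest z k; exists a => //; split=> //.
by rewrite !cE aI; lra.
Qed.

Definition int_box (K : nat) : seq int := [seq i%:Z - K%:Z | i <- iota 0 (2 * K + 1)].

Lemma mem_int_box (K : nat) (m : int) : (m * m <= K%:Z) -> m \in int_box K.
Proof.
move=> h; apply/mapP; exists (absz (m + K%:Z)); last by nia.
by rewrite mem_iota; nia.
Qed.

Lemma lattice_box (B : R) : exists l : seq C, forall a, a \in O -> sqnorm a <= B -> a \in l.
Proof.
have [K [_ hK]] := floor_bounds (4 * B + 4).
set K1 := (absz K).+1.
exists [seq Complex (m%:~R + k%:~R * e) (k%:~R * s) | m <- int_box K1, k <- int_box K1].
move=> a aO ha; have [m [k [hR hI]]] := latP H aO.
have KB : 4 * B + 4 <= K1%:~R :> R.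
  apply/ltW/(lt_le_trans hK); rewrite -[1]/(1%:~R) -rmorphD /= ler_int /K1; lia.
have B0 : 0 <= B by exact: le_trans (sqnorm_ge0 a) ha.
have s1 := lat_s2 H.
move: ha; rewrite /sqnorm hR hI => ha.
have hk : k%:~R ^+ 2 <= B :> R.
  have := sqr_ge0 (m%:~R + k%:~R * e); have := sqr_ge0 (k%:~R : R).
  by move: ha; rewrite [(_ * s) ^+ 2]exprMn; nra.
have hm : m%:~R ^+ 2 <= 4 * B + 4 :> R.
  have hr : (m%:~R + k%:~R * e) ^+ 2 <= B by have := sqr_ge0 (k%:~R * s); lra.
  have he : (k%:~R * e) ^+ 2 <= B.
    rewrite exprMn; case: e_cases => ->; rewrite ?expr0n ?mulr0 //.
    by have := sqr_ge0 (k%:~R : R); lra.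
  have := sqr_ge0 (m%:~R + k%:~R * e + k%:~R * e); lra.
apply/allpairsP; exists (m, k) => /=; split.
- by apply: mem_int_box; rewrite -(ler_int R) rmorphM /=; lra.
- by apply: mem_int_box; rewrite -(ler_int R) rmorphM /=; lra.
- by apply: complex_eqP; rewrite !cE.
Qed.

End Lattice.

(** * Normal forms in PE2 *)

Section GenInd.
Variable F : fieldType.

(** The h such that left multiplication by h and by h^-1 both preserve [X] form a subgroup; the
    clause on h^-1 is what makes it closed under inverses. *)
Lemma gen_ind (S : set (PSL2 F)) (X : PSL2 F -> Prop) : X 1%g ->
  (forall h g, S h -> X g -> X (h * g)%g) ->
  (forall h g, S h -> X g -> X (h^-1 * g)%g) ->
  forall g, g \in gen S -> X g.
Proof.
move=> X1 XS XV g /asboolP gS.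
pose B : {pred PSL2 F} := fun h => `[< (forall g, X g -> X (h * g)%g) /\
   (forall g, X g -> X (h^-1 * g)%g) >].
have : g \in B.
  apply: gS => [|h Sh]; last first.
    by apply/asboolP; split=> k Xk; [exact: XS | exact: XV].
  split; first by apply/asboolP; split=> k; rewrite ?invg1 mul1g.
  move=> x y /asboolP[hx hxV] /asboolP[hy hyV]; apply/asboolP; split=> k Xk.
    by rewrite -mulgA; apply/hx/hyV.
  by rewrite invgM invgK -mulgA; apply/hy/hxV.
by case/asboolP => /(_ 1%g X1); rewrite mulg1.
Qed.

Lemma rot_upper_rot (a b d : F) : a * d = 1 ->
  (Defs.rot F * psl a b 0 d * Defs.rot F)%g = psl d 0 (- b) a.
Proof.
move=> h; have h1 : 0 * 0 - (-1) * 1 = 1 :> F by ring.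
have h2 : a * d - b * 0 = 1 by rewrite h; ring.
have h3 : d * a - 0 * - b = 1 by rewrite -[RHS]h; ring.
rewrite rotE psl_mul // psl_mul //; last by rewrite -[RHS]h; ring.
by rewrite -[RHS]pslN //; congr psl; ring.
Qed.

Lemma pi_eq0 (M : SL2 F) : val M 1 0 = 0 -> val M 0 0 * val M 1 1 = 1.
Proof. by move=> h; have := SL2_det2 M; rewrite h mulr0 subr0. Qed.

End GenInd.

Lemma group1 (F : fieldType) (A : groupClosed (PSL2 F)) : (1%g : PSL2 F) \in A.
Proof. exact: gpred1. Qed.
Lemma groupV (F : fieldType) (A : groupClosed (PSL2 F)) (g : PSL2 F) : g \in A -> g^-1%g \in A.
Proof. by rewrite gpredV. Qed.
Lemma groupM (F : fieldType) (A : groupClosed (PSL2 F)) (g h : PSL2 F) : g \in A -> h \in A -> (g * h)%g \in A.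
Proof. exact: gpredM. Qed.

Section Elementary.
Variable R : realType.
Local Notation C := R[i].
Local Notation Im := complex.Im.
Variables (O : subringClosed C) (Delta : int) (s e : R).
Hypothesis H : order_lattice O Delta s e.
Local Notation tau := (tau R Delta).
Local Notation N := (Ngroup R Delta).

Lemma rot_PE2 : rot C \in PE2 O.
Proof.
apply: mem_gen; exists (MkSL2 (rot_subproof C)); split=> //.
  by move=> i j; rewrite mxE; do 2?case: ifP => _; rewrite ?rpred0 ?rpred1 ?rpredN ?rpred1.
have l01 : lift 0 0 = 1 :> 'I_2 by apply/val_inj.
constructor 4; exists (tperm 0 1) => i j; rewrite !mxE /=.
case: (unliftP 0 i) => [i'|] ->; case: (unliftP 0 j) => [j'|] ->; rewrite ?ord1 ?l01 /=.
- by left; rewrite tpermR.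
- by left; rewrite tpermR.
- by right; rewrite tpermL.
- by left; rewrite tpermL.
Qed.

Lemma shift_PE2 a : a \in O -> shift a \in PE2 O.
Proof.
move=> aO; apply: mem_gen; exists (MkSL2 (shift_subproof a)); split=> //.
  by move=> i j; rewrite mxE; do 2?case: ifP => _; rewrite ?rpred0 ?rpred1.
constructor 3; apply/is_trig_mxP => i j ij; rewrite !mxE.
by case: (unliftP 0 j) ij => [j'|] -> //=; case: (unliftP 0 i) => [i'|] ->; rewrite ?ord1.
Qed.

Lemma psl_upper a b d : a \in O -> b \in O -> d \in O -> a * d = 1 ->
  exists2 b', b' \in O & psl a b 0 d = shift b'.
Proof.
move=> aO bO dO h; case: (lattice_unit H aO dO h) => -[-> ->].
  by exists b => //; rewrite shiftE.
exists (- b); first by rewrite rpredN.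
by rewrite shiftE -[RHS]pslN ?opprK ?oppr0 //; ring.
Qed.

(** The units of O are 1 and -1, so up to sign a triangular matrix is unipotent, and conjugation by
    r exchanges lower and upper ones. A signed permutation matrix with c != 0 and determinant 1 is r
    up to sign. *)
Lemma elementary_cases (M : SL2 C) : mxin O M -> elementary_mx M ->
  exists2 b, b \in O & [\/ \pi_(PSL2 C) M = shift b,
    \pi_(PSL2 C) M = (rot C * shift b * rot C)%g | \pi_(PSL2 C) M = rot C].
Proof.
move=> MO.
have d1 := SL2_det2 M.
have upper : val M 1 0 = 0 -> exists2 b, b \in O & \pi_(PSL2 C) M = shift b.
  move=> h; rewrite pi_psl h; apply: psl_upper; try exact: MO.
  exact: pi_eq0.
have up : val M 1 0 = 0 -> exists2 b, b \in O & [\/ \pi_(PSL2 C) M = shift b,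
    \pi_(PSL2 C) M = (rot C * shift b * rot C)%g | \pi_(PSL2 C) M = rot C].
  by move=> /upper[b bO ->]; exists b => //; constructor 1.
case.
- by move/is_diag_mxP => h; apply: up; apply: h.
- move/is_trig_mxP => h.
  have b0 : val M 0 1 = 0 by apply: h.
  have ad : val M 1 1 * val M 0 0 = 1 by rewrite -[RHS]d1 b0; ring.
  have cO : - val M 1 0 \in O by rewrite rpredN; apply: MO.
  have [b bO eb] := psl_upper (MO 1 1) cO (MO 0 0) ad.
  exists b => //; constructor 2; rewrite -eb pi_psl b0.
  by rewrite (rot_upper_rot _ ad) opprK.
- move/is_trig_mxP => h; apply: up.
  by have := h 0 1 isT; rewrite mxE.
- case=> p hp.
  have mxp i j : val M i j != 0 -> p i = j.
    by case: (hp i j) => ->; rewrite !mxE; case: (p i =P j) => // _; rewrite ?oppr0 eqxx.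
  have mxq i j : p i = j -> val M i j = 1 \/ val M i j = -1.
    by move=> pij; case: (hp i j) => ->; rewrite !mxE pij eqxx; [left|right].
  have [c0|c0] := eqVneq (val M 1 0) 0; first exact: up.
  exists 0; first exact: rpred0.
  have p1 := mxp _ _ c0.
  have p0 : p 0 = 1.
    case: (unliftP 0 (p 0)) => [j'|] h0; first by rewrite h0 ord1; apply/val_inj.
    by have := perm_inj (etrans h0 (esym p1)).
  have a0 : val M 0 0 = 0.
    by apply/eqP/negPn/negP => /mxp; rewrite p0.
  have d0 : val M 1 1 = 0.
    by apply/eqP/negPn/negP => /mxp; rewrite p1.
  constructor 3; rewrite pi_psl a0 d0 rotE; move: d1; rewrite a0 d0.
  case: (mxq _ _ p0) => ->; case: (mxq _ _ p1) => -> d1.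
  + by exfalso; have := congr1 (@complex.Re R) d1; rewrite !cE; lra.
  + by rewrite -[RHS]pslN ?opprK ?oppr0 //; ring.
  + by [].
  + by exfalso; have := congr1 (@complex.Re R) d1; rewrite !cE; lra.
Qed.

Lemma PE2_ind (X : PSL2 C -> Prop) : X 1%g ->
  (forall g, X g -> X (rot C * g)%g) ->
  (forall a g, a \in O -> X g -> X (shift a * g)%g) ->
  forall g, g \in PE2 O -> X g.
Proof.
move=> X1 Xr Xs; apply: gen_ind => // h g [M [MO Me ->]] Xg;
  have [b bO [] ->] := elementary_cases MO Me.
- exact: Xs.
- by rewrite -!mulgA; apply/Xr/Xs/Xr.
- exact: Xr.
- by rewrite shift_inv; apply: Xs; rewrite ?rpredN.
- rewrite !invgM rot_inv shift_inv -!mulgA.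
  by apply/Xr/Xs/Xr; rewrite ?rpredN.
- by rewrite rot_inv; apply: Xr.
Qed.

Lemma rot_over : rot C \in PSL2_over O.
Proof.
rewrite rotE; apply: psl_over; rewrite ?rpred0 ?rpred1 ?rpredN ?rpred1 //; ring.
Qed.

Lemma shift_over a : a \in O -> shift a \in PSL2_over O.
Proof.
by move=> aO; rewrite shiftE; apply: psl_over; rewrite ?rpred0 ?rpred1 //; ring.
Qed.

Lemma PE2_over : {subset PE2 O <= PSL2_over O}.
Proof.
apply: (PE2_ind (X := fun g => g \in PSL2_over O)) => [|g gG|a g aO gG]; first exact: gpred1.
- by apply: groupM => //; exact: rot_over.
- by apply: groupM => //; exact: shift_over.
Qed.

Lemma rot_N : rot C \in N.
Proof. by apply: mem_gen; constructor 1. Qed.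

Lemma shift_int_N (m : int) : shift (m%:~R) \in N.
Proof.
have h1 : shift (1 : C) \in N by apply: mem_gen; constructor 2.
have hn (n : nat) : shift (n%:R : C) \in N.
  elim: n => [|n IH]; first by rewrite shift0 gpred1.
  by rewrite -natr1 -shift_mul; exact: groupM.
case: m => n; first exact: hn.
by rewrite NegzE mulrNz -shift_inv; apply: groupV; exact: hn.
Qed.

Lemma rot_tau_N : (shift tau * rot C * shift (- tau))%g \in N.
Proof. by apply: mem_gen; constructor 3; rewrite shift_inv. Qed.

Lemma N_PE2 : {subset N <= PE2 O}.
Proof.
have tO := tau_mem H.
apply: gen_sub => g [] ->; first exact: rot_PE2.
- by apply: shift_PE2; exact: rpred1.
- apply: groupM; last by apply: groupV; exact: shift_PE2.
  by apply: groupM; [exact: shift_PE2 | exact: rot_PE2].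
Qed.

Fixpoint word (l : seq C) (b : C) : PSL2 C :=
  if l is a :: l' then (shift a * rot C * word l' b)%g else shift b.

(* By the gap between 1 and 2 in the norms of O (Cohn's discretely normed
   rings), interior entries can be kept at norm at least 2. *)
Definition reduced (l : seq C) : Prop :=
  {subset l <= O} /\ {in behead l, forall a, 4 <= sqnorm a}.

(** An invariant of the rewriting rules for words: units are real, so deleting an entry 0, 1 or -1
    keeps the total imaginary part. The generators of N have total 0, which separates s(tau) from
    N. *)
Definition height_sum (l : seq C) (b : C) : R := \sum_(a <- l) Im a + Im b.

Definition nform (g : PSL2 C) (y : R) : Prop :=
  exists l b, [/\ reduced l, b \in O, g = word l b & y = height_sum l b].

Lemma word_shift l b a : reduced l -> b \in O -> a \in O ->
  exists l' b', [/\ reduced l', b' \in O, size l' = size l,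
    (shift a * word l b)%g = word l' b' & height_sum l' b' = Im a + height_sum l b].
Proof.
case: l => [|c l] [lO lg] bO aO.
  exists [::], (a + b); split=> //=; first by rewrite rpredD.
    by rewrite shift_mul.
  by rewrite /height_sum !big_nil ImD !add0r.
exists (a + c :: l), b; split=> //=.
- split=> // x; rewrite inE => /orP[/eqP->|xl].
    by rewrite rpredD // lO // mem_head.
  by apply: lO; rewrite inE xl orbT.
- by rewrite -shift_mul !mulgA.
- by rewrite /height_sum !big_cons ImD !addrA.
Qed.

Lemma nform_shift g y a : a \in O -> nform g y -> nform (shift a * g)%g (Im a + y).
Proof.
move=> aO [l [b [lr bO -> ->]]].
by have [l' [b' [? ? _ e1 e2]]] := word_shift lr bO aO; exists l', b'.
Qed.

Lemma reduced_behead a l : reduced (a :: l) -> reduced l.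
Proof.
move=> [lO lg]; split=> [x xl|x xl]; first by apply: lO; rewrite inE xl orbT.
by apply: lg; apply: mem_behead.
Qed.

(** An entry 0 cancels by r r = 1, an entry 1 or -1 is removed by [rot_shift_rot], and larger ones
    stay. Since the unit case shifts the tail before recursing, the induction is on its length and
    not on its structure. *)
Lemma nform_rot_word n l b : (size l <= n)%N -> reduced l -> b \in O ->
  nform (rot C * word l b)%g (height_sum l b).
Proof.
elim: n l b => [|n IH] [|a l] b //.
1,2: move=> _ _ bO; exists [:: 0], b; split=> //=; rewrite ?shift0 ?mul1g //.
1,3: by split=> // x; rewrite inE => /eqP ->; exact: rpred0.
1,2: by rewrite /height_sum big_cons add0r.
move=> /= sl lr bO.
have aO : a \in O by case: lr => lO _; apply: lO; rewrite mem_head.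
have lr' := reduced_behead lr.
have unit_case : a * a = 1 -> Im a = 0 ->
    nform (rot C * (shift a * rot C * word l b))%g (height_sum (a :: l) b).
  move=> aa a0; rewrite !mulgA rot_shift_rot // -mulgA.
  have naO : - a \in O by rewrite rpredN.
  have [l' [b' [rl' bO' sl' -> hs]]] := word_shift lr' bO naO.
  rewrite -mulgA; have := nform_shift naO (IH l' b' _ rl' bO').
  rewrite sl' hs /height_sum big_cons ImN a0 oppr0 !add0r; exact.
case: (lattice_gap H aO) => [a0|a1|a1|a4].
- exists l, b; split=> //; rewrite a0; last by rewrite /height_sum big_cons add0r.
  by rewrite shift0 mul1g mulgA rot2 mul1g.
- by apply: unit_case; rewrite a1 ?mulr1.
- by apply: unit_case; rewrite a1 ?mulrNN ?mulr1 //= oppr0.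
- exists (0 :: a :: l), b; split=> //=.
  + split=> x; first by rewrite inE => /orP[/eqP->|]; [exact: rpred0 | case: lr => lO _; exact: lO].
    by rewrite /= inE => /orP[/eqP->//|xl]; case: lr => _; apply.
  + by rewrite shift0 mul1g.
  + by rewrite /height_sum [in RHS]big_cons add0r.
Qed.

Lemma nform_rot g y : nform g y -> nform (rot C * g)%g y.
Proof. by move=> [l [b [lr bO -> ->]]]; exact: nform_rot_word (leqnn _) _ _. Qed.

Lemma nform1 : nform 1%g 0.
Proof.
exists [::], 0; split; rewrite ?rpred0 //= ?shift0 //.
by rewrite /height_sum big_nil add0r.
Qed.

Lemma PE2_nform g : g \in PE2 O -> exists y, nform g y.
Proof.
apply: (PE2_ind (X := fun g => exists y, nform g y)) => [|k [y h]|a k aO [y h]];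
  first by exists 0; exact: nform1.
- by exists y; exact: nform_rot.
- by exists (Im a + y); exact: nform_shift.
Qed.

Lemma N_nform g : g \in N -> nform g 0.
Proof.
have tO := tau_mem H.
have T k : nform k 0 -> nform (shift tau * (rot C * (shift (- tau) * k)))%g 0.
  move=> hk; have -> : 0 = Im tau + (Im (- tau) + 0) by rewrite ImN addr0 subrr.
  by apply: nform_shift => //; apply/nform_rot/nform_shift => //; rewrite rpredN.
apply: (gen_ind (X := fun g => nform g 0)); first exact: nform1.
- move=> h k [] -> hk; first exact: nform_rot.
  + by have := nform_shift (rpred1 O) hk; rewrite add0r.
  + by rewrite shift_inv -!mulgA; exact: T.
- move=> h k [] -> hk; first by rewrite rot_inv; exact: nform_rot.
  + have h1 : - 1 \in O by rewrite rpredN rpred1.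
    by have := nform_shift h1 hk; rewrite /= oppr0 add0r shift_inv.
  + by rewrite !invgM invgK rot_inv shift_inv -!mulgA; exact: T.
Qed.

End Elementary.

(** * Heights and strips *)

Lemma seq_argmin (T : eqType) (R : realType) (l : seq T) (P : T -> Prop) (f : T -> R) :
  (exists2 x, x \in l & P x) ->
  exists x, P x /\ forall y, y \in l -> P y -> f x <= f y.
Proof.
elim: l => [[] //|x0 l IH] [x].
have [ex _|nex] := pselect (exists2 x, x \in l & P x).
  have [y [Py hy]] := IH ex.
  have [[P0 h0]|n0] := pselect (P x0 /\ f x0 <= f y).
    exists x0; split=> // z; rewrite inE => /orP[/eqP->//|zl Pz].
    exact: le_trans h0 (hy _ zl Pz).
  exists y; split=> // z; rewrite inE => /orP[/eqP->|zl] Pz; last exact: hy.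
  by case: (leP (f y) (f x0)) => // /ltW h; case: n0.
rewrite inE => /orP[/eqP-> Px0|xl Px]; last by case: nex; exists x.
exists x0; split=> // z; rewrite inE => /orP[/eqP->//|zl Pz].
by case: nex; exists z.
Qed.

Section Sides.
Variable R : realType.
Local Notation C := R[i].
Local Notation Re := complex.Re.
Local Notation Im := complex.Im.
Variables (O : subringClosed C) (Delta : int) (s e : R).
Hypothesis H : order_lattice O Delta s e.
Local Notation tau := (tau R Delta).
Local Notation N := (Ngroup R Delta).

Lemma sqnormD_le (z w : C) : sqnorm (z + w) <= 2 * sqnorm z + 2 * sqnorm w.
Proof.
rewrite /sqnorm !cE; have := sqr_ge0 (Re z - Re w); have := sqr_ge0 (Im z - Im w); lra.
Qed.

Lemma ht_psl_le (a b c d a' b' c' d' : C) (P : C * R) : half_space P ->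
  a * d - b * c = 1 -> a' * d' - b' * c' = 1 -> den c' d' P <= den c d P ->
  (act (psl a b c d) P).2 <= (act (psl a' b' c' d') P).2.
Proof.
move=> hP h h'; rewrite (ht_psl _ h) (ht_psl _ h').
have := den_gt0 hP h; have := den_gt0 hP h'; have : 0 < P.2 := hP.
move: (P.2) (den c d P) (den c' d' P) => t D D' t0 D'0 D0 le.
by rewrite ler_pM2l // lef_pV2.
Qed.

(** The list does not depend on [P]: this uniformity permits a pigeonhole argument over infinitely
    many floor points. *)
Lemma rows_finite (B T : R) : 0 < T -> exists l : seq (C * C), forall c d P, c \in O -> d \in O ->
  T <= P.2 -> sqnorm P.1 <= B -> forall D, den c d P <= D -> D <= B -> (c, d) \in l.
Proof.
move=> T0; have T20 : 0 < T ^+ 2 by rewrite exprn_gt0.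
have [lc hlc] := lattice_box H (B / T ^+ 2).
have [ld hld] := lattice_box H (2 * B + 2 * (B / T ^+ 2 * B)).
exists [seq (c, d) | c <- lc, d <- ld] => c d P cO dO TP zB D hD DB.
have n1 := sqnorm_ge0 (c * P.1 + d); have n2 := sqnorm_ge0 c; have n4 := sqnorm_ge0 P.1.
have TP2 : T ^+ 2 <= P.2 ^+ 2 by rewrite lerXn2r // nnegrE; lra.
have hc' : sqnorm c * T ^+ 2 <= B.
  by move: hD; rewrite /den => hD; have := ler_wpM2l n2 TP2; lra.
have hc : sqnorm c <= B / T ^+ 2 by rewrite ler_pdivlMr.
apply/allpairsP; exists (c, d); split=> //=; first exact: hlc.
apply: hld => //.
have := sqnormD_le (c * P.1 + d) (- (c * P.1)); rewrite addrAC subrr add0r sqnormN sqnormM.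
have : sqnorm c * sqnorm P.1 <= B / T ^+ 2 * B by apply: ler_pM.
have : sqnorm (c * P.1 + d) <= B.
  by move: hD; rewrite /den; have := mulr_ge0 n2 (sqr_ge0 P.2); lra.
lra.
Qed.

(** Heights in the orbit are t / den, and only finitely many rows have den at most that of a given
    element. So a maximum is attained over any nonempty [E], be it a subgroup or not. *)
Lemma orbit_max (P : C * R) (E : PSL2 C -> Prop) : half_space P ->
  (forall g, E g -> g \in PSL2_over O) -> (exists g, E g) ->
  exists g, E g /\ forall h, E h -> (act h P).2 <= (act g P).2.
Proof.
move=> hP EG [g0 Eg0].
have [a0 [b0 [c0 [d0 [h0 _ eg0]]]]] := PSL2_overP (EG _ Eg0).
set D0 := den c0 d0 P.
have D0_gt0 : 0 < D0 := den_gt0 hP h0.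
have t0 : 0 < P.2 := hP.
have [l hl] := rows_finite (sqnorm P.1 + D0) t0.
have inl c d : c \in O -> d \in O -> den c d P <= D0 -> (c, d) \in l.
  move=> cO dO le; apply: (hl c d P cO dO (lexx _) _ D0 le).
    by rewrite lerDl ltW.
  by rewrite lerDr sqnorm_ge0.
pose Q (x : C * C) := exists a b, [/\ a * x.2 - b * x.1 = 1, E (psl a b x.1 x.2),
   x.1 \in O & x.2 \in O].
have QE g : E g -> exists a b c d, [/\ Q (c, d), a * d - b * c = 1 & g = psl a b c d].
  move=> Eg; have [a [b [c [d [h [aO bO cO dO] eg]]]]] := PSL2_overP (EG _ Eg).
  by exists a, b, c, d; split=> //; exists a, b; rewrite -eg.
have [[c d] [[a [b [/= hdet Eg cO dO]]] hmin]] : exists x, Q x /\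
    forall y, y \in l -> Q y -> den x.1 x.2 P <= den y.1 y.2 P.
  apply: seq_argmin.
  have [a [b [c [d [Qcd h eg]]]]] := QE _ Eg0.
  have [_ [_ [_ _ cO dO]]] := Qcd.
  exists (c, d) => //; apply: inl => //; rewrite /D0.
  have := ht_psl P h0; rewrite -eg0 eg ht_psl // => /(mulfI (lt0r_neq0 t0)) /invr_inj ->.
  by [].
exists (psl a b c d); split=> // h /QE[a' [b' [c' [d' [Q' hdet' ->]]]]].
apply: ht_psl_le => //.
have [_ [_ [_ _ cO' dO']]] := Q'.
have [le|lt] := leP (den c' d' P) D0; first exact: (hmin (c', d') (inl _ _ cO' dO' le)).
apply: le_trans (ltW lt).
have [a1 [b1 [c1 [d1 [Q1 h1 eg1]]]]] := QE _ Eg0.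
have [_ [_ [_ _ cO1 dO1]]] := Q1.
have e1 : den c1 d1 P = D0.
  by have := ht_psl P h0; rewrite -eg0 eg1 ht_psl // => /(mulfI (lt0r_neq0 t0)) /invr_inj ->.
by rewrite -e1; apply: (hmin (c1, d1)) => //; apply: inl => //; rewrite e1.
Qed.

Lemma nq_rot (P : C * R) : half_space P -> nq (act (rot C) P) = (nq P)^-1.
Proof.
move=> hP; have n0 := nq_gt0 hP; rewrite act_rotE //.
move: n0; rewrite /nq /sqnorm; case: P hP => -[x y] t /= hP n0.
by field; rewrite gt_eqF.
Qed.

Lemma ht_rot (P : C * R) : half_space P -> (act (rot C) P).2 = P.2 / nq P.
Proof. by move=> hP; rewrite act_rotE. Qed.

Lemma Im_rot (P : C * R) : half_space P -> Im (act (rot C) P).1 = Im P.1 / nq P.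
Proof. by move=> hP; rewrite act_rotE. Qed.

Definition outer (P : C * R) : Prop :=
  half_space P /\ forall a, a \in O -> 1 <= nq (P.1 + a, P.2).

Lemma outer_half P : outer P -> half_space P. Proof. by case. Qed.

Lemma outer_shift P a : outer P -> a \in O -> outer (act (shift a) P).
Proof.
rewrite act_shift => -[hP oP] aO; split=> // b bO /=.
by rewrite -addrA; apply: oP; rewrite rpredD.
Qed.

Lemma outer_up z t t' : outer (z, t) -> t <= t' -> outer (z, t').
Proof.
move=> [hP oP] tt; have t0 : 0 < t := hP.
split; first exact: lt_le_trans hP tt.
move=> a aO; have := oP a aO; rewrite /nq /=.
have : t ^+ 2 <= t' ^+ 2 by rewrite lerXn2r // nnegrE; lra.
lra.
Qed.

Lemma max_outer (P : C * R) : half_space P ->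
  (forall g, g \in PE2 O -> (act g P).2 <= P.2) -> outer P.
Proof.
move=> hP hmax; split=> // a aO.
have := hmax (rot C * shift a)%g (groupM (rot_PE2 O) (shift_PE2 aO)).
have hP' : half_space (act (shift a) P) by exact: half_space_act.
rewrite act_mul // ht_rot // act_shift /= ler_pdivrMr; last by rewrite act_shift in hP'; exact: nq_gt0 hP'.
by rewrite ler_pMr.
Qed.

Lemma PE2_reduce (P : C * R) : half_space P -> exists2 a, a \in PE2 O & outer (act a P).
Proof.
move=> hP.
have [a [aA hmax]] := orbit_max hP (PE2_over H (O:=O)) (ex_intro _ 1%g (group1 (PE2 O))).
exists a => //; apply: max_outer; first exact: half_space_act.
by move=> g gA; rewrite -act_mul //; apply: hmax; apply: groupM.
Qed.

(** r sends the outside of the unit ball into the ball, and a translation of length at least 2 moves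
    the open ball off itself. *)
Lemma rot_shift_nq (Y : C * R) a : half_space Y -> 1 <= nq Y -> 4 <= sqnorm a ->
  1 <= nq (act (shift a) (act (rot C) Y)).
Proof.
move=> hY nY na; have : nq (act (rot C) Y) <= 1 by rewrite nq_rot // invf_le1 ?nq_gt0.
rewrite act_shift /nq; case: (act (rot C) Y) => [[x y] t] /=; move: na.
rewrite /sqnorm !cE => na h1.
have := sqr_ge0 (2 * x + Re a); have := sqr_ge0 (2 * y + Im a); have := sqr_ge0 t.
lra.
Qed.

Lemma word_outer (P : C * R) l b : outer P -> {subset l <= O} ->
  {in l, forall a, 4 <= sqnorm a} -> b \in O -> 1 <= nq (act (word l b) P).
Proof.
move=> oP; have hP := outer_half oP.
elim: l => [|a l IH] lO lg bO /=; first by rewrite act_shift; case: oP => _; apply.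
rewrite -mulgA !act_mul //; try by do ?apply: half_space_act.
apply: rot_shift_nq; first exact: half_space_act.
  have sub x : x \in l -> x \in a :: l by rewrite inE => ->; rewrite orbT.
  by apply: IH => // x /sub; [exact: lO | exact: lg].
by apply: lg; rewrite mem_head.
Qed.

Lemma act_word_cons a l b (P : C * R) : half_space P ->
  act (word (a :: l) b) P = act (shift a) (act (rot C) (act (word l b) P)).
Proof. by move=> hP /=; rewrite -mulgA !act_mul //; do ?apply: half_space_act. Qed.

Lemma word_nq_tail (P : C * R) a l b : outer P -> reduced O (a :: l) -> b \in O ->
  1 <= nq (act (word l b) P).
Proof.
move=> oP [lO lg] bO; apply: word_outer => // x xl.
by apply: lO; rewrite inE xl orbT.
Qed.

(** Read from the right, each r acts at a point outside the open unit ball, where it cannot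
    raise. *)
Lemma word_ht (P : C * R) l b : outer P -> reduced O l -> b \in O ->
  (act (word l b) P).2 <= P.2.
Proof.
move=> oP; have hP := outer_half oP.
elim: l => [|a l IH] lr bO; first by rewrite /= act_shift.
rewrite act_word_cons // act_shift /= ht_rot; last exact: half_space_act.
apply: le_trans (IH (reduced_behead lr) bO).
rewrite ler_pdivrMr ?nq_gt0 ?ler_peMr //; try exact: half_space_act.
- by apply: ltW; apply: half_space_act.
- exact: word_nq_tail lr bO.
Qed.

Lemma PE2_ht (P : C * R) g : outer P -> g \in PE2 O -> (act g P).2 <= P.2.
Proof.
by move=> oP /(PE2_nform H)[y [l [b [lr bO -> _]]]]; exact: word_ht.
Qed.

Definition in_strip (k : int) (P : C * R) : Prop :=
  k%:~R * s < Im P.1 /\ Im P.1 < (k%:~R + 1) * s.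

Lemma in_strip_uniq k k' P : in_strip k P -> in_strip k' P -> k = k'.
Proof.
move=> [h1 h2] [h3 h4]; have s0 := s_gt0 H.
have : (k%:~R : R) < (k' + 1)%:~R.
  by rewrite rmorphD /= -(ltr_pM2r s0); apply: lt_trans h1 h4.
have : (k'%:~R : R) < (k + 1)%:~R.
  by rewrite rmorphD /= -(ltr_pM2r s0); apply: lt_trans h3 h2.
by rewrite !ltr_int; lia.
Qed.

Lemma latticeE a : a \in O -> exists m k : int, a = m%:~R + k%:~R * tau.
Proof.
move=> /(latP H)[m [k [hR hI]]]; exists m, k; rewrite (lat_tau H).
by apply: complex_eqP; rewrite !cE ?hR ?hI; ring.
Qed.

Lemma in_strip_shift k j (m : int) P : in_strip k P -> in_strip (k + j) (act (shift (m%:~R + j%:~R * tau)) P).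
Proof.
rewrite act_shift /in_strip (lat_tau H) /= !cE => -[h1 h2].
by rewrite rmorphD /=; split; lra.
Qed.

Lemma ktau_mem (k : int) : k%:~R * tau \in O.
Proof. by rewrite rpredM ?int_mem ?(tau_mem H). Qed.

(** Losing at most a factor 3 of height forces nq <= 3 < s^2 wherever an r acts, so the point is
    then in one of the two strips along the real axis. There r keeps the strip, as it preserves the
    sign of Im and lands in the unit ball. It also keeps the coset: in the upper strip because r is
    in N, in the lower one because s(tau) r s(-tau) is. *)
Lemma word_strip (P : C * R) l b : outer P -> in_strip 0 P -> reduced O l -> b \in O ->
  P.2 / 3 <= (act (word l b) P).2 ->
  exists k, in_strip k (act (word l b) P) /\ (shift (- (k%:~R * tau)) * word l b)%g \in N.
Proof.
move=> oP sP; have hP := outer_half oP.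
elim: l => [|a l IH] lr bO.
  move=> _; have [m [k ->]] := latticeE bO; exists k; split.
    by have := in_strip_shift k m sP; rewrite add0r.
  by rewrite /= shift_mul addrC addrK; exact: shift_int_N.
have hY : half_space (act (word l b) P) by exact: half_space_act.
have nY := word_nq_tail oP lr bO.
have tY := word_ht oP (reduced_behead lr) bO.
rewrite act_word_cons //; set Y := act (word l b) P in hY nY tY IH *.
have Y0 : 0 < Y.2 := hY.
have n0 := nq_gt0 hY.
rewrite {1}act_shift ht_rot //= ler_pdivlMr // => hh.
have [k [sY wN]] : exists k, in_strip k Y /\ (shift (- (k%:~R * tau)) * word l b)%g \in N.
  apply: IH => //; first exact: reduced_behead lr.
  apply: le_trans hh; rewrite ler_peMr // divr_ge0 //; exact: ltW.
have nY3 : nq Y <= 3.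
  have := nY; have : 0 < P.2 := hP; nra.
have kk : k = 0 \/ k = -1.
  have I3 : (Im Y.1) ^+ 2 <= 3.
    apply: le_trans nY3; rewrite /nq /sqnorm.
    have := sqr_ge0 (Re Y.1); have := sqr_ge0 Y.2; lra.
  have s0 := s_gt0 H; have s15 := lat_s2 H.
  have i1 : Im Y.1 < s by nra.
  have i2 : - s < Im Y.1 by nra.
  case: sY => h1 h2.
  have k1 : (k%:~R : R) < 1%:~R by rewrite -(ltr_pM2r s0) mul1r; lra.
  have k2 : ((-2)%:~R : R) < k%:~R by rewrite -(ltr_pM2r s0) rmorphN /=; lra.
  by move: k1 k2; rewrite !ltr_int; clear; lia.
have sZ : in_strip k (act (rot C) Y).
  have s0 := s_gt1 H.
  have I1 : (Im (act (rot C) Y).1) ^+ 2 <= 1.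
    have : nq (act (rot C) Y) <= 1 by rewrite nq_rot // invf_le1.
    rewrite /nq /sqnorm; have := sqr_ge0 (Re (act (rot C) Y).1); have := sqr_ge0 (act (rot C) Y).2; lra.
  have i1 : Im (act (rot C) Y).1 < s by nra.
  have i2 : - s < Im (act (rot C) Y).1 by nra.
  case: sY; move: i1 i2; rewrite /in_strip Im_rot //.
  case: kk => -> i1 i2; rewrite ?rmorphN /= => h1 h2; split; try lra.
  - by rewrite mul0r divr_gt0 // -(mul0r s).
  - have h3 : Im Y.1 < 0 by lra.
    by rewrite addNr mul0r pmulr_llt0 // invr_gt0.
have rN : (shift (- (k%:~R * tau)) * (rot C * word l b))%g \in N.
  case: kk wN => ->.
    by rewrite mulr0z mul0r oppr0 shift0 !mul1g => wN; exact: groupM (rot_N R Delta) wN.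
  rewrite rmorphN mulN1r opprK => wN.
  suff -> : (shift tau * (rot C * word l b))%g = (shift tau * rot C * shift (- tau) * (shift tau * word l b))%g.
    exact: groupM (rot_tau_N R Delta) wN.
  by rewrite -!mulgA [(shift (- tau) * _)%g]mulgA shift_mul addNr shift0 mul1g.
have aO : a \in O by case: lr => lO _; apply: lO; rewrite mem_head.
have [m [j ea]] := latticeE aO; exists (k + j); rewrite ea; split; first exact: in_strip_shift.
suff -> : (shift (- ((k + j)%:~R * tau)) * word ((m%:~R + j%:~R * tau) :: l) b)%g =
  (shift m%:~R * (shift (- (k%:~R * tau)) * (rot C * word l b)))%g.
  exact: groupM (shift_int_N R Delta m) rN.
rewrite /= -[(shift (m%:~R + _) * rot C * _)%g]mulgA !(mulgA _ _ (rot C * word l b)%g) !shift_mul.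
congr (shift _ * _)%g.
by rewrite rmorphD; ring.
Qed.

Lemma PE2_strip (P : C * R) g : outer P -> in_strip 0 P -> g \in PE2 O ->
  P.2 / 3 <= (act g P).2 ->
  exists k, in_strip k (act g P) /\ (shift (- (k%:~R * tau)) * g)%g \in N.
Proof.
by move=> oP sP /(PE2_nform H)[y [l [b [lr bO -> _]]]]; exact: word_strip.
Qed.

(** On each row Im = j s some centre is within horizontal distance 1/2, so the squared vertical
    offset exceeds 1 - 1/4 - 4/9 = 11/36 > 1/4. *)
Lemma outer_low_strip (P : C * R) : outer P -> P.2 < 2 / 3 ->
  exists k : int, k%:~R * s + 1 / 2 < Im P.1 /\ Im P.1 < (k%:~R + 1) * s - 1 / 2.
Proof.
move=> [hP oP] t23; have t0 : 0 < P.2 := hP.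
have [k [h1 h2]] := strip_index H (Im P.1); exists k.
have row j : 1 / 4 < (Im P.1 - j%:~R * s) ^+ 2.
  have [a [aO aI aR]] := row_nearest H P.1 j.
  have naO : - a \in O by rewrite rpredN.
  have := oP _ naO; rewrite /nq /sqnorm /=; move: aR; rewrite !cE aI.
  by move: (Re P.1 - Re a) => u; nra.
have r0 := row k; have r1 := row (k + 1).
rewrite rmorphD /= in r1.
split; nra.
Qed.

End Sides.

(** * The two sides of the separating surface *)

Section Tree.
Variable R : realType.
Local Notation C := R[i].
Local Notation Re := complex.Re.
Local Notation Im := complex.Im.
Variables (O : subringClosed C) (Delta : int) (s e : R).
Hypothesis H : order_lattice O Delta s e.
Local Notation tau := (tau R Delta).
Local Notation N := (Ngroup R Delta).
Local Notation A := (PE2 O).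
Local Notation G := (PSL2_over O).

Definition low (P : C * R) : Prop := [/\ outer O P, P.2 < 2 / 3 & in_strip s 0 P].

(* The part of the half-space cut off by the N-orbit of the piece of the plane
   t = 2/3 above the strip 0 < Im z < s and outside the unit balls. *)
Definition below (P : C * R) : Prop :=
  half_space P /\ exists2 n, n \in N & low (act n P).

(* PE2(O) stabilizes this region, the translates of [below] are its complement. *)
Definition above (P : C * R) : Prop :=
  half_space P /\ exists2 a, a \in A & outer O (act a P) /\ 2 / 3 <= (act a P).2.

Lemma below_half P : below P -> half_space P. Proof. by case. Qed.
Lemma above_half P : above P -> half_space P. Proof. by case. Qed.

Lemma below_N n P : n \in N -> below P -> below (act n P).
Proof.
move=> nN [hP [m mN lm]]; split; first exact: half_space_act.
exists (m * n^-1)%g; first by apply: groupM => //; exact: groupV.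
by rewrite act_mul ?actK //; exact: half_space_act.
Qed.

Lemma above_PE2 a P : a \in A -> above P -> above (act a P).
Proof.
move=> aA [hP [m mA hm]]; split; first exact: half_space_act.
exists (m * a^-1)%g; first by apply: groupM => //; exact: groupV.
by rewrite act_mul ?actK //; exact: half_space_act.
Qed.

Lemma above_PE2V a P : a \in A -> half_space P -> above (act a P) -> above P.
Proof. by move=> aA hP /(above_PE2 (groupV aA)); rewrite actK. Qed.

Lemma below_NV a P : a \in N -> half_space P -> below (act a P) -> below P.
Proof. by move=> aA hP /(below_N (groupV aA)); rewrite actK. Qed.

Lemma not_above_ht P a : half_space P -> ~ above P -> a \in A -> outer O (act a P) -> (act a P).2 < 2 / 3.
Proof.
move=> hP nP aA oa; rewrite ltNge; apply/negP => h; apply: nP; split=> //.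
by exists a.
Qed.

Lemma PE2_ht_eq P a : outer O P -> a \in A -> outer O (act a P) -> (act a P).2 = P.2.
Proof.
move=> oP aA oa; apply/eqP; rewrite eq_le (PE2_ht H oP aA) /=.
by have := PE2_ht H oa (groupV aA); rewrite actK //; exact: outer_half oP.
Qed.

Lemma below_not_above P : below P -> ~ above P.
Proof.
move=> [hP [n nN [on tn _]]] [_ [a aA [oa ta]]].
have nA := N_PE2 H nN.
have : (act (a * n^-1)%g (act n P)).2 = (act n P).2.
  apply: PE2_ht_eq => //; first by apply: groupM => //; exact: groupV.
  by rewrite act_mul ?actK //; exact: half_space_act.
by rewrite act_mul ?actK //; [lra|exact: half_space_act].
Qed.

(** Normalising both points by N turns a into a height-preserving element of PE2(O) between two low
    points; strip index 0 at both ends puts it in N. *)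
Lemma below_stab P a : below P -> a \in A -> below (act a P) -> a \in N.
Proof.
move=> [hP [n nN [on tn sn]]] aA [_ [m mN [om tm sm]]].
have nA := N_PE2 H nN; have mA := N_PE2 H mN.
have hn : half_space (act n P) by exact: half_space_act.
set b := (m * a * n^-1)%g.
have bA : b \in A by apply: groupM; [exact: groupM | exact: groupV].
have eb : act b (act n P) = act m (act a P).
  by rewrite /b -mulgA act_mul // act_mul // actK //; exact: half_space_act.
have ht : (act b (act n P)).2 = (act n P).2.
  by apply: PE2_ht_eq => //; rewrite eb.
have [k [sk kN]] : exists k, in_strip s k (act b (act n P)) /\ (shift (- (k%:~R * tau)) * b)%g \in N.
  apply: (PE2_strip H) => //; rewrite ht.
  by have : 0 < (act n P).2 := hn; lra.
have k0 : k = 0 by apply: (in_strip_uniq H sk); rewrite eb.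
move: kN; rewrite k0 mulr0z mul0r oppr0 shift0 mul1g => bN.
have -> : a = (m^-1 * b * n)%g by rewrite /b !mulgA mulVg mul1g -mulgA mulVg mulg1.
by apply: groupM => //; apply: groupM => //; exact: groupV.
Qed.

Lemma not_above_below P : half_space P -> ~ above P -> exists2 a, a \in A & below (act a P).
Proof.
move=> hP nP; have [a aA oa] := PE2_reduce H hP.
have ta := not_above_ht hP nP aA oa.
have [k [k1 k2]] := outer_low_strip H oa ta.
have kO : - (k%:~R * tau) \in O by rewrite rpredN (ktau_mem H).
exists (shift (- (k%:~R * tau)) * a)%g; first by apply: groupM => //; exact: shift_PE2.
split; first exact: half_space_act.
exists 1%g; first exact: group1.
rewrite act1 act_mul //; split; first exact: outer_shift.
  by rewrite act_shift.
have -> : - (k%:~R * tau) = 0%:~R + (- k)%:~R * tau :> C by rewrite rmorphN; ring.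
have <- : k + (- k) = 0 by rewrite subrr.
by apply: (in_strip_shift H); split; lra.
Qed.

(** Some b in PE2(O) brings Q' to an outer point. Comparing heights on both sides of b, the height
    of b Q is at least 9/16 of that of Q, so [PE2_strip] reads off the coset of b from the strip of
    b Q. The margin 1/2 puts b Q and b Q' in the same strip. *)
Lemma below_near P P' : below P -> half_space P' -> ~ above P' -> hdist P P' <= 1 / 16 -> below P'.
Proof.
move=> [hP [n nN [on tn sn]]] hP' nP' d.
set Q := act n P in on tn sn; set Q' := act n P'.
have hQ : half_space Q by exact: half_space_act.
have hQ' : half_space Q' by exact: half_space_act.
have dQ : hdist Q Q' <= 1 / 16 by rewrite hdist_act.
have nQ' : ~ above Q' by move=> /(above_PE2V (N_PE2 H nN) hP').
apply: (below_NV nN hP'); rewrite -/Q'.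
have [b bA ob] := PE2_reduce H hQ'.
have tb := not_above_ht hQ' nQ' bA ob.
have hbQ : half_space (act b Q) by exact: half_space_act.
have hbQ' : half_space (act b Q') by exact: half_space_act.
have db : hdist (act b Q) (act b Q') <= 1 / 16 by rewrite hdist_act.
have [r1 _] := hdist_ht hQ hQ' dQ.
have [r3 r4] := hdist_ht hbQ hbQ' db.
have q0 : 0 < Q.2 := hQ.
have r2 : Q'.2 <= (act b Q').2.
  by have := PE2_ht H ob (groupV bA); rewrite actK.
have tbQ : (act b Q).2 <= Q.2 := PE2_ht H on bA.
have [k [[k1 k2] kN]] : exists k, in_strip s k (act b Q) /\ (shift (- (k%:~R * tau)) * b)%g \in N.
  by apply: (PE2_strip H) => //; lra.
have [j [j1 j2]] := outer_low_strip H ob tb.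
have im : (Im (act b Q).1 - Im (act b Q').1) ^+ 2 <= 1 / 36.
  have := hdist_sq hbQ hbQ' db; rewrite /sqnorm !cE.
  have := sqr_ge0 (Re (act b Q).1 - Re (act b Q').1).
  have b0 : 0 < (act b Q).2 := hbQ.
  have b0' : 0 < (act b Q').2 := hbQ'.
  have : (act b Q).2 * (act b Q').2 <= 2 / 3 * (2 / 3) by apply: ler_pM; lra.
  lra.
have jQ : in_strip s j (act b Q).
  by move: im; split; nra.
have jk : j = k := in_strip_uniq H jQ (conj k1 k2).
split=> //; exists (shift (- (k%:~R * tau)) * b)%g => //.
have kO : - (k%:~R * tau) \in O by rewrite rpredN (ktau_mem H).
rewrite act_mul //; split; first exact: outer_shift.
  by rewrite act_shift.
have -> : - (k%:~R * tau) = 0%:~R + (- k)%:~R * tau :> C by rewrite rmorphN; ring.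
have <- : k + (- k) = 0 by rewrite subrr.
by apply: (in_strip_shift H); rewrite -jk; split; lra.
Qed.

Lemma below_near_iff P P' : half_space P -> half_space P' -> ~ above P -> ~ above P' ->
  hdist P P' <= 1 / 16 -> below P <-> below P'.
Proof.
move=> hP hP' nP nP' d; split=> b; apply: below_near b _ _ _ => //.
rewrite /hdist [P'.2 * _]mulrC; congr (_ / _ <= _): d.
by rewrite /sqnorm !cE; ring.
Qed.

Lemma below_vertical g z t t' : 0 < t -> t <= t' ->
  (forall u, t <= u -> ~ above (act g (z, u))) ->
  below (act g (z, t)) <-> below (act g (z, t')).
Proof.
move=> t0 tt' na.
have step u v : t <= u -> u <= v -> v <= 5 / 4 * u ->
    below (act g (z, u)) <-> below (act g (z, v)).
  move=> tu uv vu; have hu : half_space (z, u) by rewrite /half_space /=; lra.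
  have hv : half_space (z, v) by rewrite /half_space /=; lra.
  apply: below_near_iff; try exact: half_space_act; try (by apply: na; lra).
  rewrite hdist_act // /hdist /= subrr.
  have -> : sqnorm (0 : C) = 0 by rewrite /sqnorm !cE; ring.
  rewrite ler_pdivrMr; last by rewrite mulr_gt0; lra.
  nra.
(* The chain descends from u by factors 4/5. A bound linear in n is enough, because 4/5 (1 + (n +
   1)/4) = 1 + n/5 <= 1 + n/4. *)
have main n u : t <= u -> u <= (1 + n%:R * (1 / 4)) * t -> below (act g (z, t)) <-> below (act g (z, u)).
  elim: n u => [|n IH] u tu hu.
    have -> // : u = t by apply/eqP; rewrite eq_le tu andbT; lra.
  have n0 : (0 : R) <= n%:R by exact: ler0n.
  set v := Num.max t (4 / 5 * u).
  have tv : t <= v by rewrite /v le_max lexx.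
  have vu : v <= u by rewrite /v ge_max tu /=; lra.
  have uv : 4 / 5 * u <= v by rewrite /v le_max lexx orbT.
  apply: iff_trans (IH v tv _) (step v u tv vu _); last by lra.
  rewrite /v ge_max; apply/andP; split; first by nra.
  by rewrite -natr1 in hu; nra.
have [k [_ hk]] := floor_bounds (4 * (t' / t)).
apply: (main (absz k).+1) => //.
have : t' / t <= 1 + (absz k).+1%:R * (1 / 4).
  have : k%:~R <= (absz k)%:R :> R by rewrite -[(absz k)%:R]/((Posz (absz k))%:~R) ler_int; lia.
  by rewrite -natr1; lra.
by rewrite ler_pdivrMr.
Qed.

Lemma shift_psl_unit a b d : a \in O -> b \in O -> d \in O -> a * d = 1 -> psl a b 0 d \in A.
Proof.
by move=> aO bO dO h; have [b' b'O ->] := psl_upper H aO bO dO h; exact: shift_PE2.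
Qed.

Lemma psl_unit_c a b c d : a * d - b * c = 1 -> a \in O -> d \in O -> c = 1 \/ c = -1 ->
  psl a b c d \in A.
Proof.
move=> h aO dO hc.
have c0 : c != 0 by case: hc => ->; rewrite ?oppr_eq0 oner_eq0.
have cO : c \in O by case: hc => ->; rewrite ?rpredN rpred1.
have ci : c^-1 = c by case: hc => ->; rewrite ?invrN invr1.
rewrite psl_bruhat // ci; apply: groupM; last by apply: shift_PE2; rewrite rpredM.
apply: groupM (rot_PE2 O); apply: shift_psl_unit => //.
by rewrite -[in X in X * _]ci mulVf.
Qed.

(* An isometric sphere of radius |c|^-1 < 1 has radius at most 1/2, by the gap in
   the norms of O, so above t = 1/2 only the unit spheres count. *)
Lemma outer_max P g : outer O P -> 1 / 2 <= P.2 -> g \in G -> (act g P).2 <= P.2.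
Proof.
move=> oP t2 /PSL2_overP[a [b [c [d [h [aO bO cO dO] ->]]]]].
have hP := outer_half oP; have D0 := den_gt0 hP h.
have t0 : 0 < P.2 := hP.
rewrite ht_psl // ler_pdivrMr // ler_peMr ?(ltW t0) //.
have nn := sqnorm_ge0 (c * P.1 + d).
case: (lattice_gap H cO) => [ec|ec|ec|ec].
- have d0 : d != 0.
    by apply: contra_eq_neq h => ->; rewrite ec !mulr0 subrr eq_sym oner_neq0.
  by have := sqnorm_ge1 H dO d0; rewrite /den ec mul0r add0r; have := sqnorm_ge0 (0 : C); nra.
- have := oP.2 _ dO; rewrite /nq /den ec mul1r /=.
  by have -> : sqnorm (1 : C) = 1; [rewrite /sqnorm !cE; ring | rewrite mul1r].
- have dO' : - d \in O by rewrite rpredN.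
  have := oP.2 _ dO'; rewrite /nq /den ec mulN1r /=.
  have -> : - P.1 + d = - (P.1 + - d) by ring.
  rewrite sqnormN; have -> : sqnorm (-1 : C) = 1; [rewrite /sqnorm !cE; ring | by rewrite mul1r].
- rewrite /den; have : 1 / 4 <= P.2 ^+ 2 by nra.
  nra.
Qed.

(** After normalisation g preserves the height of a point with t >= 2/3, so den = 1. With |c|^2 >=
    4, den would be at least 16/9, and matrices over O with c = 0, 1 or -1 are elementary. *)
Lemma above_disjoint g P : g \in G -> above P -> above (act g P) -> g \in A.
Proof.
move=> gG [hP [a aA [oa ta]]] [_ [b bA [ob tb]]].
set Q := act a P in oa ta.
have hQ : half_space Q := outer_half oa.
have eQ : act (b * g * a^-1)%g Q = act b (act g P).
  by rewrite -mulgA act_mul // act_mul // actK //; exact: half_space_act.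
have hG : (b * g * a^-1)%g \in G.
  by apply: groupM; [apply: groupM => //|apply: groupV]; exact: PE2_over H _ _.
suff hA : (b * g * a^-1)%g \in A.
  have -> : g = (b^-1 * (b * g * a^-1) * a)%g by rewrite !mulgA mulVg mul1g -mulgA mulVg mulg1.
  by apply: groupM => //; apply: groupM => //; exact: groupV.
have ht : (act (b * g * a^-1)%g Q).2 = Q.2.
  apply/eqP; rewrite eq_le outer_max //=; last by lra.
  have : (act (b * g * a^-1)^-1%g (act (b * g * a^-1)%g Q)).2 <= (act (b * g * a^-1)%g Q).2.
    by rewrite eQ; apply: outer_max => //; [lra | exact: groupV].
  by rewrite actK.
move: hG ht => /PSL2_overP[a' [b' [c [d [h [aO bO cO dO] ->]]]]].
have q0 : 0 < Q.2 := hQ.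
rewrite ht_psl // => ht.
have D1 : den c d Q = 1.
  have D0 := den_gt0 hQ h; apply: (mulfI (lt0r_neq0 q0)).
  by rewrite mulr1 -{1}ht divfK // gt_eqF.
have nn := sqnorm_ge0 (c * Q.1 + d).
case: (lattice_gap H cO) => [ec|ec|ec|ec].
- by rewrite ec; apply: shift_psl_unit => //; move: h; rewrite ec mulr0 subr0.
- by apply: psl_unit_c => //; left.
- by apply: psl_unit_c => //; right.
- by exfalso; move: D1; rewrite /den; nra.
Qed.

Lemma above_outer z t : outer O (z, t) -> 2 / 3 <= t -> above (z, t).
Proof.
move=> oP tP; split; first exact: outer_half oP.
by exists 1%g; [exact: group1 | rewrite act1].
Qed.

Lemma outer01 : outer O (0, 1).
Proof.
split; first by rewrite /half_space /=; lra.
by move=> a aO; rewrite /nq /=; have := sqnorm_ge0 (0 + a); lra.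
Qed.

Lemma rot01 : act (rot C) (0, 1) = (0, 1) :> C * R.
Proof.
have h01 : half_space ((0 : C), (1 : R)) by exact: outer_half outer01.
have n1 : nq ((0 : C), (1 : R)) = 1 by rewrite /nq /sqnorm /=; ring.
rewrite act_rotE // n1 !divr1; congr pair.
by apply: complex_eqP; rewrite /= ?oppr0.
Qed.

Definition sees (h : PSL2 C) : Prop :=
  forall z t, outer O (z, t) -> 2 / 3 <= t -> below (act h (z, t)).

(** The image of the whole region avoids [above], so it cannot change sides: climb to height T, move
    along the horosphere, descend. T is so large that the horizontal move is a single step. *)
Lemma sees_one h z t : h \in G -> h \notin A -> outer O (z, t) -> 2 / 3 <= t ->
  below (act h (z, t)) -> sees h.
Proof.
move=> hG hA o t1 b z' t' o' t1'.
have na w u : outer O (w, u) -> 2 / 3 <= u -> ~ above (act h (w, u)).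
  by move=> ow hu /(above_disjoint hG (above_outer ow hu)); apply/negP.
pose T := t + t' + 16 * (1 + sqnorm (z - z')).
have n0 := sqnorm_ge0 (z - z').
have T1 : t <= T by rewrite /T; lra.
have T2 : t' <= T by rewrite /T; lra.
have bT : below (act h (z, T)).
  apply/(below_vertical (t := t)) => //; first by lra.
  by move=> u tu; apply: na; [exact: outer_up o tu | lra].
apply/(below_vertical (t' := T)) => //; first by lra.
  by move=> u tu; apply: na; [exact: outer_up o' tu | lra].
have oT := outer_up o T1; have oT' := outer_up o' T2.
apply: below_near bT _ _ _.
- by apply: half_space_act; exact: outer_half oT'.
- by apply: na => //; lra.
- rewrite hdist_act; [|exact: outer_half oT|exact: outer_half oT'].
  rewrite /hdist /= subrr expr0n addr0 ler_pdivrMr; last by rewrite mulr_gt0; lra.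
  have : 16 * (1 + sqnorm (z - z')) <= T by rewrite /T; lra.
  nra.
Qed.

Lemma PE2_mulr_notin h k : h \in G -> h \notin A -> k \in A -> (h * k)%g \in G /\ (h * k)%g \notin A.
Proof.
move=> hG hA kA; split; first by apply: groupM => //; exact: PE2_over H _ kA.
apply: contra hA => hk; have -> : h = (h * k * k^-1)%g by rewrite -mulgA mulgV mulg1.
by apply: groupM => //; exact: groupV.
Qed.

(** It is enough to pass through generators: s(b) preserves outer points, while r fixes (0, 1), so h
    and h r agree there and [sees_one] spreads this. The induction quantifies over h because letters
    move from k into h. *)
Lemma sees_above h P : h \in G -> h \notin A -> sees h -> above P -> below (act h P).
Proof.
move=> hG hA hs [hP [a aA [oa ta]]].
suff : forall k, k \in A -> forall h, h \in G -> h \notin A -> sees h -> sees (h * k)%g.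
  move=> /(_ _ (groupV aA) _ hG hA hs); move: oa ta.
  case eq : (act a P) => [z t] oa /= ta /(_ z t oa ta).
  rewrite -eq act_mul; last exact: half_space_act.
  by rewrite actK.
move: hG hA hs => _ _ _.
apply: (PE2_ind (H) (X := fun k => forall h, h \in G -> h \notin A -> sees h -> sees (h * k)%g)).
- by move=> h' _ _; rewrite mulg1.
- move=> k IH h' hG hA hs; rewrite mulgA.
  have [hG' hA'] := PE2_mulr_notin hG hA (rot_PE2 O).
  apply: IH => //; apply: (sees_one (z := 0) (t := 1)) => //; [exact: outer01| lra |].
  rewrite act_mul ?rot01; last exact: outer_half outer01.
  by apply: hs; [exact: outer01 | lra].
- move=> b k bO IH h' hG hA hs; rewrite mulgA.
  have [hG' hA'] := PE2_mulr_notin hG hA (shift_PE2 bO).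
  apply: IH => // z t o ht.
  rewrite act_mul; last exact: outer_half o.
  have := outer_shift o bO; rewrite act_shift => o'.
  by apply: hs.
Qed.

(* The vertical ray above a point of [outer] ends in [above]; as long as its translate
   avoids [above], it does not change sides. *)
Lemma sees_ray h z t : h \in G -> h \notin A -> outer O (z, t) -> t < 2 / 3 ->
  (forall u, t <= u -> u < 2 / 3 -> ~ above (act h (z, u))) ->
  below (act h (z, t)) <-> sees h.
Proof.
move=> hG hA o t1 na.
have t0 : 0 < t := outer_half o.
have ou u := @outer_up _ O z t u o.
have o1 : outer O (z, 1) by apply: ou; lra.
have na' u : t <= u -> ~ above (act h (z, u)).
  move=> tu; have [u23|u23] := ltP u (2 / 3); first exact: na.
  by move=> /(above_disjoint hG (above_outer (ou u tu) u23)); apply/negP.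
have seesn : below (act h (z, 1)) <-> sees h.
  split=> [b|]; first by apply: (sees_one hG hA o1) b; lra.
  by apply=> //; lra.
by rewrite -seesn; apply: below_vertical => //; lra.
Qed.

Lemma sees_PE2 h k : h \in G -> h \notin A -> sees h -> k \in A -> sees (h * k)%g.
Proof.
move=> hG hA hs kA w u ow hu; rewrite act_mul; last exact: outer_half ow.
by apply: sees_above => //; apply: above_PE2 => //; exact: above_outer.
Qed.

(** The vertical ray over a low point stays low up to height 2/3, so the hypothesis on [below]
    provides what [sees_ray] asks for. *)
Lemma below_translate h P : h \in G -> h \notin A -> sees h ->
  (forall Q, below Q -> ~ above (act h Q)) -> below P -> below (act h P).
Proof.
move=> hG hA hs hQ [hP [n nN [on tn sn]]].
have nA := N_PE2 H nN; have nVA := groupV nA.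
have [hnG hnA] := PE2_mulr_notin hG hA nVA.
move: (half_space_act n hP) on tn sn; case eP : (act n P) => [z t] hn on tn sn /=.
have eP' : act h P = act (h * n^-1)%g (z, t).
  by rewrite -eP act_mul ?actK //; exact: half_space_act.
rewrite eP'; apply/(sees_ray hnG hnA on tn); last exact: sees_PE2.
move=> u tu u23; have ou := outer_up on tu.
rewrite act_mul; last exact: outer_half ou.
apply: hQ; apply: below_N; first exact: groupV.
split; first exact: outer_half ou.
by exists 1%g; [exact: group1 | rewrite act1].
Qed.

End Tree.

(** * Ping-pong for Gamma and PE2(O) *)

Section GammaSide.
Variable R : realType.
Local Notation C := R[i].
Variables (O : subringClosed C) (Delta : int) (s e : R).
Hypothesis H : order_lattice O Delta s e.
Local Notation N := (Ngroup R Delta).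
Local Notation A := (PE2 O).
Local Notation G := (PSL2_over O).
Local Notation F := (ford_domain O Delta).

Lemma ford_outer P : F P -> outer O P.
Proof.
move=> [hP _ hmax]; apply: max_outer => // g gA.
exact: (hmax _ (PE2_over H gA)).
Qed.

Lemma ford_ht_eq P b : F P -> b \in G -> F (act b P) -> (act b P).2 = P.2.
Proof.
move=> [hP _ hmax] bG [_ _ hmax']; apply/eqP; rewrite eq_le hmax //=.
by have := hmax' _ (groupV bG); rewrite actK.
Qed.

Lemma ford_low_below P : F P -> P.2 < 2 / 3 -> below O Delta s P.
Proof.
move=> FP t23; have oP := ford_outer FP.
have [k [k1 k2]] := outer_low_strip H oP t23.
have [hP [_ I01] _] := FP; move: I01; rewrite (lat_s H) => /andP[I0 I1].
have s0 := s_gt0 H.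
have k0 : k = 0.
  have e1 : (k%:~R : R) < 1%:~R.
    by rewrite -(ltr_pM2r s0) mul1r; lra.
  have e2 : ((-1)%:~R : R) < k%:~R.
    by rewrite -(ltr_pM2r s0) rmorphN /=; lra.
  by move: e1 e2; rewrite !ltr_int; clear; lia.
split=> //; exists 1%g; first exact: group1.
by rewrite act1; split=> //; move: k1 k2; rewrite k0 /in_strip => k1 k2; split; lra.
Qed.

(* [faces h]: the translate by h of the low part of the Ford domain is in [below]. *)
Definition faces (h : PSL2 C) : Prop := h \in N \/ (h \notin A /\ sees O Delta s h).

(** The point is that the criterion does not involve [P]. Over a point of the Ford domain every den
    is at least 1 and does not decrease with t, so no element lifts the ray below 2/3 to that
    height, and [sees_ray] applies. *)
Lemma ford_low_faces P h : F P -> P.2 < 2 / 3 -> h \in G ->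
  below O Delta s (act h P) <-> faces h.
Proof.
move=> FP t23 hG; have bP := ford_low_below FP t23.
have [hP _ hmax] := FP.
have [hA|hA] := boolP (h \in A).
  split=> [b|[hN|[]]]; last by rewrite hA.
    by left; apply: (below_stab H bP).
  exact: below_N.
have oP := ford_outer FP.
case: P FP t23 bP hP hmax oP => z t FP t23 bP hP hmax oP.
rewrite (sees_ray H hG hA oP t23); first by split=> [?|[/(N_PE2 H)|[]//]]; [right | rewrite (negbTE hA)].
move=> u tu u23 [_ [a aA [_]]].
have hu : half_space (z, u) by exact: lt_le_trans hP tu.
have aG := groupM (PE2_over H aA) hG.
rewrite -act_mul //; have {aG} := PSL2_overP aG.
case=> a' [b' [c [d [h' [aO bO cO dO] ->]]]].
rewrite ht_psl //= => le.
have D1 : 1 <= den c d (z, t).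
  have := hmax _ (psl_over h' aO bO cO dO); rewrite ht_psl //=.
  have D0 := den_gt0 hP h'; have t0 : 0 < t := hP.
  by rewrite ler_pdivrMr // ler_pMr.
have D2 : den c d (z, t) <= den c d (z, u).
  rewrite /den /= lerD2l ler_wpM2l ?sqnorm_ge0 //.
  by rewrite lerXn2r // nnegrE ltW //; exact: lt_le_trans hP tu.
have D3 : 0 < den c d (z, u) by lra.
by move: le; rewrite ler_pdivlMr //; nra.
Qed.

(** A low face of b contains some P = b P' with both points in the Ford domain and of equal height,
    hence both low. Testing h P = (h b) P' against [below] compares h with h b. *)
Lemma Gamma_faces b : b \in Gamma O Delta ->
  b \in G /\ forall h, h \in G -> faces h <-> faces (h * b)%g.
Proof.
have gen b' : face_pairing O Delta b' -> partially_below (2 / 3) (face O Delta b') ->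
    b' \in G /\ forall h, h \in G -> faces h <-> faces (h * b')%g.
  move=> [bG _ _] [P [FP [P' FP' eP]] tP]; split=> // h hG.
  have tP' : P'.2 < 2 / 3.
    have FbP' : F (act b' P') by rewrite eP.
    by have := ford_ht_eq FP' bG FbP'; rewrite eP => <-.
  have hP' : half_space P' by case: FP'.
  rewrite -(ford_low_faces FP tP hG) -(ford_low_faces FP' tP'); last exact: groupM.
  by rewrite act_mul // eP.
apply: (gen_ind (X := fun b => b \in G /\ forall h, h \in G -> faces h <-> faces (h * b)%g)).
- by split=> [|h hG]; [exact: group1 | rewrite mulg1].
- move=> k g [fk pk] [gG gf]; have [kG kf] := gen _ fk pk.
  split=> [|h hG]; first exact: groupM.
  by rewrite mulgA (kf h hG); apply: gf; exact: groupM.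
- move=> k g [fk pk] [gG gf]; have [kG kf] := gen _ fk pk; have kVG := groupV kG.
  split=> [|h hG]; first exact: groupM.
  have hkG := groupM hG kVG.
  have := kf _ hkG; rewrite -mulgA mulVg mulg1 => e1.
  by rewrite mulgA -e1; apply: gf.
Qed.

Lemma Gamma_over : {subset Gamma O Delta <= G}.
Proof. by move=> b /Gamma_faces[]. Qed.

Lemma Gamma_sees b : b \in Gamma O Delta -> b \notin N -> b \notin A /\ sees O Delta s b.
Proof.
move=> /Gamma_faces[_ /(_ 1%g (group1 _))]; rewrite mul1g => f bN.
have [|//] : faces b by apply/f; left; exact: group1.
by rewrite (negbTE bN).
Qed.

(** Outside [above], P lies in a translate a^-1 L with a not in N. If b a^-1 sent a point of L into
    [above], then b^-1, which maps [above] into L, would make a^-1 L meet L. *)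
Lemma Gamma_pingpong b P : b \in Gamma O Delta -> b \notin N -> half_space P ->
  ~ below O Delta s P -> below O Delta s (act b P).
Proof.
move=> bB bN hP nP; have bG := Gamma_over bB; have [bA bs] := Gamma_sees bB bN.
have [abP|nab] := pselect (above O P); first exact: (sees_above H).
have [a aA ba] := not_above_below H hP nab.
have aVA := groupV aA.
have aN : a^-1%g \notin N.
  apply/negP => /groupV; rewrite invgK => aN; apply: nP.
  exact: below_NV aN hP ba.
have [hG hA] := PE2_mulr_notin H bG bA aVA.
have -> : act b P = act (b * a^-1)%g (act a P).
  by rewrite act_mul ?actK //; exact: half_space_act.
apply: (below_translate H) => //; first exact: (sees_PE2 H).
move=> Q bQ; have hQ := below_half bQ; rewrite act_mul // => abQ.
have [bA' bs'] : b^-1%g \notin A /\ sees O Delta s b^-1%g.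
  by apply: Gamma_sees; [exact: groupV | apply: contra bN => /groupV; rewrite invgK].
have := sees_above H (groupV bG) bA' bs' abQ.
rewrite actK => [bQ'|]; last exact: half_space_act.
by move: aN; rewrite (below_stab H bQ aVA bQ').
Qed.

Lemma PE2_pingpong a P : a \in A -> a \notin N -> below O Delta s P ->
  ~ below O Delta s (act a P) /\ ~ above O (act a P).
Proof.
move=> aA aN bP; split=> [b|ab].
  by move: aN; rewrite (below_stab H bP aA b).
by apply: (below_not_above H bP); exact: above_PE2V aA (below_half bP) ab.
Qed.

End GammaSide.

(** * Normal forms in an amalgam *)

Section AmalgamNormalForm.
Variables (G : groupType) (A B N : groupClosed G).
Hypothesis NA : {subset N <= A}.
Hypothesis NB : {subset N <= B}.
Local Notation letter := (subgroup_type A + subgroup_type B)%type.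
Local Notation aword := (amalgam_word A B).
Local Notation cong := (@amalgam_cong G A B N).

Definition letter_val (x : letter) : G :=
  match x with inl a => val a | inr b => val b end.
Definition is_inl (x : letter) : bool := if x is inl _ then true else false.

Definition word_val (w : aword) : G := foldr (fun x g => (letter_val x * g)%g) 1%g w.

Lemma word_val_cat v w : word_val (v ++ w) = (word_val v * word_val w)%g.
Proof. by elim: v => [|x v IH] /=; rewrite ?mul1g // IH mulgA. Qed.

Lemma cong_word_val v w : cong v w -> word_val v = word_val w.
Proof.
elim=> {v w} //=.
- by move=> u v w _ -> _ ->.
- by move=> v1 v2 w1 w2 _ e1 _ e2; rewrite !word_val_cat e1 e2.
- by rewrite mulg1.
- by rewrite mulg1.
- by move=> a a'; rewrite !mulg1.
- by move=> b b'; rewrite !mulg1.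
- by move=> a b ->.
Qed.

Lemma letter_merge x y : is_inl x = is_inl y ->
  exists z, [/\ is_inl z = is_inl x, letter_val z = (letter_val x * letter_val y)%g
    & cong [:: x; y] [:: z]].
Proof.
case: x => x; case: y => y // _.
- by exists (inl (x * y)%g); split=> //; exact: AmalgMulL.
- by exists (inr (x * y)%g); split=> //; exact: AmalgMulR.
Qed.

Lemma letter_side (c : bool) x : letter_val x \in N ->
  exists y, [/\ is_inl y = c, letter_val y = letter_val x & cong [:: x] [:: y]].
Proof.
case: c; case: x => x /= xN.
- by exists (inl x); split=> //; exact: AmalgRefl.
- exists (inl (SubgroupElt (NA xN))); split=> //.
  by apply: AmalgSym; apply: AmalgGlue.
- exists (inr (SubgroupElt (NB xN))); split=> //.
  by apply: AmalgGlue.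
- by exists (inr x); split=> //; exact: AmalgRefl.
Qed.

Fixpoint alternating (w : aword) : Prop :=
  if w is x :: w' then
    [/\ letter_val x \notin N, (if w' is y :: _ then is_inl x != is_inl y else true) & alternating w']
  else True.

(** Elements of N get a one-letter form, placed in [A] by convention; it also stands for the empty
    word, so every word has a normal form. *)
Definition normal (w : aword) : Prop :=
  (exists n, letter_val (inl n) \in N /\ w = [:: inl n]) \/ (w <> [::] /\ alternating w).

Lemma cong_cons x v w : cong v w -> cong (x :: v) (x :: w).
Proof. by move=> vw; exact: (AmalgCat (AmalgRefl _ [:: x]) vw). Qed.

Lemma cong_head w v x : cong v [:: x] -> cong (v ++ w) (x :: w).
Proof. by move=> vx; exact: (AmalgCat vx (AmalgRefl _ w)). Qed.

Lemma alternating_absorb x y w : letter_val x \in N -> alternating (y :: w) ->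
  exists z, [/\ is_inl z = is_inl y, cong [:: x, y & w] (z :: w) & alternating (z :: w)].
Proof.
move=> xN [yN sw aw].
have [x' [sx vx cx]] := letter_side (is_inl y) xN.
have [z [sz vz cz]] := letter_merge sx.
exists z; split; first by rewrite sz.
- apply: AmalgTrans (cong_head w cz).
  exact: (AmalgCat cx (AmalgRefl _ (y :: w))).
- split=> //; last by move: sw; rewrite sz sx.
  rewrite vz vx; apply: contra yN => zN.
  have -> : letter_val y = ((letter_val x)^-1 * (letter_val x * letter_val y))%g by rewrite mulKg.
  by rewrite gpredM // gpredV.
Qed.

Lemma normal_cons x w : normal w -> exists w', cong (x :: w) w' /\ normal w'.
Proof.
have [xN|xN] := boolP (letter_val x \in N).
  case=> [[n [nN ->]]|[w0 aw]].
    have [x' [sx vx cx]] := letter_side true xN.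
    have [z [sz vz cz]] := letter_merge (x := x') (y := inl n) sx.
    exists [:: z]; split.
      apply: AmalgTrans cz; exact: (AmalgCat cx (AmalgRefl _ [:: inl n])).
    rewrite sx in sz; left; case: z sz vz {cz} => // z _ vz.
    by exists z; split=> //; rewrite vz vx gpredM.
  case: w w0 aw => [//|y w] _ aw.
  have [z [_ cz az]] := alternating_absorb xN aw.
  by exists (z :: w); split=> //; right.
case=> [[n [nN ->]]|[w0 aw]].
  have [n' [sn vn cn]] := letter_side (is_inl x) nN.
  have [z [sz vz cz]] := letter_merge (esym sn).
  exists [:: z]; split; first by apply: AmalgTrans (cong_cons x cn) cz.
  right; split=> //=; split=> //; rewrite vz vn; apply: contra xN => zN.
  by rewrite -[letter_val x](mulgK (letter_val (inl n))) gpredM // gpredV.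
case: w w0 aw => [//|y w] _ aw.
have [sxy|sxy] := eqVneq (is_inl x) (is_inl y); last first.
  by exists [:: x, y & w]; split; [exact: AmalgRefl | right].
have [z [sz vz cz]] := letter_merge sxy.
case: aw => yN sw aw.
have czw : cong [:: x, y & w] (z :: w) := cong_head w cz.
have [zN|zN] := boolP (letter_val z \in N); last first.
  exists (z :: w); split=> //; right; split=> //; split=> //.
  by move: sw; rewrite sz sxy.
case: w sw aw czw => [|y' w] sw aw czw.
  have [z' [sz' vz' cz']] := letter_side true zN.
  case: z' sz' vz' cz' => // z' _ vz' cz'.
  exists [:: inl z']; split; first exact: AmalgTrans czw cz'.
  by left; exists z'; rewrite vz'.
have [z' [_ cz' az']] := alternating_absorb zN aw.
by exists (z' :: w); split; [exact: AmalgTrans czw cz' | right].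
Qed.

Lemma normal_exists w : exists w', cong w w' /\ normal w'.
Proof.
elim: w => [|x w [w' [cw nw]]].
  exists [:: inl 1%g]; split; first by apply: AmalgSym; exact: AmalgOneL.
  by left; exists 1%g; split=> //; exact: gpred1.
have [w'' [cw' nw']] := normal_cons x nw.
by exists w''; split=> //; apply: AmalgTrans (cong_cons x cw) cw'.
Qed.

Hypothesis alternating_neq1 : forall w, w <> [::] -> alternating w -> word_val w <> 1%g.

Lemma word_val_inj1 w : word_val w = 1%g -> cong w [::].
Proof.
have [w' [cw [[n [nN ew]]|[w0 aw]]]] := normal_exists w; rewrite (cong_word_val cw).
  rewrite ew /= mulg1 => n1; apply: AmalgTrans cw _; rewrite ew.
  have -> : n = 1%g by apply: val_inj.
  exact: AmalgOneL.
by move/(alternating_neq1 w0 aw).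
Qed.

Lemma word_val_inv w : word_val (amalgam_word_inv w) = (word_val w)^-1%g.
Proof.
have := cong_word_val (amalgam_cong_mulV N w); rewrite word_val_cat => h.
by apply: (mulgI (word_val w)); rewrite h mulgV.
Qed.

Lemma word_val_inj v w : word_val v = word_val w -> cong v w.
Proof.
move=> vw; have h : cong (v ++ amalgam_word_inv w) [::].
  by apply: word_val_inj1; rewrite word_val_cat word_val_inv vw mulgV.
have h' : cong ((v ++ amalgam_word_inv w) ++ w) w := AmalgCat h (AmalgRefl _ w).
apply: AmalgTrans h'; rewrite -catA -[X in cong X _]cats0.
apply: AmalgCat; first exact: AmalgRefl.
by apply: AmalgSym; apply: word_val_inj1; rewrite word_val_cat word_val_inv mulVg.
Qed.

Variable M : groupClosed G.
Hypothesis AM : {subset A <= M}.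
Hypothesis BM : {subset B <= M}.
Hypothesis gen_M : forall g, g \in M -> exists w, word_val w = g.

Lemma word_val_mem w : word_val w \in M.
Proof.
elim: w => [|x w IH] /=; first exact: gpred1.
by rewrite gpredM //; case: x => x /=; [apply/AM/valP | apply/BM/valP].
Qed.

Definition amalgam_val (x : amalgam A B N) : subgroup_type M := SubgroupElt (word_val_mem (repr x)).

Lemma amalgam_val_pi w : val (amalgam_val (\pi_(amalgam A B N) w)) = word_val w.
Proof. exact: cong_word_val (amalgam_reprP _ w). Qed.

Lemma amalgam_val_mul : {morph amalgam_val : x y / (x * y)%g >-> (x * y)%g}.
Proof.
move=> x y; apply: val_inj.
exact: etrans (amalgam_val_pi (repr x ++ repr y)) (word_val_cat _ _).
Qed.

HB.instance Definition _ := isMultiplicative.Build _ _ amalgam_val amalgam_val_mul.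

Lemma amalgam_iso : exists f : {multiplicative amalgam A B N -> subgroup_type M},
  [/\ bijective f,
    forall a : subgroup_type A, val (f (amalgam_inl B N a)) = val a
    & forall b : subgroup_type B, val (f (amalgam_inr A N b)) = val b].
Proof.
exists amalgam_val; split=> [|a|b]; last 2 first.
- by rewrite [LHS]amalgam_val_pi /= mulg1.
- by rewrite [LHS]amalgam_val_pi /= mulg1.
have inj : injective amalgam_val.
  move=> x y /(congr1 val) /= /word_val_inj h.
  rewrite -[x]reprK -[y]reprK; apply/amalgam_piP/asboolP; exact: h.
have surj (g : subgroup_type M) : exists x, amalgam_val x == g.
  have [w ew] := gen_M (valP g); exists (\pi_(amalgam A B N) w); apply/eqP/val_inj.
  by rewrite amalgam_val_pi.
pose inv g := xchoose (surj g).
have invK g : amalgam_val (inv g) = g by apply/eqP/(xchooseP (surj g)).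
by exists inv => // x; apply: inj; rewrite invK.
Qed.

End AmalgamNormalForm.

(** * Generation by PE2 and Gamma *)

Lemma infinite_pigeonhole (T : eqType) (l : seq T) (f : nat -> T) (n0 : nat) :
  (forall n, (n0 <= n)%N -> f n \in l) -> exists x, forall n, exists2 m, (n <= m)%N & f m = x.
Proof.
elim: l n0 => [|x l IH] n0 fl; first by have := fl n0 (leqnn _).
have [inf|fin] := pselect (forall n, exists2 m, (n <= m)%N & f m = x); first by exists x.
move/existsNP: fin => [n1 hn1]; apply: (IH (maxn n0 n1)) => n; rewrite geq_max => /andP[n0n n1n].
have := fl n n0n; rewrite inE => /orP[/eqP e|//].
by case: hn1; exists n.
Qed.

Section Generation.
Variable R : realType.
Local Notation C := R[i].
Local Notation Re := complex.Re.
Local Notation Im := complex.Im.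

(** A geodesic line projects to C into a point or a straight line; the imaginary part is, up to
    sign, twice the area of the triangle of the projections. *)
Lemma not_geodesic_line (S : set (C * R)) P1 P2 P3 : S P1 -> S P2 -> S P3 ->
  Im ((P2.1 - P1.1) * (P3.1 - P1.1)^*) != 0 ->
  ~ exists2 L, geodesic_line L & (forall P, S P -> L P).
Proof.
move=> S1 S2 S3 nc [L [[z ->]|[z [rho [u [_ u0 ->]]]]] SL].
  have [_ e1] := SL _ S1; have [_ e2] := SL _ S2; have [_ e3] := SL _ S3.
  by move: nc; rewrite e1 e2 e3 subrr mul0r eqxx.
have [_ [_ e1]] := SL _ S1; have [_ [_ e2]] := SL _ S2; have [_ [_ e3]] := SL _ S3.
have un := sqnorm_gt0 u0.
move/eqP: nc; apply; apply: (mulfI (lt0r_neq0 un)); rewrite mulr0.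
move: e1 e2 e3; rewrite /sqnorm !cE.
move: (P1.1) (P2.1) (P3.1) => [x1 y1] [x2 y2] [x3 y3] /=.
move: (Re u) (Im u) (Re z) (Im z) => p q zx zy e1 e2 e3.
have d2 : (y2 - y1) * p = (x2 - x1) * q by lra.
have d3 : (y3 - y1) * p = (x3 - x1) * q by lra.
transitivity (((y2 - y1) * p) * ((x3 - x1) * p + (y3 - y1) * q) - ((x2 - x1) * p + (y2 - y1) * q) * ((y3 - y1) * p) +
  ((y2 - y1) * q * ((x3 - x1) * q) - ((x2 - x1) * q) * ((y3 - y1) * q)) ); first ring.
by rewrite d2 d3; ring.
Qed.

Variables (O : subringClosed C) (Delta : int) (s e : R).
Hypothesis H : order_lattice O Delta s e.
Local Notation G := (PSL2_over O).
Local Notation F := (ford_domain O Delta).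

Lemma psl_neq1 (a b c d : C) : a * d - b * c = 1 -> c != 0 -> psl a b c d <> 1%g.
Proof.
move=> h c0 e1.
have D (t : R) : 0 < t -> den c d (0, t) = 1.
  move=> t0; have hP : half_space ((0 : C), t) by [].
  have := ht_psl (0, t) h; rewrite e1 act1 /= => ht.
  have D0 := den_gt0 hP h; apply: (mulfI (lt0r_neq0 t0)).
  by rewrite mulr1 {1}ht divfK // gt_eqF.
have := D 1 (ltr01); have := D 2 (ltr0Sn _ 1); rewrite /den /=.
have := sqnorm_gt0 c0; lra.
Qed.

Lemma face_sphere a b c d P : psl a b c d \in G -> a * d - b * c = 1 -> c != 0 ->
  F P -> F (act (psl a b c d) P) -> sqnorm (P.1 - - (d / c)) + P.2 ^+ 2 = (sqnorm c)^-1.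
Proof.
move=> hG h c0 FP FP'; have := ford_ht_eq FP hG FP'.
have hP : half_space P by case: FP.
have t0 : 0 < P.2 := hP.
rewrite ht_psl // => ht; have D0 := den_gt0 hP h.
have D1 : den c d P = 1.
  by apply: (mulfI (lt0r_neq0 t0)); rewrite mulr1 -{1}ht divfK // gt_eqF.
have n0 := sqnorm_gt0 c0; apply: (mulfI (lt0r_neq0 n0)); rewrite divff ?lt0r_neq0 //.
rewrite -D1 /den mulrDr -sqnormM opprK; congr (sqnorm _ + _).
by field.
Qed.

Lemma mem_face h P : F P -> F (act h P) -> face O Delta h^-1%g P.
Proof.
move=> FP FP'; split=> //; exists (act h P) => //.
by rewrite actK //; case: FP.
Qed.

(** If P and g P are both in the Ford domain, then P is in the face of g^-1. Equal heights put that
    face on the isometric sphere of g, and three non-collinear projections make it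
    two-dimensional. *)
Lemma low_floor_pairing a b c d P1 P2 P3 : psl a b c d \in G -> a * d - b * c = 1 -> c != 0 ->
  (F P1 /\ F (act (psl a b c d) P1)) -> (F P2 /\ F (act (psl a b c d) P2)) ->
  (F P3 /\ F (act (psl a b c d) P3)) ->
  Im ((P2.1 - P1.1) * (P3.1 - P1.1)^*) != 0 -> P1.2 < 2 / 3 ->
  psl a b c d \in Gamma O Delta.
Proof.
move=> hG h c0 [F1 F1'] [F2 F2'] [F3 F3'] nc t1.
rewrite -[psl a b c d]invgK; apply: groupV; apply: mem_gen; split; last first.
  by exists P1 => //; exact: mem_face.
split; first exact: groupV.
  apply/eqP => /(congr1 (fun g => g^-1%g)); rewrite invgK invg1.
  exact: psl_neq1.
split; last exact: not_geodesic_line (mem_face F1 F1') (mem_face F2 F2') (mem_face F3 F3') nc.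
exists (hemisphere (- (d / c)) (Num.sqrt (sqnorm c)^-1)).
  left; exists (- (d / c)), (Num.sqrt (sqnorm c)^-1); split=> //.
  by rewrite sqrtr_gt0 invr_gt0 sqnorm_gt0.
move=> P [FP [P' FP' eP]]; have hP : half_space P by case: FP.
have hP' : half_space P' by case: FP'.
have eP' : P' = act (psl a b c d) P by rewrite -eP actVK.
split=> //; rewrite sqr_sqrtr ?invr_ge0 ?sqnorm_ge0 //.
by apply: face_sphere hG h c0 FP _; rewrite -eP'.
Qed.

(* Squared height above w of the isometric sphere of the row (c, d). *)
Definition sphere_ht (x : C * C) (w : C) : R := (sqnorm x.1)^-1 - sqnorm (w + x.2 / x.1).

Lemma den_sphere (c d w : C) (t : R) : c != 0 ->
  den c d (w, t) = 1 + sqnorm c * (t ^+ 2 - sphere_ht (c, d) w).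
Proof.
move=> c0; have n0 := sqnorm_gt0 c0.
rewrite /den /sphere_ht /=; have -> : c * w + d = c * (w + d / c) by field.
by rewrite sqnormM; field; rewrite gt_eqF.
Qed.

(** The radius is at most 1, so a sphere covering w has its centre within 1 of w, and the squared
    distance to it grows by at most 2 eta + eta^2 <= 3 eta. *)
Lemma sphere_ht_near (x : C * C) (w z : C) (eta : R) : 0 < eta -> eta <= 1 ->
  sqnorm (w - z) <= eta ^+ 2 -> 1 <= sqnorm x.1 -> 0 <= sphere_ht x w ->
  sphere_ht x w - 3 * eta <= sphere_ht x z.
Proof.
move=> e0 e1 wz n1; rewrite /sphere_ht.
have : (sqnorm x.1)^-1 <= 1 by rewrite invf_le1 //; lra.
move: ((sqnorm x.1)^-1) (x.2 / x.1) => r v r1.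
have -> : z + v = (w + v) - (w - z) by ring.
move: (w - z) (w + v) wz => [p q] [u y]; rewrite /sqnorm /= => wz h.
have h1 : u ^+ 2 + y ^+ 2 <= 1 by lra.
have k1 := sqr_ge0 (eta * u + p); have k2 := sqr_ge0 (eta * y + q).
have k3 : eta * (u ^+ 2 + y ^+ 2) <= eta by nra.
have k4 : eta * (- 2 * (u * p + y * q)) <= eta * (2 * eta).
  have : eta ^+ 2 * (u ^+ 2 + y ^+ 2) <= eta ^+ 2 by nra.
  lra.
have k5 : - 2 * (u * p + y * q) <= 2 * eta by rewrite -(ler_pM2l e0).
have k6 : eta ^+ 2 <= eta by nra.
lra.
Qed.

Definition is_row (x : C * C) : Prop := [/\ x.1 \in O, x.2 \in O &
  exists a b, [/\ a * x.2 - b * x.1 = 1, a \in O & b \in O]].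

(** This is the floor of the Ford domain above [w]: finitely many spheres reach as high as that of
    [x0], and on the highest one no element raises the point. *)
Lemma top_sphere (w : C) (x0 : C * C) : is_row x0 -> x0.1 != 0 -> 0 < sphere_ht x0 w ->
  exists x, [/\ is_row x, x.1 != 0, sphere_ht x0 w <= sphere_ht x w &
    forall g, g \in G -> (act g (w, Num.sqrt (sphere_ht x w))).2 <= Num.sqrt (sphere_ht x w)].
Proof.
move=> r0 c0 h0; set T := Num.sqrt (sphere_ht x0 w).
have T0 : 0 < T by rewrite sqrtr_gt0.
have [l hl] := rows_finite H (1 + sqnorm w) T0.
have inl x : is_row x -> x.1 != 0 -> sphere_ht x0 w <= sphere_ht x w -> x \in l.
  case: x => c d [/= cO dO _] cn le.
  apply: (hl c d (w, T) cO dO (lexx _) _ 1); rewrite ?lerDl ?lerDr ?sqnorm_ge0 //=.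
  rewrite den_sphere // sqr_sqrtr ?(ltW h0) //.
  by have := sqnorm_gt0 cn; nra.
have [x [[rx cx] hmin]] : exists x, (is_row x /\ x.1 != 0) /\ forall y, y \in l ->
    (is_row y /\ y.1 != 0) -> - sphere_ht x w <= - sphere_ht y w.
  by apply: (seq_argmin (P := fun x => is_row x /\ x.1 != 0)); exists x0 => //; exact: inl.
have max y : is_row y -> y.1 != 0 -> sphere_ht y w <= sphere_ht x w.
  move=> ry cy; have l0 : sphere_ht x0 w <= sphere_ht x w.
    by rewrite -lerN2; apply: hmin => //; exact: inl.
  have [le|lt] := leP (sphere_ht x0 w) (sphere_ht y w).
    by rewrite -lerN2; apply: hmin => //; exact: inl.
  exact: le_trans (ltW lt) l0.
have hx : 0 < sphere_ht x w by apply: lt_le_trans h0 (max _ r0 c0).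
exists x; split=> //; first exact: max.
set U := Num.sqrt _; have U0 : 0 < U by rewrite sqrtr_gt0.
have hU : half_space (w, U) by [].
move=> g /PSL2_overP[a [b [c [d [h [aO bO cO dO] ->]]]]].
have D0 := den_gt0 hU h; rewrite ht_psl //= ler_pdivrMr // ler_pMr //.
have [c00|cn] := eqVneq c 0.
  have d0 : d != 0.
    by apply: contra_eq_neq h => ->; rewrite c00 !mulr0 subrr eq_sym oner_neq0.
  have := sqnorm_ge1 H dO d0; rewrite /den c00 mul0r add0r /=.
  by have := mulr_ge0 (sqnorm_ge0 (0 : C)) (sqr_ge0 U); lra.
rewrite den_sphere // sqr_sqrtr ?(ltW hx) // lerDl mulr_ge0 ?sqnorm_ge0 // subr_ge0.
by apply: max => //; split=> //; exists a, b.
Qed.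

End Generation.

(** * Raising points by low pairings, and generation *)

Section Raise.
Variable R : realType.
Local Notation C := R[i].
Local Notation Re := complex.Re.
Local Notation Im := complex.Im.
Variables (O : subringClosed C) (Delta : int) (s e : R).
Hypothesis H : order_lattice O Delta s e.
Local Notation N := (Ngroup R Delta).
Local Notation A := (PE2 O).
Local Notation G := (PSL2_over O).
Local Notation F := (ford_domain O Delta).

Lemma rectangleP (z : C) : rectangle Delta z <->
  - (1 / 2) <= Re z <= 1 / 2 /\ 0 <= Im z <= s.
Proof.
by rewrite /rectangle /= (lat_s H) ler_norml !mul1r.
Qed.

Lemma rectangle_sqnorm (z : C) : rectangle Delta z -> sqnorm z <= 1 + 1 / 4 + s ^+ 2.
Proof.
move/rectangleP => [/andP[h1 h2] /andP[h3 h4]]; rewrite /sqnorm.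
have : (Re z) ^+ 2 <= 1 / 4 by nra.
have : (Im z) ^+ 2 <= s ^+ 2 by nra.
lra.
Qed.

Lemma ht_act_eq_den (a b c d : C) P : half_space P -> a * d - b * c = 1 ->
  (act (psl a b c d) P).2 = P.2 -> den c d P = 1.
Proof.
move=> hP h; have t0 : 0 < P.2 := hP; have D0 := den_gt0 hP h.
rewrite ht_psl // => ht; apply: (mulfI (lt0r_neq0 t0)).
by rewrite mulr1 -{1}ht divfK // gt_eqF.
Qed.

Lemma ford_act P g : F P -> g \in G -> (act g P).2 = P.2 -> rectangle Delta (act g P).1 ->
  F (act g P).
Proof.
move=> [hP _ hmax] gG ht rect; split=> //; first exact: half_space_act.
by move=> k kG; rewrite -act_mul // ht; apply: hmax; exact: groupM.
Qed.

(** The bottom rows of g and of its inverse lie in a finite list and together determine g. A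
    clearance of 7 eta at z leaves 4 eta at w, and still eta at z for the sphere found over w. *)
Lemma floor_point (l : seq (C * C)) (z : C) (t : R) (w : C) (x0 : C * C) (eta : R) :
  (forall (c d : C) P, c \in O -> d \in O -> t <= P.2 -> sqnorm P.1 <= 1 + 1 / 4 + s ^+ 2 ->
     forall D, den c d P <= D -> D <= 1 + 1 / 4 + s ^+ 2 -> (c, d) \in l) ->
  outer O (z, t) -> rectangle Delta w -> is_row O x0 -> x0.1 != 0 ->
  0 < eta -> eta <= 1 -> t ^+ 2 + 7 * eta <= sphere_ht x0 z -> sqnorm (w - z) <= eta ^+ 2 ->
  exists y : (C * C) * (C * C),
   [/\ y.1 \in l /\ y.2 \in l, y.2.1 = - y.1.1,
    y.1.1 != 0 /\ t ^+ 2 < sphere_ht y.1 z &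
    exists b u, [/\ y.2.2 * y.1.2 - b * y.1.1 = 1, psl y.2.2 b y.1.1 y.1.2 \in G, u < 2 / 3,
      F (w, u) & F (act (psl y.2.2 b y.1.1 y.1.2) (w, u))]].
Proof.
move=> hl oP rw r0 c0 e0 e1 he wz.
have t0 : 0 < t := outer_half oP.
have t20 : 0 < t ^+ 2 by rewrite exprn_gt0.
have x0w : t ^+ 2 + 4 * eta <= sphere_ht x0 w.
  have n1 : 1 <= sqnorm x0.1 by apply: (sqnorm_ge1 H); case: r0.
  have wz' : sqnorm (z - w) <= eta ^+ 2 by rewrite -sqnormN opprB.
  have := sphere_ht_near e0 e1 wz' n1; lra.
have x0w0 : 0 < sphere_ht x0 w by lra.
have [[c d] [[/= cO dO [a [b [h aO bO]]]] cn le hmax]] := top_sphere H r0 c0 x0w0.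
have xw : 0 < sphere_ht (c, d) w by lra.
have xz : t ^+ 2 < sphere_ht (c, d) z.
  have := sphere_ht_near e0 e1 wz (sqnorm_ge1 H cO cn : 1 <= sqnorm (c, d).1); lra.
(* The sphere covers the outer point (z, t), so it is no unit sphere; by the norm gap its radius is
   at most 1/2, and the floor point is low. *)
have c4 : 4 <= sqnorm c.
  case: (lattice_gap H cO) => [ec|ec|ec|//]; first by rewrite ec eqxx in cn.
  - have := oP.2 _ dO; move: xz; rewrite /nq /sphere_ht ec /= divr1.
    by have -> : sqnorm (1 : C) = 1; [rewrite /sqnorm !cE; ring | rewrite invr1; lra].
  - have dO' : - d \in O by rewrite rpredN.
    have := oP.2 _ dO'; move: xz; rewrite /nq /sphere_ht ec /= invrN invr1 mulrN1.
    by have -> : sqnorm (-1 : C) = 1; [rewrite /sqnorm !cE; ring | rewrite invr1; lra].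
set u := Num.sqrt (sphere_ht (c, d) w) in hmax.
have u0 : 0 < u by rewrite sqrtr_gt0.
have u2 : u ^+ 2 = sphere_ht (c, d) w by rewrite sqr_sqrtr // ltW.
have u4 : u ^+ 2 <= 1 / 4.
  rewrite u2 /sphere_ht /=; have := sqnorm_ge0 (w + d / c).
  have : (sqnorm c)^-1 <= 1 / 4.
    by rewrite -[1 / 4]invrK lef_pV2 ?posrE ?invr_gt0; lra.
  lra.
have tu : t <= u by nra.
have FP : F (w, u) by [].
have hP : half_space (w, u) by [].
have den1 : den c d (w, u) = 1 by rewrite den_sphere // u2 subrr mulr0 addr0.
(* Translating by -al brings the image into the rectangle and keeps the bottom row. *)
have [al alO [hre him]] := lattice_reduce H (act (psl a b c d) (w, u)).1.
have nalO : - al \in O by rewrite rpredN.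
have gG : psl a b c d \in G by exact: psl_over.
set a' := a - al * c; set b' := b - al * d.
have h' : a' * d - b' * c = 1 by rewrite -[RHS]h /a' /b'; ring.
have eg : psl a' b' c d = (shift (- al) * psl a b c d)%g.
  have h1 : 1 * 1 - (- al) * 0 = 1 :> C by ring.
  by rewrite shiftE psl_mul //; congr psl; rewrite /a' /b'; ring.
have hG : psl a' b' c d \in G by rewrite eg; apply: groupM => //; exact: shift_over.
have ht : (act (psl a' b' c d) (w, u)).2 = u by rewrite ht_psl // den1 divr1.
have rect' : rectangle Delta (act (psl a' b' c d) (w, u)).1.
  by rewrite eg act_mul // act_shift /=; apply/rectangleP.
have FP' : F (act (psl a' b' c d) (w, u)) by exact: ford_act.
have a'O : a' \in O by rewrite rpredB // rpredM.
have s20 := sqr_ge0 s.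
exists ((c, d), (- c, a')); split=> //=.
- split.
    by apply: (hl c d (w, u) cO dO tu (rectangle_sqnorm rw) 1); [rewrite den1 | lra].
  have ncO : - c \in O by rewrite rpredN.
  apply: (hl (- c) a' _ ncO a'O _ (rectangle_sqnorm rect') 1); rewrite ?ht //; last by lra.
  have h2 : d * a' - (- b') * (- c) = 1 by rewrite -[RHS]h'; ring.
  rewrite (ht_act_eq_den _ h2) //; first exact: half_space_act.
  by rewrite ht -psl_inv // actK.
- exists b', u; split=> //; nra.
Qed.

(* Points on a parabola near z are in general position, so by the pigeonhole
   principle one pairing of the floor of F contains three of them and is thus
   two-dimensional; by continuity its isometric sphere still covers Q. *)
Lemma raise Q g0 : outer O Q -> rectangle Delta Q.1 -> g0 \in G -> Q.2 < (act g0 Q).2 ->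
  exists2 b, b \in Gamma O Delta & Q.2 < (act b Q).2.
Proof.
case: Q => z t oP rect /PSL2_overP[a0 [b0 [c0 [d0 [h0 [a0O b0O c0O d0O] ->]]]]].
have hP := outer_half oP; have t0 : 0 < t := hP; have D0 := den_gt0 hP h0.
rewrite ht_psl // ltr_pdivlMr // gtr_pMr // => den0.
have c00 : c0 != 0.
  apply/eqP => ec; have dn : d0 != 0.
    by apply: contra_eq_neq h0 => ->; rewrite ec !mulr0 subrr eq_sym oner_neq0.
  move: den0; rewrite /den ec mul0r add0r; have := sqnorm_ge1 H d0O dn.
  by have := mulr_ge0 (sqnorm_ge0 (0 : C)) (sqr_ge0 t); rewrite /=; lra.
have n0 := sqnorm_gt0 c00.
have phi0 : t ^+ 2 < sphere_ht (c0, d0) z.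
  by move: den0; rewrite den_sphere //; nra.
have r0 : is_row O (c0, d0) by split=> //=; exists a0, b0.
pose eta := Num.min 1 ((sphere_ht (c0, d0) z - t ^+ 2) / 7).
have e0 : 0 < eta by rewrite lt_min ltr01 /= divr_gt0 //; lra.
have e1 : eta <= 1 by rewrite ge_min lexx.
have e7 : t ^+ 2 + 7 * eta <= sphere_ht (c0, d0) z.
  have : eta <= (sphere_ht (c0, d0) z - t ^+ 2) / 7 by rewrite ge_min lexx orbT.
  lra.
have [l hl] := rows_finite H (1 + 1 / 4 + s ^+ 2) t0.
pose rho (j : nat) : R := eta / 2 / (j.+1)%:R.
have rho0 j : 0 < rho j by rewrite !divr_gt0.
have rho1 j : rho j <= eta / 2.
  by rewrite ler_pdivrMr // ler_peMr ?ler1n // divr_ge0 // ltW.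
have rho_lt i j : (i < j)%N -> rho j < rho i.
  by move=> ij; rewrite ltr_pM2l ?divr_gt0 // ltf_pV2 ?posrE // ltr_nat.
have /rectangleP [/andP[x1 x2] /andP[y1 y2]] := rect.
have s1 := s_gt1 H.
(* The signs keep the parabola in the rectangle even if z is on its boundary. *)
have [sx [sx2 hsx]] : exists sx : R, sx ^+ 2 = 1 /\ forall r, 0 < r -> r <= 1 / 2 -> - (1 / 2) <= Re z + sx * r <= 1 / 2.
  have [p|p] := ltP 0 (Re z).
    by exists (-1); split; [ring | move=> r r0' r1; lra].
  by exists 1; split; [ring | move=> r r0' r1; lra].
have [sy [sy2 hsy]] : exists sy : R, sy ^+ 2 = 1 /\ forall r, 0 < r -> r <= 1 / 2 -> 0 <= Im z + sy * r <= s.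
  have [p|p] := ltP (s / 2) (Im z).
    by exists (-1); split; [ring | move=> r r0' r1; lra].
  by exists 1; split; [ring | move=> r r0' r1; lra].
pose w j := Complex (Re z + sx * rho j) (Im z + sy * (rho j) ^+ 2).
have wrect j : rectangle Delta (w j).
  have r0' := rho0 j; have r1 := rho1 j; apply/rectangleP; split; [apply: hsx => //; lra|].
  by apply: hsy; [rewrite exprn_gt0 | nra].
have wz j : sqnorm (w j - z) <= eta ^+ 2.
  have r0' := rho0 j; have r1 := rho1 j.
  have -> : sqnorm (w j - z) = sx ^+ 2 * rho j ^+ 2 + sy ^+ 2 * (rho j ^+ 2) ^+ 2.
    by rewrite /sqnorm !cE; ring.
  rewrite sx2 sy2 !mul1r.
  have q1 : rho j ^+ 2 <= eta ^+ 2 / 4 by nra.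
  have q2 : rho j ^+ 2 <= 1 by nra.
  have := sqr_ge0 (rho j); nra.
have pt j := floor_point hl oP (wrect j) r0 c00 e0 e1 e7 (wz j).
have [f hf] := choice pt.
have fl n : (0 <= n)%N -> f n \in [seq (x, y) | x <- l, y <- l].
  move=> _; have [[l1 l2] _ _ _] := hf n; apply/allpairsP; exists (f n); split=> //.
  by case: (f n).
have [[[c d] [c' a]] hx] := infinite_pigeonhole fl.
have [i _ fi] := hx 0%N; have [j ij fj] := hx i.+1; have [k jk fk] := hx j.+1.
have := hf i; rewrite fi => -[_ _ [cn phi] [b1 [u1 [hb1 gG u23 F1 F1']]]].
have := hf j; rewrite fj => -[_ _ _ [b2 [u2 [hb2 _ _ F2 F2']]]].
have := hf k; rewrite fk => -[_ _ _ [b3 [u3 [hb3 _ _ F3 F3']]]].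
have eqb b b' : a * d - b * c = 1 -> a * d - b' * c = 1 -> b = b'.
  by move=> e2 e3; apply: (mulIf cn); apply: oppr_inj; apply: (addrI (a * d)); rewrite e2 e3.
rewrite -(eqb _ _ hb1 hb2) in F2'; rewrite -(eqb _ _ hb1 hb3) in F3'.
have nc : Im ((w j - w i) * (w k - w i)^*) != 0.
  have ri := rho_lt _ _ ij; have rj := rho_lt _ _ jk; have rik := lt_trans rj ri.
  (* A Vandermonde determinant in the three parameters. *)
  have -> : Im ((w j - w i) * (w k - w i)^*) =
      sx * sy * ((rho i - rho j) * (rho i - rho k) * (rho j - rho k)).
    by rewrite !cE; ring.
  have nz (x : R) : x ^+ 2 = 1 -> x != 0.
    by move=> x21; apply: contra_eq_neq x21 => ->; rewrite expr0n eq_sym oner_neq0.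
  have gt_nz (x y : R) : y < x -> x - y != 0 by move=> xy; rewrite subr_eq0 gt_eqF.
  by do ?apply: mulf_neq0; do ?[exact: nz | exact: gt_nz].
exists (psl a b1 c d).
  exact: (low_floor_pairing (a := a) (b := b1) (c := c) (d := d) gG hb1 cn (conj F1 F1') (conj F2 F2') (conj F3 F3') nc u23).
have hb0 := den_gt0 hP hb1; rewrite (ht_psl _ hb1) ltr_pdivlMr // gtr_pMr // den_sphere //.
have n1 : 0 < sqnorm c := sqnorm_gt0 cn.
have phi' : t ^+ 2 < sphere_ht (c, d) z := phi.
nra.
Qed.

(** The test point (0, 2) is so high that a matrix over O not lowering it has den = |d|^2 + 4 |c|^2
    <= 1, hence c = 0. By [raise], the best x found inside [X] is best in PSL2(O), so x g^-1 is such
    a matrix. *)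
Lemma generation (X : PSL2 C -> Prop) : X 1%g ->
  (forall a g, a \in A -> X g -> X (a * g)%g) ->
  (forall b g, b \in Gamma O Delta -> X g -> X (b * g)%g) ->
  forall g, g \in G -> X g.
Proof.
move=> X1 XA XB g gG.
pose P0 : C * R := (0, 2); have hP0 : half_space P0 by rewrite /half_space /=; lra.
pose P := act g^-1%g P0; have hP : half_space P by exact: half_space_act.
have [x [[xX xG] xmax]] := orbit_max H (E := fun x => X x /\ x \in G) hP (fun _ h => proj2 h)
  (ex_intro _ 1%g (conj X1 (group1 G))).
have hxP : half_space (act x P) by exact: half_space_act.
have oxP : outer O (act x P).
  apply: max_outer => // a aA; rewrite -act_mul //; apply: xmax; split; first exact: XA.
  by apply: groupM => //; exact: PE2_over H _ aA.
have [al alO [h1 h2]] := lattice_reduce H (act x P).1.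
have nalO : - al \in O by rewrite rpredN.
set Q := act (shift (- al)) (act x P).
have oQ : outer O Q by exact: outer_shift.
have rQ : rectangle Delta Q.1 by rewrite /Q act_shift; apply/rectangleP.
have tQ : Q.2 = (act x P).2 by rewrite /Q act_shift.
have top k : k \in G -> (act k Q).2 <= Q.2.
  move=> kG; rewrite leNgt; apply/negP => /(raise oQ rQ kG)[b bB]; apply/negP; rewrite -leNgt.
  have -> : act b Q = act (b * (shift (- al) * x))%g P by rewrite !act_mul //; exact: half_space_act.
  rewrite tQ; apply: xmax; split.
    by apply: XB => //; apply: XA => //; exact: shift_PE2.
  apply: groupM; first exact: (Gamma_over H).
  by apply: groupM => //; exact: shift_over.
have hQ : half_space Q by exact: outer_half oQ.
have xgG : (x * g^-1)%g \in G by apply: groupM => //; exact: groupV.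
have tall : 2 <= (act (x * g^-1)%g P0).2.
  rewrite act_mul // -/P -tQ.
  have : (act (g * x^-1 * (shift (- al))^-1)%g Q).2 <= Q.2.
    apply: top; apply: groupM; last by apply: groupV; exact: shift_over.
    by apply: groupM => //; exact: groupV.
  by rewrite act_mul // /Q actK // act_mul // actK // actVK.
move: xgG tall => /PSL2_overP[a [b [c [d [h [aO bO cO dO] exg]]]]].
rewrite exg ht_psl //= ler_pdivlMr; last exact: den_gt0 hP0 h.
rewrite /den /= => D1.
have c0 : c = 0.
  apply/eqP; apply/negP => /negP cn; have := sqnorm_ge1 H cO cn.
  by have := sqnorm_ge0 (c * 0 + d); lra.
have xgA : (x * g^-1)%g \in A.
  by rewrite exg c0; apply: (shift_psl_unit H) => //; move: h; rewrite c0 mulr0 subr0.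
have -> : g = ((x * g^-1)^-1 * x)%g by rewrite invgM invgK -mulgA mulVg mulg1.
by apply: XA => //; exact: groupV.
Qed.

End Raise.

(** * N in Gamma, and nontriviality *)

Section Nontrivial.
Variable R : realType.
Local Notation C := R[i].
Local Notation Re := complex.Re.
Local Notation Im := complex.Im.
Variables (O : subringClosed C) (Delta : int) (s e : R).
Hypothesis H : order_lattice O Delta s e.
Local Notation tau := (tau R Delta).
Local Notation N := (Ngroup R Delta).
Local Notation A := (PE2 O).
Local Notation G := (PSL2_over O).
Local Notation F := (ford_domain O Delta).

Lemma sqr_add_int (x : R) (m : int) : - (1 / 2) <= x <= 1 / 2 -> x ^+ 2 <= (x + m%:~R) ^+ 2.
Proof.
move=> /andP[h1 h2]; have [m0|m0] := eqVneq m 0; first by rewrite m0 addr0.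
have [m1|m1] : 1 <= m \/ m <= -1 by lia.
  have : (1%:~R : R) <= m%:~R by rewrite ler_int.
  nra.
have : (m%:~R : R) <= (-1)%:~R by rewrite ler_int.
rewrite rmorphN /=; nra.
Qed.

(* In the rectangle only the balls centred on its two horizontal sides matter. *)
Lemma outer_rectangle x y t : 0 < t -> - (1 / 2) <= x <= 1 / 2 -> 0 <= y <= s ->
  1 <= x ^+ 2 + y ^+ 2 + t ^+ 2 ->
  (forall m : int, 1 <= (x - e + m%:~R) ^+ 2 + (s - y) ^+ 2 + t ^+ 2) ->
  outer O (Complex x y, t).
Proof.
move=> t0 hx /andP[y0 y1] r0 r1; split=> // a /(latP H)[m [k [hR hI]]].
rewrite /nq /sqnorm !cE /= hR hI; have s1 := s_gt1 H.
have t2 := sqr_ge0 t; have s2 : 1 <= s ^+ 2 by nra.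
have [k0|[k0|[k0|k0]]] : k = 0 \/ k = -1 \/ 1 <= k \/ k <= -2 by lia.
- rewrite k0 !mul0r !addr0; have := sqr_add_int m hx; lra.
- have := r1 m; rewrite k0 rmorphN /=.
  have -> : (s - y) ^+ 2 = (y + -1 * s) ^+ 2 by ring.
  by have -> : x - e + m%:~R = x + (m%:~R + -1 * e) by ring.
- have k1 : (1%:~R : R) <= k%:~R by rewrite ler_int.
  have : s <= y + k%:~R * s by nra.
  have := sqr_ge0 (x + (m%:~R + k%:~R * e)); nra.
- have k1 : (k%:~R : R) <= (-2)%:~R by rewrite ler_int.
  rewrite rmorphN /= in k1.
  have : y + k%:~R * s <= - s by nra.
  have := sqr_ge0 (x + (m%:~R + k%:~R * e)); nra.
Qed.

Lemma ford_rectangle x y t : 1 / 2 <= t -> - (1 / 2) <= x <= 1 / 2 -> 0 <= y <= s ->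
  1 <= x ^+ 2 + y ^+ 2 + t ^+ 2 ->
  (forall m : int, 1 <= (x - e + m%:~R) ^+ 2 + (s - y) ^+ 2 + t ^+ 2) ->
  F (Complex x y, t).
Proof.
move=> t2 hx hy r0 r1; have t0 : 0 < t by lra.
have o := outer_rectangle t0 hx hy r0 r1.
split=> //; first by apply/(rectangleP H).
by move=> g gG; apply: (outer_max H).
Qed.

Lemma ford_bottom x y t : 0 <= x <= 1 / 2 -> 0 <= y <= 4 / 5 -> 1 / 2 <= t ->
  x ^+ 2 + y ^+ 2 + t ^+ 2 = 1 -> F (Complex x y, t) /\ F (act (rot C) (Complex x y, t)).
Proof.
move=> /andP[x0 x1] /andP[y0 y1] t1 e1; have s1 := s_gt1 H.
have t0 : 0 < t by lra.
have FP : F (Complex x y, t).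
  apply: ford_rectangle; try lra.
  by move=> m; have := sqr_ge0 (x - e + m%:~R); have := sqr_ge0 t; nra.
split=> //; have nq1 : nq (Complex x y, t) = 1 by [].
apply: ford_act => //; first exact: rot_over.
  by rewrite act_rotE // nq1 !divr1.
by apply/(rectangleP H); rewrite act_rotE // nq1 !divr1 /=; lra.
Qed.

Lemma rot_Gamma : rot C \in Gamma O Delta.
Proof.
have c0 : 1 != 0 :> C by exact: oner_neq0.
have h : 0 * 0 - (-1) * 1 = 1 :> C by ring.
pose T x y t := F (Complex x y, t) /\ F (act (rot C) (Complex x y, t)).
(* Pythagorean triples give rational points of the unit sphere; 3/5 < 2/3 makes the face low. *)
have F1 : T 0 (4 / 5) (3 / 5) by apply: ford_bottom; lra.
have F2 : T 0 0 1 by apply: ford_bottom; lra.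
have F3 : T (7 / 25) 0 (24 / 25) by apply: ford_bottom; lra.
rewrite /T rotE in F1 F2 F3 *.
apply: (low_floor_pairing _ h c0 F1 F2 F3).
- by rewrite -rotE; exact: rot_over.
- by rewrite !cE; apply/eqP; lra.
- by change (3 / 5 < 2 / 3 :> R); lra.
Qed.

Lemma ford_wall x y t : x = 1 / 2 \/ x = - (1 / 2) -> 0 <= y <= s ->
  1 / 2 <= t -> 1 <= t \/ y = s / 2 -> F (Complex x y, t).
Proof.
move=> hx hy ht h; have s2 := lat_s2 H.
have x2 : x ^+ 2 = 1 / 4 by case: hx => ->; lra.
apply: ford_rectangle => //.
- by case: hx => ->; lra.
- rewrite x2; have := sqr_ge0 y; case: h => [t1|->]; first by nra.
  nra.
- move=> m; have := sqr_ge0 (x - e + m%:~R); have := sqr_ge0 (s - y); case: h => [t1|->]; first by nra.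
  nra.
Qed.

(** The face lies in the wall Re = 1/2, where projections are collinear, so lines are excluded
    directly: two points on one vertical and a third off it. At the middle of the side, s^2 / 4 >=
    15/16 leaves room for the height 3/5. *)
Lemma shift1_Gamma : shift 1 \in Gamma O Delta.
Proof.
have s1 := s_gt1 H.
have mem y t : 0 <= y <= s -> 1 / 2 <= t -> 1 <= t \/ y = s / 2 ->
    face O Delta (shift 1) (Complex (1 / 2) y, t).
  move=> hy ht h; split; first by apply: ford_wall => //; left.
  exists (Complex (- (1 / 2)) y, t); first by apply: ford_wall => //; right.
  by rewrite act_shift /=; congr pair; apply: complex_eqP; rewrite !cE; field.
apply: mem_gen; split; last first.
  by exists (Complex (1 / 2) (s / 2), 3 / 5); [apply: mem; lra | change (3 / 5 < 2 / 3 :> R); lra].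
have m1 : face O Delta (shift 1) (Complex (1 / 2) (s / 2), 1) by apply: mem; lra.
have m2 : face O Delta (shift 1) (Complex (1 / 2) (s / 2), 2) by apply: mem; lra.
have m3 : face O Delta (shift 1) (Complex (1 / 2) 0, 1) by apply: mem; lra.
split; first by apply: shift_over; exact: rpred1.
  apply/eqP => /(congr1 (fun g => (act g ((0 : C), (1 : R))).1)).
  rewrite act1 act_shift /= add0r => /eqP; exact/negP/oner_neq0.
split.
  exists (vertical_plane (Complex (1 / 2) 0) (Complex 0 1)).
    right; exists (Complex (1 / 2) 0), (Complex 0 1); split=> //.
    by apply/eqP => /(congr1 (@complex.Im R)) /= /eqP; exact/negP/oner_neq0.
  move=> P [FP [P' FP' eP]]; case: FP => hP /(rectangleP H)[/andP[_ x1] _] _.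
  case: FP' => _ /(rectangleP H)[/andP[x2 _] _] _.
  split=> //; rewrite !cE; move: eP; rewrite act_shift => /(congr1 (fun Q => Re Q.1)) /=.
  by rewrite !cE; lra.
move=> [L [[z ->]|[z [rho [u [_ _ ->]]]]] SL].
  have [_ /= e1] := SL _ m1; have [_ /= e3] := SL _ m3.
  have := congr1 (@complex.Im R) e1; rewrite -e3 /=; lra.
have [[_ /= e1] _] := SL _ m1; have [[_ /= e2] _] := SL _ m2.
by have := etrans e1 (esym e2); lra.
Qed.

(** The ball is centred at tau - 2e because for e = 1/2 its part with x in [0, 1/2] lies over the
    rectangle; the pairing maps it to its mirror image on the ball around tau. It differs from the
    generator of N by s(2e), which is 1 or s(1). *)
Lemma ford_top x v t : 0 <= x <= 1 / 2 -> 0 <= v <= 4 / 5 -> 1 / 2 <= t ->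
  x ^+ 2 + v ^+ 2 + t ^+ 2 = 1 ->
  F (Complex (x - e) (s - v), t) /\
  F (act (shift tau * rot C * shift ((2 * e)%:C%C - tau))%g (Complex (x - e) (s - v), t)).
Proof.
move=> hx hv ht e1; have s1 := s_gt1 H.
have /andP[x0 x1] := hx; have /andP[v0 v1] := hv.
have ecase := e_cases H.
have [E he] : exists E : int, 2 * e = E%:~R by case: ecase => ->; [exists 0 | exists 1]; lra.
have t0 : 0 < t by lra.
have hxe : - (1 / 2) <= x - e <= 1 / 2 by case: ecase => ->; lra.
have FP : F (Complex (x - e) (s - v), t).
  apply: ford_rectangle => //; first by lra.
  - by have := sqr_ge0 (x - e); have := sqr_ge0 t; nra.
  - move=> m; have hx' : - (1 / 2) <= x <= 1 / 2 by lra.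
    have := sqr_add_int (m - E) hx'; rewrite rmorphB /= -he.
    have -> : x - e - e + m%:~R = x + (m%:~R - 2 * e) by ring.
    have -> : s - (s - v) = v by ring.
    lra.
split=> //.
have EO : (2 * e)%:C%C - tau \in O.
  rewrite rpredB ?(tau_mem H) //.
  have -> : (2 * e)%:C%C = E%:~R :> C by rewrite he; apply: complex_eqP; rewrite !cE.
  exact: int_mem.
have gG : (shift tau * rot C * shift ((2 * e)%:C%C - tau))%g \in G.
  apply: groupM; last exact: shift_over.
  by apply: groupM; [apply: shift_over; exact: tau_mem H | exact: rot_over].
have eact : act (shift tau * rot C * shift ((2 * e)%:C%C - tau))%g (Complex (x - e) (s - v), t)
    = (Complex (e - x) (s - v), t).
  have hP : half_space (Complex (x - e) (s - v), t) by [].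
  rewrite !act_mul //; last by exact: half_space_act.
  have -> : act (shift ((2 * e)%:C%C - tau)) (Complex (x - e) (s - v), t) = (Complex x (- v), t).
    by rewrite act_shift (lat_tau H); congr pair; apply: complex_eqP; rewrite !cE; ring.
  have hQ : half_space (Complex x (- v), t) by [].
  have nq1 : nq (Complex x (- v), t) = 1 by rewrite /nq /sqnorm /= sqrrN.
  rewrite act_rotE // nq1 !divr1 act_shift (lat_tau H); congr pair.
  by apply: complex_eqP; rewrite !cE; ring.
apply: ford_act => //; rewrite eact //.
by apply/(rectangleP H) => /=; split; [case: ecase => ->|]; lra.
Qed.

Lemma rot_tau_Gamma : (shift tau * rot C * shift (- tau))%g \in Gamma O Delta.
Proof.
have c0 : 1 != 0 :> C by exact: oner_neq0.
set x := (2 * e)%:C%C - tau.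
have h : tau * x - (tau * x - 1) * 1 = 1 :> C by ring.
have eg : (shift tau * rot C * shift x)%g = psl tau (tau * x - 1) 1 x.
  rewrite !shiftE rotE psl_mul ?psl_mul; try ring.
  by congr psl; ring.
pose T u v t := F (Complex (u - e) (s - v), t) /\
  F (act (shift tau * rot C * shift x)%g (Complex (u - e) (s - v), t)).
have F1 : T 0 (4 / 5) (3 / 5) by apply: ford_top; lra.
have F2 : T 0 0 1 by apply: ford_top; lra.
have F3 : T (7 / 25) 0 (24 / 25) by apply: ford_top; lra.
rewrite /T eg in F1 F2 F3.
have xO : x \in O.
  rewrite rpredB ?(tau_mem H) //.
  have [E he] : exists E : int, 2 * e = E%:~R by case: (e_cases H) => ->; [exists 0 | exists 1]; lra.
  have -> : (2 * e)%:C%C = E%:~R :> C by rewrite he; apply: complex_eqP; rewrite !cE.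
  exact: int_mem.
have hB : (shift tau * rot C * shift x)%g \in Gamma O Delta.
  rewrite eg; apply: (low_floor_pairing _ h c0 F1 F2 F3).
  - by apply: psl_over => //; rewrite ?rpredB ?rpredM ?rpred1 ?(tau_mem H).
  - by rewrite !cE; apply/eqP; lra.
  - by change (3 / 5 < 2 / 3 :> R); lra.
have -> : (shift tau * rot C * shift (- tau))%g = (shift tau * rot C * shift x * shift (- (2 * e)%:C%C))%g.
  by rewrite -[in RHS]mulgA shift_mul /x; congr (_ * shift _)%g; ring.
apply: groupM => //; case: (e_cases H) => ->.
  by rewrite mulr0 rmorph0 oppr0 shift0; exact: group1.
have -> : 2 * (1 / 2) = 1 :> R by field.
by rewrite rmorph1 -shift_inv; apply: groupV; exact: shift1_Gamma.
Qed.

Lemma N_Gamma : {subset N <= Gamma O Delta}.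
Proof.
apply: gen_sub => g [] ->; [exact: rot_Gamma | exact: shift1_Gamma |].
by rewrite shift_inv; exact: rot_tau_Gamma.
Qed.

Lemma outer02 : outer O (0, 2).
Proof. by apply: outer_up (outer01 O) _; lra. Qed.

Lemma word_sinks l b : l <> [::] -> reduced O l -> b \in O -> (act (word l b) (0, 2)).2 <= 1 / 2.
Proof.
have oP := outer02; have hP := outer_half oP.
elim: l => [//|a l IH] _ lr bO.
have lr' := reduced_behead lr; have n1 := word_nq_tail oP lr bO.
have hY : half_space (act (word l b) (0, 2)) by exact: half_space_act.
rewrite act_word_cons // ht_shift ht_rot // ler_pdivrMr ?nq_gt0 //.
case: l IH lr lr' n1 hY => [|a' l] IH lr lr' n1 hY.
  change (word [::] b) with (shift b).
  by rewrite act_shift /nq /=; have := sqnorm_ge0 (0 + b); lra.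
have nz : a' :: l <> [::] by [].
by have := IH nz lr' bO; lra.
Qed.

(** Any r in a reduced form would sink (0, 2), so every such form of s(tau) is a bare translation
    with total Im equal to s, whereas elements of N have a form with total 0. *)
Lemma shift_tau_notin_N : shift tau \notin N.
Proof.
apply/negP => /(N_nform H)[l [b [lr bO ew hs]]].
case: l lr ew hs => [|a l] lr ew hs.
  have := congr1 (fun g => Im (act g ((0 : C), (1 : R))).1) ew; rewrite !act_shift /= !cE.
  move: hs; rewrite /height_sum big_nil (lat_tau H) /=.
  by have := s_gt0 H; lra.
have nz : a :: l <> [::] by [].
have := word_sinks nz lr bO; rewrite -ew ht_shift.
by change (2 <= 1 / 2 :> R -> False); lra.
Qed.

(** Here Q = |k|^2 for k = 11 + 10 i s, and lam is just below 1/22. From s^2 >= 15/4 follows Q >=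
    496 > 22^2, which leaves room for |lam k| >= 1; the upper side is at distance at least 12 s / 22
    > 1. *)
Lemma outer_gap_point (Q lam t : R) : Q = 121 + 100 * s ^+ 2 -> lam * (22 * Q + 1) = Q -> 0 < t ->
  outer O (Complex (11 * lam) (10 * s * lam), t).
Proof.
move=> eQ lp t0; have s1 := s_gt1 H; have s0 := s_gt0 H; have s2 := lat_s2 H.
have Q0 : 496 <= Q by lra.
set p := 22 * Q + 1 in lp; have p0 : 0 < p by rewrite /p; lra.
have lE : lam = Q / p by rewrite -lp mulfK // gt_eqF.
have l0 : 0 < lam by rewrite lE divr_gt0 //; lra.
have l1 : lam < 1 / 22 by rewrite lE ltr_pdivrMr // /p; lra.
have l2 : 1 <= lam ^+ 2 * Q.
  rewrite lE exprMn exprVn mulrAC ler_pdivlMr ?exprn_gt0 // mul1r /p.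
  have : 496 * Q ^+ 2 <= Q ^+ 2 * Q by rewrite mulrC ler_wpM2l ?sqr_ge0.
  nra.
have sl : s * lam <= s * (1 / 22) by rewrite ler_wpM2l //; lra.
have sl0 : 0 <= s * lam by rewrite mulr_ge0 //; lra.
have t2 := sqr_ge0 t.
apply: outer_rectangle => //; try lra.
- have -> : (11 * lam) ^+ 2 + (10 * s * lam) ^+ 2 = lam ^+ 2 * Q by rewrite eQ; ring.
  lra.
- move=> m; have := sqr_ge0 (11 * lam - e + m%:~R).
  have h1 : s * (12 / 22) <= s - 10 * s * lam by lra.
  have h2 : (s * (12 / 22)) ^+ 2 <= (s - 10 * s * lam) ^+ 2.
    by rewrite lerXn2r // nnegrE; lra.
  lra.
Qed.

Lemma gap_det (k k' q : C) : q = k * k' ->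
  10648%:~R * q * k' * - (q * k) - - (484%:~R * q * q - 22%:~R * q + 1) * (22%:~R * q + 1) = 1.
Proof. by move=> ->; ring. Qed.

(* With k = 11 + 5 sqrt Delta, q = |k|^2 and p = 22 q + 1, the row (p, - q k) is
   unimodular because p divides 22^3 q^3 + 1, and its cusp q k / p is so close to
   k / 22 = 1/2 + 5 i s / 11 that it lies outside all unit discs centred in O. *)
Lemma nonelementary : exists2 g, g \in G & g \notin A.
Proof.
have s0 := s_gt0 H; have s2 := lat_s2 H.
have rO := sqrt_disc_mem H.
pose k : C := 11%:~R + 5%:~R * Complex 0 (2 * s).
pose k' : C := 11%:~R - 5%:~R * Complex 0 (2 * s).
have kO : k \in O by rewrite rpredD ?rpredM ?int_mem.
have k'O : k' \in O by rewrite rpredB ?rpredM ?int_mem.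
pose q := k * k'.
have qO : q \in O by rewrite rpredM.
pose Q : R := 121 + 100 * s ^+ 2.
have Q0 : 496 <= Q by rewrite /Q; lra.
have qE : q = (Q%:C)%C by apply: complex_eqP; rewrite /q /k /k' /Q !cE; ring.
pose p : R := 22 * Q + 1.
have p0 : 0 < p by rewrite /p; lra.
pose a : C := 10648%:~R * q * k'; pose b : C := - (484%:~R * q * q - 22%:~R * q + 1).
pose c : C := 22%:~R * q + 1; pose d : C := - (q * k).
have h : a * d - b * c = 1.
  by rewrite /a /b /c /d; apply: gap_det.
have mO (m : int) x : x \in O -> m%:~R * x \in O.
  by move=> xO; exact: (rpredM (int_mem O m) xO).
have aO : a \in O by apply: (rpredM (mO _ _ qO) k'O).
have bO : b \in O.
  rewrite rpredN; apply: (rpredD (rpredB _ (mO _ _ qO)) (rpred1 O)).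
  exact: (rpredM (mO _ _ qO) qO).
have cO : c \in O by apply: (rpredD (mO _ _ qO) (rpred1 O)).
have dO : d \in O by rewrite rpredN; exact: (rpredM qO kO).
clearbody a b.
have cE' : c = (p%:C)%C by rewrite /c qE; apply: complex_eqP; rewrite !cE /p; ring.
(* At this height over the cusp den is |c|^2 t^2 = 1/4, so g raises an outer point fourfold, as no
   element of PE2(O) can. *)
pose t : R := 1 / (2 * p).
have t0 : 0 < t by rewrite divr_gt0 // mulr_gt0.
pose lam := Q / p.
have lp : lam * p = Q by rewrite divfK // gt_eqF.
have oP : outer O (Complex (11 * lam) (10 * s * lam), t) by exact: outer_gap_point (erefl Q) lp t0.
exists (psl a b c d).
  exact: psl_over h aO bO cO dO.
apply/negP => gA; have := PE2_ht H oP gA; rewrite ht_psl //.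
have -> : den c d (Complex (11 * lam) (10 * s * lam), t) = 1 / 4.
  rewrite /den [(_, t).1]/= [(_, t).2]/=.
  have -> : c * Complex (11 * lam) (10 * s * lam) + d = 0.
    rewrite cE' /d qE /k; apply: complex_eqP; rewrite !cE -lp; ring.
  have -> : sqnorm c = p ^+ 2 by rewrite cE' /sqnorm !cE; ring.
  have -> : sqnorm (0 : C) = 0 by rewrite /sqnorm !cE; ring.
  by rewrite /t; field; rewrite gt_eqF.
by change (t / (1 / 4) <= t -> False); lra.
Qed.

End Nontrivial.

(** * Ping-pong on alternating words *)

Section PingPong.
Variable R : realType.
Local Notation C := R[i].
Variables (O : subringClosed C) (Delta : int) (s e : R).
Hypothesis H : order_lattice O Delta s e.
Local Notation N := (Ngroup R Delta).
Local Notation A := (PE2 O).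
Local Notation B := (Gamma O Delta).

(** A single letter from PE2(O) is exceptional: it keeps the point in [above], so that its value
    differs from 1 only because 1 is in N. *)
Lemma alternating_sides (w : amalgam_word A B) (P : C * R) :
  alternating N w -> above O P ->
  match w with
  | [::] => True
  | [:: inl _] => above O (act (word_val w) P)
  | inl _ :: _ => ~ below O Delta s (act (word_val w) P) /\ ~ above O (act (word_val w) P)
  | inr _ :: _ => below O Delta s (act (word_val w) P)
  end.
Proof.
move=> aw aP; have hP := above_half aP.
elim: w aw => [//|x w IH] [xN sw aw].
have hw : half_space (act (word_val w) P) by exact: half_space_act.
have eact : act (word_val (x :: w)) P = act (letter_val x) (act (word_val w) P) by rewrite -act_mul.
have {IH} := IH aw; rewrite eact; case: x xN sw {eact} => x /= xN.
  case: w aw hw => [|[y|y] w] aw hw // _.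
    by move=> _; rewrite act1; apply: above_PE2 => //; exact: valP.
  by move=> bw; apply: (PE2_pingpong H) => //; exact: valP.
move=> sw ihw; apply: (Gamma_pingpong H (valP x) xN hw).
case: w sw aw hw ihw => [|[y|y] w] // _ aw hw.
  by move=> _; rewrite act1 => /(below_not_above H).
by case: w aw hw => [|z w] aw hw; [move=> ab /(below_not_above H) | case].
Qed.

Lemma alternating_neq1 (w : amalgam_word A B) : w <> [::] -> alternating N w -> word_val w <> 1%g.
Proof.
have a01 : above O ((0 : C), (1 : R)) by apply: above_outer; [exact: outer01 | lra].
case: w => [//|x w] _ aw w1; have := alternating_sides aw a01; rewrite w1 act1.
case: x aw w1 => x; last by move=> _ _ /(below_not_above H).
case: w => [|y w]; last by move=> _ _ [].
move=> [xN _ _] w1 _; have x1 : letter_val (A := A) (B := B) (inl x) = 1%g by rewrite -w1 /= mulg1.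
by rewrite x1 group1 in xN.
Qed.

End PingPong.

Theorem corollary1p5 (R : realType) (K : divringClosed R[i])
    (O : subringClosed R[i]) (Delta : int)
    (hK : imaginary_quadratic_field K) (hO : is_order K O)
    (hDelta : has_discriminant O Delta) (h12 : 12 < `|Delta|) :
  let PSL2O := PSL2_over O in
  let PE2O := PE2 O in
  let GammaO := Gamma O Delta in
  let N := Ngroup R Delta in
  [/\ {subset N <= PE2O},
      {subset N <= GammaO},
      exists f : {multiplicative amalgam PE2O GammaO N -> subgroup_type PSL2O},
        [/\ bijective f,
            forall a : subgroup_type PE2O, val (f (amalgam_inl GammaO N a)) = val a
          & forall b : subgroup_type GammaO, val (f (amalgam_inr PE2O N b)) = val b],
      ~ (N =i PE2O)
    & ~ (N =i GammaO)].
Proof.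
have [s [e H]] := order_latticeP hDelta h12.
split; [exact: N_PE2 H | exact: N_Gamma H | | |].
- apply: amalgam_iso (N_PE2 H) (N_Gamma H) (alternating_neq1 H) _ (PE2_over H) (Gamma_over H) _.
  apply: (generation H (X := fun g => exists w : amalgam_word (PE2 O) (Gamma O Delta), word_val w = g)).
  + by exists [::].
  + by move=> a g aA [w <-]; exists (inl (SubgroupElt aA) :: w).
  + by move=> b g bB [w <-]; exists (inr (SubgroupElt bB) :: w).
- move=> eqN; have := shift_tau_notin_N H; rewrite eqN => /negP; apply.
  exact: shift_PE2 (tau_mem H).
(* If N were Gamma, PE2(O) would contain Gamma and so be all of PSL2(O). *)
- move=> eqN; have [g gG /negP] := nonelementary H; apply.
  apply: (generation H (X := fun g => g \in PE2 O)) gG => [|a k aA kA|b k bB kA].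
  + exact: group1.
  + exact: groupM.
  + by apply: groupM => //; apply: (N_PE2 H); rewrite eqN.
Qed.
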